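(* Let $m\ge 0$ and let $\Sigma$ be a spacelike surface with constant mean curvature $H_0=1$ near the future null-infinity $\mathcal I^+$ of Schwarzschild spacetime of mass $m$, given as the graph $\{\bar v=-P(\mathbf y,s)\}$ of a function $P$ which is smooth on $\mathbb S^2\times(0,s_0]$ for some $s_0>0$. Suppose $P$ is at least $C^4$ up to $s=0$, and let $f(\mathbf y)=P(\mathbf y,0)$ be the boundary value of $P$ at $\mathcal I^+$. Then: (i) At $s=0$, $P_s,P_{ss},P_{sss}$ can be expressed in terms of $f$ and its derivatives as a function on $\mathbb S^2$ (i.e. by universal differential expressions in $f$ on $\mathbb S^2$). (ii) In general $P_{ssss}|_{s=0}$ cannot be determined by $f$ (i.e. there exist spacelike surfaces with constant mean curvature $1$ near $\mathcal I^+$ of Schwarzschild spacetime of mass $m$, given as graphs $\{\bar v=-P(\mathbf y,s)\}$ of functions $P$ which are smooth on $\mathbb S^2\times(0,s_0]$ for some $s_0>0$ and at least $C^4$ up to $s=0$, with the same boundary value $f$ but different $P_{ssss}|_{s=0}$). (iii) $f$ must satisfy the following compatibility condition on $\mathbb S^2$ in order that $P$ is $C^4$ up to $s=0$: $$0=\tfrac52\,\ell_2\,\widetilde\Delta f+\tfrac34\,\ell_1^3-4\,\ell_1\widetilde\Delta f_1-2\,\widetilde\Delta f_2+6\,\ell_1 f_1+\langle\widetilde\nabla \ell_2,\widetilde\nabla f\rangle+2\langle\widetilde\nabla \ell_1,\widetilde\nabla f_1\rangle,$$ where $$f_1=-\tfrac12(1+|\widetilde\nabla f|^2),\qquad \ell_1=-\widetilde\Delta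 f,\qquad f_2=\tfrac12\langle\widetilde\nabla(|\widetilde\nabla f|^2),\widetilde\nabla f\rangle+\tfrac12\widetilde\Delta f,$$ $$\ell_2=-\tfrac12(\widetilde\Delta f)^2+2\widetilde\Delta|\widetilde\nabla f|^2-2\langle\widetilde\nabla\widetilde\Delta f,\widetilde\nabla f\rangle-2(1+|\widetilde\nabla f|^2).$$ (iv) If $P$ is smooth up to $s=0$, then all derivatives of $P$ at $s=0$ are determined by $f$ and $P_{ssss}|_{s=0}$.
   Context: $\mathbb S^2\subset\mathbb R^3$ is the unit sphere with standard metric $\sigma$; $\widetilde\nabla,\widetilde\Delta$ are the covariant derivative and Laplacian of $(\mathbb S^2,\sigma)$, and $\langle\cdot,\cdot\rangle$, $|\cdot|$ are taken with respect to $\sigma$. For $m\ge0$ put $h(r)=1-\frac{2m}{r}$. The Schwarzschild metric on $r>2m$ is $g_{\mathrm{Sch}}=-h\,dt^2+h^{-1}dr^2+r^2\sigma$ (Minkowski if $m=0$), with $\partial_t$ future directed. Let $r_*=r+2m\log|\frac r{2m}-1|$ ($r_*=r$ if $m=0$), $\bar v=t-r_*$ (retarded null coordinate) and $s=r^{-1}$. In the coordinates $(\mathbf y,s,\bar v)$, $\mathbf y\in\mathbb S^2$, one has $g_{\mathrm{Sch}}=s^{-2}\bar g$ with $\bar g=-s^2(1-2ms)d\bar v^2+2\,d\bar v\,ds+\sigma$, which extends smoothly to $s=0$; $\mathcal I^+=\{s=0\}$ is the future null-infinity. A surface is the graph of $P=P(\mathbf y,s)$ if it is $\{\bar v=-P(\mathbf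 y,s)\}$; equivalently it is $t=u(\mathbf y,r)$ with $P=r_*-u$. The mean curvature is one third of the trace of the second fundamental form with respect to the future directed unit normal $\mathbf n$, $H=\frac13\mathrm{div}\,\mathbf n$ (so the hyperboloid $t=\sqrt{1+|\mathbf x|^2}$ in Minkowski spacetime has $H=1$). Subscripts $s$ denote $\partial_s$. *)

(* Defs.v *)
From HB Require Import structures.
From mathcomp Require Import all_boot all_order all_algebra.
From mathcomp Require Import all_classical all_reals all_analysis.

Set Implicit Arguments.
Unset Strict Implicit.
Unset Printing Implicit Defensive.

Import Order.TTheory GRing.Theory Num.Theory.
Import numFieldNormedType.Exports.

Local Open Scope classical_set_scope.
Local Open Scope ring_scope.

(** * Functions of class C^k on a subset of R^n, up to the boundary *)

Section Regularity.
Variables (R : realType) (n : nat).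
Implicit Types (D : set 'rV[R]_n) (i : 'I_n) (F : 'rV[R]_n -> R).

Definition pd i F (x : 'rV[R]_n) : R := 'D_(delta_mx 0 i) F x.

(* Difference quotients taken only between points of D: the derivative is
   one-sided at the boundary of D, and agrees with [pd] inside D. *)
Definition dquot i F (x : 'rV[R]_n) (h : R) : R :=
  h^-1 * (F (x + h *: delta_mx 0 i) - F x).

Definition stays D i (x : 'rV[R]_n) : set R :=
  [set h | D (x + h *: delta_mx 0 i)].

Definition pdw D i F (x : 'rV[R]_n) : R :=
  lim (dquot i F x h @[h --> within (stays D i x) 0^']).

Definition derivablew D i F : Prop :=
  forall x, D x -> cvg (dquot i F x h @[h --> within (stays D i x) 0^']).

(* Meant for D a product of intervals with nonempty interior. *)
Fixpoint Ck k D F : Prop :=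
  {within D, continuous F} /\
  if k is k'.+1 then
    forall i, derivablew D i F /\ Ck k' D (pdw D i F)
  else True.

Definition smooth D F : Prop := forall k, Ck k D F.

(* Iterated partial derivatives; the last index of l is applied first. *)
Definition pdws D (l : seq 'I_n) F : 'rV[R]_n -> R := foldr (pdw D) F l.

End Regularity.

(** * Gradient and divergence of a (pseudo-)Riemannian metric in coordinates *)

Section Metric.
Variables (R : realType) (n : nat) (g : 'rV[R]_n -> 'M[R]_n).
Implicit Types (F G : 'rV[R]_n -> R) (X : 'rV[R]_n -> 'rV[R]_n).

Definition differ F (x : 'rV[R]_n) : 'rV[R]_n := \row_i pd i F x.

Definition inner (x v w : 'rV[R]_n) : R := (v *m g x *m w^T) 0 0.

Definition grad F (x : 'rV[R]_n) : 'rV[R]_n := differ F x *m invmx (g x).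

Definition volume_density (x : 'rV[R]_n) : R := Num.sqrt `|\det (g x)|.

Definition divergence X (x : 'rV[R]_n) : R :=
  (volume_density x)^-1 *
  \sum_i pd i (fun z => volume_density z * X z 0 i) x.

Definition laplacian F : 'rV[R]_n -> R := divergence (grad F).

Definition gradprod F G (x : 'rV[R]_n) : R := inner x (grad F x) (grad G x).

End Metric.

(** * The unit sphere of R^3 *)

Section Sphere.
Variable R : realType.

Definition sphere : set 'rV[R]_3 := [set y | \sum_k y 0 k ^+ 2 = 1].

(* The two inverse stereographic projections, centred at the points
   (0, 0, (-1)^c); their images cover the sphere, c = false missing only the
   south pole and c = true only the north pole.  All operators below being
   invariant under changes of coordinates, identities on the sphere are stated
   at every point of both charts. *)
Definition stereo (c : bool) (x : 'rV[R]_2) : 'rV[R]_3 :=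
  let q := \sum_i x 0 i ^+ 2 in
  (1 + q)^-1 *: (row_mx (2 *: x) ((-1) ^+ c * (1 - q))%:M : 'rV[R]_(2 + 1)).

(* Pullback under [stereo c] of the Euclidean metric of R^3. *)
Definition sigma (c : bool) (x : 'rV[R]_2) : 'M[R]_2 :=
  \matrix_(i, j) \sum_(k < 3)
    pd i (fun z => stereo c z 0 k) x * pd j (fun z => stereo c z 0 k) x.

Definition Slap (c : bool) := laplacian (sigma c).

(* <grad F, grad G> for the metric sigma. *)
Definition Sdot (c : bool) := gradprod (sigma c).

(* Universal differential expressions in one unknown function on the sphere. *)
Inductive dexpr : Type :=
| DVar
| DConst of R
| DAdd of dexpr & dexpr
| DMul of dexpr & dexpr
| DDot of dexpr & dexpr
| DLap of dexpr.

Fixpoint deval (c : bool) (e : dexpr) (f : 'rV[R]_2 -> R) : 'rV[R]_2 -> R :=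
  match e with
  | DVar => f
  | DConst a => fun=> a
  | DAdd e1 e2 => fun x => deval c e1 f x + deval c e2 f x
  | DMul e1 e2 => fun x => deval c e1 f x * deval c e2 f x
  | DDot e1 e2 => Sdot c (deval c e1 f) (deval c e2 f)
  | DLap e1 => Slap c (deval c e1 f)
  end.

End Sphere.

(** * Functions on S^2 x [0, s0] *)

(* Such a function is a P : 'rV[R]_3 -> R -> R, of which only the values on
   [sphere] x [0, s0] matter. *)

Section Collar.
Variable R : realType.
Implicit Types (P : 'rV[R]_3 -> R -> R).

Definition ord_s : 'I_(2 + 1) := rshift 2 ord0.

Definition in_chart (c : bool) P (q : 'rV[R]_(2 + 1)) : R :=
  P (stereo c (lsubmx q)) (q 0 ord_s).

Definition collar (s0 : R) : set 'rV[R]_(2 + 1) :=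
  [set q | 0 <= q 0 ord_s <= s0].

Definition open_collar (s0 : R) : set 'rV[R]_(2 + 1) :=
  [set q | 0 < q 0 ord_s <= s0].

Definition smooth_inside (s0 : R) P : Prop :=
  forall c, smooth (open_collar s0) (in_chart c P).

Definition Ck_up_to_scri k (s0 : R) P : Prop :=
  forall c, Ck k (collar s0) (in_chart c P).

Definition smooth_up_to_scri (s0 : R) P : Prop :=
  forall c, smooth (collar s0) (in_chart c P).

(* The iterated partial derivative, in the coordinates (x1, x2, s), along the
   list l of P at the point (x, 0) of future null infinity. *)
Definition scri_derivative (s0 : R) c (l : seq 'I_(2 + 1)) P
    (x : 'rV[R]_2) : R :=
  pdws (collar s0) l (in_chart c P) (row_mx x 0).

Definition scri_ds (s0 : R) c k P (x : 'rV[R]_2) : R :=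
  scri_derivative s0 c (nseq k ord_s) P x.

Definition boundary_value P (c : bool) (x : 'rV[R]_2) : R := P (stereo c x) 0.

End Collar.

(** * Spacelike graphs in the Schwarzschild spacetime *)

Section Schwarzschild.
Variables (R : realType) (m : R).
Implicit Types (P : 'rV[R]_3 -> R -> R) (p : 'rV[R]_(2 + 2)).

(* Coordinates (x1, x2, s, v), x being stereographic coordinates on the
   sphere, s = 1 / r and v = t - r_*; here d/dv is the vector field d/dt. *)
Definition s_of p : R := p 0 (rshift 2 0).
Definition v_of p : R := p 0 (rshift 2 1).

(* s^-2 (sigma + 2 dv ds - s^2 (1 - 2 m s) dv^2) *)
Definition gSch (c : bool) p : 'M[R]_(2 + 2) :=
  let s := s_of p in
  s ^- 2 *: block_mx (sigma c (lsubmx p)) 0 0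
    (block_mx 0%:M 1%:M 1%:M (- (s ^+ 2 * (1 - 2 * m * s)))%:M : 'M[R]_(1 + 1)).

(* The graph of P is the zero set of this function. *)
Definition defining (c : bool) P p : R :=
  v_of p + P (stereo c (lsubmx p)) (s_of p).

Definition graph_point (c : bool) P (x : 'rV[R]_2) (s : R) : 'rV[R]_(2 + 2) :=
  row_mx x (row_mx s%:M (- P (stereo c x) s)%:M : 'rV[R]_(1 + 1)).

Definition spacelike_at (c : bool) P p : Prop :=
  forall X : 'rV[R]_(2 + 2), X != 0 ->
    (differ (defining c P) p *m X^T) 0 0 = 0 -> 0 < inner (gSch c) p X X.

(* The unit normal field of the level sets of [defining c P], which are the
   translates of the graph under the flow of d/dt; g(n, d/dt) is a negative
   multiple of d(defining)(d/dv) = 1, so that n is future directed. *)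
Definition unit_normal (c : bool) P p : 'rV[R]_(2 + 2) :=
  - (Num.sqrt (- gradprod (gSch c) (defining c P) (defining c P) p))^-1
    *: grad (gSch c) (defining c P) p.

Definition mean_curvature (c : bool) P p : R :=
  3^-1 * divergence (gSch c) (unit_normal c P) p.

(* The condition 2 m s0 < 1 says that the graph lies in the region r > 2 m. *)
Definition spacelike_cmc1 (s0 : R) P : Prop :=
  [/\ 0 < s0, 2 * m * s0 < 1, smooth_inside s0 P &
    forall (c : bool) (x : 'rV[R]_2) (s : R), 0 < s < s0 ->
      spacelike_at c P (graph_point c P x s) /\
      mean_curvature c P (graph_point c P x s) = 1].

End Schwarzschild.

(** * The functions entering the compatibility condition *)

Section Compatibility.
Variables (R : realType) (c : bool) (f : 'rV[R]_2 -> R).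
Implicit Type x : 'rV[R]_2.

Definition normgrad2 x : R := Sdot c f f x.

Definition f1 x : R := - (1 / 2) * (1 + normgrad2 x).

Definition l1 x : R := - Slap c f x.

Definition f2 x : R := 1 / 2 * Sdot c normgrad2 f x + 1 / 2 * Slap c f x.

Definition l2 x : R :=
  - (1 / 2) * Slap c f x ^+ 2 + 2 * Slap c normgrad2 x
  - 2 * Sdot c (Slap c f) f x - 2 * (1 + normgrad2 x).

End Compatibility.

(* Main.v *)
Require Import Defs.
From HB Require Import structures.
From mathcomp Require Import all_boot all_order all_algebra.
From mathcomp Require Import all_classical all_reals all_analysis.
From mathcomp Require Import ring lra.

Set Implicit Arguments.
Unset Strict Implicit.
Unset Printing Implicit Defensive.

Import Order.TTheory GRing.Theory Num.Theory.
Import numFieldNormedType.Exports.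

Local Open Scope classical_set_scope.
Local Open Scope ring_scope.

(** Write A = s^2 (1 - 2 m s), let mu = (1 + |x|^2)^2 / 4 be the inverse of the
    conformal factor of the sphere in stereographic coordinates, and let
    W = - (A P_s^2 + 2 P_s + |grad P|^2).  Up to the factor s^2, W is minus the
    squared length of the differential of v + P, so the graph of P is spacelike
    exactly where W > 0, and H = 1 becomes the equation [cmc_eq]
<<
  3 W sqrt W = 3 W (1 + A P_s)
    - s (W ((A P_s)_s + Lap P) - W_s (1 + A P_s) / 2 - <grad W, grad P> / 2),
>>
    which extends smoothly to s = 0 once W is known to be positive there.

    Boundary value of W.  At s = 0 the equation reads W sqrt W = W, so W is 0 or
    1 on the boundary ([W_boundary01]).  It cannot be 0: where W is small the
    equation makes W strictly decrease along s (d_s + grad P), away from the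
    boundary, and a barrier turns this into a contradiction with W > 0 inside
    ([W_boundary_neq0]).

    (i) and (iii).  With W = 1 at s = 0 both the definition of W and the equation
    can be expanded in powers of s.  The definition of W expresses P_s, and then
    P_ss and P_sss, through the Taylor coefficients of W; the orders s and s^2 of
    the equation give W_s = l1 and W_ss = l2.  At order s^3 the coefficient of
    W_sss cancels, and with it P_ssss: what remains is the compatibility
    condition ([cmc_orders], [compatibility]).

    (iv).  Let two solutions agree so far that their s-derivatives first differ
    by C s^k.  Then W differs by - 2 C s^k, the left side of the equation by
    - 9 C s^k, and the right side by - (6 + k) C s^k, so (k - 3) C = 0.  Order
    k = 3, that is P_ssss, is the only free one ([contact_equation]).  The
    tangential derivatives of the coefficients follow, as partial derivatives
    commute up to the boundary ([pdw_comm]).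

    (ii).  For a rotationally symmetric graph the equation is the linear equation
    3 q - s q_s = 3 for q = (1 + A P_s) / sqrt W, with solutions q = 1 + C s^3.
    Solving for P_s gives a solution [rad_P] for each C in [0, 1], all with
    boundary value 0, and C moves P_ssss ([rad_P_ds4]). *)

(** * One-sided partial derivatives and functions of class C^k *)

Lemma cvg_near_eq (R : realType) (T : Type) (A : set_system T) {FA : Filter A}
    (f g : T -> R) (l : R) : (\forall x \near A, f x = g x) ->
  f x @[x --> A] --> l -> g x @[x --> A] --> l.
Proof. by move=> fg; apply: cvg_trans; apply: near_eq_cvg. Qed.

Section WithinDerivative.
Variables (R : realType) (n : nat).
Implicit Types (D : set 'rV[R]_n) (i j : 'I_n) (F G : 'rV[R]_n -> R).

(** The value of a one-sided derivative, as a relation, so that it can be computed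
    by rules.  It is a record to keep the filter from being unfolded when these
    rules are applied. *)
Record has_pdw D i F (x : 'rV[R]_n) (l : R) : Prop := HasPdw {
  has_pdw_cvg : dquot i F x h @[h --> within (stays D i x) 0^'] --> l }.

(** At every point of D the admissible increments in each coordinate direction
    accumulate at 0; one-sided derivatives are then unique. *)
Definition perfect D := forall i x, D x ->
  ProperFilter (within (stays D i x) (0:R)^').

Lemma has_pdw_pdw D i F x l : perfect D -> D x -> has_pdw D i F x l -> pdw D i F x = l.
Proof. by move=> pD Dx [H]; have := pD i x Dx => PF; exact: cvg_lim. Qed.

Lemma pdwP D i F x : perfect D -> derivablew D i F -> D x ->
  has_pdw D i F x (pdw D i F x).
Proof. by move=> pD dF Dx; split; exact: (dF x Dx). Qed.

Lemma has_pdw_derivable D i F : (forall x, D x -> exists l, has_pdw D i F x l) ->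
  derivablew D i F.
Proof. by move=> H x Dx; have [l [Hl]] := H x Dx; apply/cvg_ex; exists l. Qed.

Lemma near_stays D i x : \forall h \near within (stays D i x) (0:R)^', D (x + h *: delta_mx 0 i) /\ h != 0.
Proof.
rewrite near_withinE; near=> h => Dh; split; first exact: Dh.
by near: h; exact: nbhs_dnbhs_neq.
Unshelve. all: by end_near. Qed.

Lemma has_pdw_eq D i F G x l : D x -> {in D, F =1 G} ->
  has_pdw D i F x l -> has_pdw D i G x l.
Proof.
move=> Dx FG [H]; split; apply: (cvg_near_eq _ H).
near=> h; rewrite /dquot !FG ?inE//.
have [] : D (x + h *: delta_mx 0 i) /\ h != 0 by near: h; exact: near_stays.
by [].
Unshelve. all: by end_near. Qed.

Lemma pdw_eq D i F G x : D x -> {in D, F =1 G} -> pdw D i F x = pdw D i G x.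
Proof.
move=> Dx FG; rewrite /pdw; congr (lim _).
have E (F' G' : 'rV[R]_n -> R) : {in D, F' =1 G'} ->
    {near within (stays D i x) (0:R)^', dquot i F' x =1 dquot i G' x}.
  move=> FG'; near=> h; rewrite /dquot !FG' ?inE//.
  have [] : D (x + h *: delta_mx 0 i) /\ h != 0 by near: h; exact: near_stays.
  by [].
rewrite eqEsubset; split; apply: near_eq_cvg; apply: E => // y Dy.
by rewrite FG.
Unshelve. all: by end_near. Qed.

Lemma has_pdw_cst D i (a : R) x : has_pdw D i (fun=> a) x 0.
Proof.
split; rewrite (_ : dquot i _ x = fun=> 0); first exact: cvg_cst.
by apply/funext => h; rewrite /dquot subrr mulr0.
Qed.

Lemma has_pdw_coord D i k x : has_pdw D i (fun z : 'rV[R]_n => z 0 k) x (i == k)%:R.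
Proof.
split; apply: (cvg_near_eq (f := fun=> (i == k)%:R)); last exact: cvg_cst.
near=> h.
have [_ h0] : D (x + h *: delta_mx 0 i) /\ h != 0 by near: h; exact: near_stays.
by rewrite /dquot !mxE eqxx/= addrAC subrr add0r mulrA mulVf// mul1r eq_sym.
Unshelve. all: by end_near. Qed.

Lemma has_pdwD D i F G x l k : has_pdw D i F x l -> has_pdw D i G x k ->
  has_pdw D i (fun z => F z + G z) x (l + k).
Proof.
move=> [Fl] [Gk]; split; apply: (cvg_trans _ (cvgD Fl Gk)).
rewrite (_ : dquot i _ x = dquot i F x \+ dquot i G x)//.
by apply/funext => h; rewrite /dquot/= -mulrDr; congr (_ * _); ring.
Qed.

Lemma cvg_stays D i F x l : has_pdw D i F x l ->
  F (x + h *: delta_mx 0 i) @[h --> within (stays D i x) 0^'] --> F x.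
Proof.
move=> [Fl].
have h0 : h @[h --> within (stays D i x) (0:R)^'] --> (0:R).
  by apply: cvg_within_filter; exact: (@nbhs_dnbhs _ (0:R)).
have cF : F x @[_ --> within (stays D i x) (0:R)^'] --> F x by exact: cvg_cst.
apply: (cvg_near_eq (f := fun h => h * dquot i F x h + F x)); last first.
  have := cvgD (cvgM h0 Fl) cF; rewrite mul0r add0r; apply.
near=> h.
have [_ hn0] : D (x + h *: delta_mx 0 i) /\ h != 0 by near: h; exact: near_stays.
by rewrite /dquot/= mulrA divff// mul1r subrK.
Unshelve. all: by end_near. Qed.

Lemma has_pdwM D i F G x l k : has_pdw D i F x l -> has_pdw D i G x k ->
  has_pdw D i (fun z => F z * G z) x (l * G x + F x * k).
Proof.
move=> [Fl] Gk; have [Gk'] := Gk.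
have cF : F x @[_ --> within (stays D i x) (0:R)^'] --> F x by exact: cvg_cst.
split; rewrite (_ : dquot i _ x = (fun h => dquot i F x h * G (x + h *: delta_mx 0 i)) \+
   (fun h => F x * dquot i G x h)).
  exact: cvgD (cvgM Fl (cvg_stays Gk)) (cvgM cF Gk').
by apply/funext => h; rewrite /dquot/=; ring.
Qed.

Lemma Ck_cont k D F : Ck k D F -> {within D, continuous F}.
Proof. by case: k => [|k] []. Qed.

Lemma Ck_derivable k D F i : Ck k.+1 D F -> derivablew D i F.
Proof. by case=> _ /(_ i)[]. Qed.
Arguments Ck_derivable {k D F} i.

Lemma Ck_pdw k D F i : Ck k.+1 D F -> Ck k D (pdw D i F).
Proof. by case=> _ /(_ i)[]. Qed.
Arguments Ck_pdw {k D F} i.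

Lemma CkS k D F : Ck k.+1 D F -> Ck k D F.
Proof.
elim: k F => [|k IH] F [cF dF]; first by split.
by split=> // i; have [? /IH] := dF i.
Qed.

Lemma Ck_le k l D F : (k <= l)%N -> Ck l D F -> Ck k D F.
Proof.
elim: l => [|l IH]; first by rewrite leqn0 => /eqP->.
by rewrite leq_eqVlt => /predU1P[->//|/IH H] /CkS.
Qed.

Lemma Ck_eq k D F G : {in D, F =1 G} -> Ck k D F -> Ck k D G.
Proof.
elim: k F G => [|k IH] F G FG [cF dF].
  by split=> //; apply: subspace_eq_continuous cF => // x; exact: FG.
split; first by apply: subspace_eq_continuous cF => // x; exact: FG.
move=> i; have [dFi cFi] := dF i; split.
  move=> x Dx; have /cvg_ex[l Hl] := dFi x Dx.
  have [] : has_pdw D i G x l by apply: has_pdw_eq Dx FG _; split.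
  by move=> H; apply/cvg_ex; exists l.
by apply: IH cFi => x /[!inE] Dx; exact: pdw_eq.
Qed.

Lemma Ck_cst k D (a : R) : perfect D -> Ck k D (fun=> a).
Proof.
move=> pD; elim: k a => [|k IH] a; first by split=> //; exact: cst_continuous.
split; first exact: cst_continuous.
move=> i; split.
  by apply: has_pdw_derivable => x Dx; exists 0; exact: has_pdw_cst.
apply: Ck_eq (IH 0) => x /[!inE] Dx.
by rewrite (@has_pdw_pdw _ _ _ _ 0 pD Dx)//; exact: has_pdw_cst.
Qed.

Lemma coord_cont k : continuous (fun z : 'rV[R]_n => z 0 k).
Proof. by move=> z; exact: coord_continuous. Qed.

Lemma Ck_coord k D j : perfect D -> Ck k D (fun z : 'rV[R]_n => z 0 j).
Proof.
move=> pD; have cc : {within D, continuous (fun z : 'rV[R]_n => z 0 j)}.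
  by apply: continuous_subspaceT; exact: coord_cont.
case: k => [|k]; split=> // i; split.
  by apply: has_pdw_derivable => x Dx; exists (i == j)%:R; exact: has_pdw_coord.
apply: Ck_eq (Ck_cst k (i == j)%:R pD) => x /[!inE] Dx.
by rewrite (@has_pdw_pdw _ _ _ _ (i == j)%:R pD Dx)//; exact: has_pdw_coord.
Qed.

Lemma CkD k D F G : perfect D -> Ck k D F -> Ck k D G -> Ck k D (fun z => F z + G z).
Proof.
move=> pD; elim: k F G => [|k IH] F G CF CG.
  split=> //; have [cF _] := CF; have [cG _] := CG.
  by move=> x; apply: cvgD; [exact: cF|exact: cG].
have [cF _] := CF; have [cG _] := CG.
split; first by move=> x; apply: cvgD; [exact: cF|exact: cG].
move=> i; have dF := Ck_derivable i CF; have dG := Ck_derivable i CG; split.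
  apply: has_pdw_derivable => x Dx; eexists.
  by apply: has_pdwD; exact: pdwP.
apply: Ck_eq (IH _ _ (Ck_pdw i CF) (Ck_pdw i CG)) => x /[!inE] Dx.
by rewrite (has_pdw_pdw pD Dx (has_pdwD (pdwP pD dF Dx) (pdwP pD dG Dx))).
Qed.

Lemma CkM k D F G : perfect D -> Ck k D F -> Ck k D G -> Ck k D (fun z => F z * G z).
Proof.
move=> pD; elim: k F G => [|k IH] F G CF CG.
  split=> //; have [cF _] := CF; have [cG _] := CG.
  by move=> x; apply: cvgM; [exact: cF|exact: cG].
have [cF _] := CF; have [cG _] := CG.
split; first by move=> x; apply: cvgM; [exact: cF|exact: cG].
move=> i; have dF := Ck_derivable i CF; have dG := Ck_derivable i CG; split.
  apply: has_pdw_derivable => x Dx; eexists.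
  by apply: has_pdwM; exact: pdwP.
have := CkD pD (IH _ _ (Ck_pdw i CF) (CkS CG)) (IH _ _ (CkS CF) (Ck_pdw i CG)).
apply: Ck_eq => x /[!inE] Dx.
by rewrite (has_pdw_pdw pD Dx (has_pdwM (pdwP pD dF Dx) (pdwP pD dG Dx))).
Qed.

Lemma CkN k D F : perfect D -> Ck k D F -> Ck k D (fun z => - F z).
Proof.
move=> pD CF; have := CkM pD (Ck_cst k (-1) pD) CF.
by apply: Ck_eq => x _; rewrite mulN1r.
Qed.

Lemma CkX k D F l : perfect D -> Ck k D F -> Ck k D (fun z => F z ^+ l).
Proof.
move=> pD CF; elim: l => [|l IH]; first exact: Ck_cst.
by apply: Ck_eq (CkM pD CF IH) => x _; rewrite exprS.
Qed.

End WithinDerivative.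
Arguments Ck_derivable {R n k D F} i.
Arguments Ck_pdw {R n k D F} i.

(** * Symmetry of second derivatives up to the boundary *)

Section Slices.
Variables (R : realType) (n : nat).
Implicit Types (D : set 'rV[R]_n) (i j : 'I_n) (F G : 'rV[R]_n -> R).

Lemma near0P (P : R -> Prop) e : 0 < e -> (forall h, `|h| < e -> P h) ->
  \forall h \near (0:R), P h.
Proof. by move=> e0 H; exists e => //= h /=; rewrite sub0r normrN; exact: H. Qed.

Lemma is_derive_quot (phi : R -> R) a l :
  h^-1 * (phi (a + h) - phi a) @[h --> (0:R)^'] --> l -> is_derive a 1 phi l.
Proof.
move=> H.
have H' : h^-1 *: ((phi \o shift a) (h *: (1:R)) - phi a) @[h --> (0:R)^'] --> l.
  apply: (cvg_near_eq _ H); near=> h => /=.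
  by rewrite /GRing.scale/= mulr1 [h + a]addrC.
by apply: DeriveDef; [apply/cvg_ex; exists l|exact: cvg_lim].
Unshelve. all: by end_near. Qed.

Lemma slice_derive D i F x a l :
  (\forall h \near (0:R), D (x + (a + h) *: delta_mx 0 i)) ->
  has_pdw D i F (x + a *: delta_mx 0 i) l ->
  is_derive a 1 (fun t => F (x + t *: delta_mx 0 i)) l.
Proof.
move=> nD [H]; apply: is_derive_quot.
have nD' : \forall h \near (0:R)^', stays D i (x + a *: delta_mx 0 i) h.
  by apply: nbhs_dnbhs; apply: filterS nD => h; rewrite /stays/= -addrA -scalerDl.
have H2 : dquot i F (x + a *: delta_mx 0 i) h @[h --> (0:R)^'] --> l.
  apply: cvg_trans H => A; rewrite /nbhs/= /nbhs/= /within/=.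
  by move: nD'; apply: filterS2 => h Sh; exact.
apply: (cvg_near_eq _ H2); near=> h.
by rewrite /dquot scalerDl addrA.
Unshelve. all: by end_near. Qed.

Lemma slice_cont D i F x (I : set R) : {within D, continuous F} ->
  (forall t, I t -> D (x + t *: delta_mx 0 i)) ->
  {within I, continuous (fun t => F (x + t *: delta_mx 0 i))}.
Proof.
move=> /subspace_continuousP cF ID; apply/subspace_continuousP => t It.
have := cF _ (ID t It); apply: cvg_comp => /=.
have c : {for t, continuous (fun u : R => x + u *: (delta_mx 0 i : 'rV[R]_n))}.
  apply: continuousD; [exact: cst_continuous|exact: scalel_continuous].
move=> A; rewrite /nbhs/= /within/= => /c nA.
apply: (@filterS _ (nbhs t) _ _ _ _ nA) => u Au Iu; apply: Au; exact: ID.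
Qed.

(** Two applications of the mean value theorem, in direction i to a difference of
    two slices and then in direction j.  Only points x + a e_i + b e_j with
    a, b >= 0 occur, which makes the lemma usable at a boundary point. *)
Lemma second_difference D F i j (x : 'rV[R]_n) (r : R) : perfect D -> Ck 2 D F -> 0 < r ->
  (forall a b : R, 0 <= a <= r -> 0 <= b <= r ->
     D (x + a *: delta_mx 0 i + b *: delta_mx 0 j)) ->
  (i != j) ->
  exists a b, [/\ 0 < a < r, 0 < b < r &
    F (x + r *: delta_mx 0 i + r *: delta_mx 0 j) - F (x + r *: delta_mx 0 i)
    - F (x + r *: delta_mx 0 j) + F x
    = r ^+ 2 * pdw D j (pdw D i F) (x + a *: delta_mx 0 i + b *: delta_mx 0 j)].
Proof.
move=> pD CF r0 Dab ij.
have Dsw (a b : R) : 0 <= a <= r -> 0 <= b <= r ->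
     D (x + b *: delta_mx 0 j + a *: delta_mx 0 i).
  by move=> a0 b0; rewrite addrAC; exact: Dab.
pose phi (t : R) := F (x + r *: delta_mx 0 j + t *: delta_mx 0 i) - F (x + t *: delta_mx 0 i).
pose dphi (t : R) := pdw D i F (x + r *: delta_mx 0 j + t *: delta_mx 0 i)
   - pdw D i F (x + t *: delta_mx 0 i).
have D0 (a : R) : 0 <= a <= r -> D (x + a *: delta_mx 0 i).
  by move=> a0; have := Dab a 0 a0; rewrite scale0r addr0; apply; rewrite lexx ltW.
have rr : 0 <= r <= r by rewrite lexx ltW.
have nearI (t : R) : t \in `]0, r[ -> \forall h \near (0:R), 0 <= t + h <= r.
  rewrite in_itv/= => /andP[t0 tr].
  apply: (@near0P _ (Num.min t (r - t))); first by rewrite lt_min t0 subr_gt0.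
  by move=> h; rewrite lt_min !ltr_norml; lra.
have dphiP (t : R) : t \in `]0, r[ -> is_derive t 1 phi (dphi t).
  move=> t0r; have t0r' : 0 <= t <= r by move: t0r; rewrite in_itv/=; lra.
  have dF := Ck_derivable i CF.
  apply: is_deriveB; apply: (slice_derive (D := D)).
  - by apply: filterS (nearI _ t0r) => h H; exact: Dsw.
  - by apply: pdwP => //; exact: Dsw.
  - by apply: filterS (nearI _ t0r) => h H; exact: D0.
  - by apply: pdwP => //; exact: D0.
have cphi : {within `[0, r], continuous phi}.
  have [cF _] := CF => t; apply: cvgB.
  - apply: (slice_cont (D := D)) => // u; rewrite /= in_itv/= => u0; exact: Dsw.
  - apply: (slice_cont (D := D)) => // u; rewrite /= in_itv/= => u0; exact: D0.
have [a a0r Ea] := MVT r0 dphiP cphi.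
have a0r' : 0 <= a <= r by move: a0r; rewrite in_itv/=; lra.
have CdF := Ck_pdw i CF; have dF := Ck_derivable j CdF.
pose psi (t : R) := pdw D i F (x + a *: delta_mx 0 i + t *: delta_mx 0 j).
have dpsiP (t : R) : t \in `]0, r[ ->
    is_derive t 1 psi (pdw D j (pdw D i F) (x + a *: delta_mx 0 i + t *: delta_mx 0 j)).
  move=> t0r; have t0r' : 0 <= t <= r by move: t0r; rewrite in_itv/=; lra.
  apply: (slice_derive (D := D)).
  - by apply: filterS (nearI _ t0r) => h H; exact: Dab.
  - by apply: pdwP => //; exact: Dab.
have cpsi : {within `[0, r], continuous psi}.
  apply: (slice_cont (D := D)); first exact: Ck_cont CdF.
  by move=> u; rewrite /= in_itv/= => u0; exact: Dab.
have [b b0r Eb] := MVT r0 dpsiP cpsi.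
exists a, b; split; [by move: a0r; rewrite in_itv|by move: b0r; rewrite in_itv|].
move: Ea Eb; rewrite /phi /dphi /psi !scale0r !addr0 !subr0 => Ea Eb.
rewrite [_ + r *: delta_mx 0 j + a *: _]addrAC in Ea.
rewrite [_ + r *: delta_mx 0 j + r *: _]addrAC in Ea.
rewrite Eb in Ea.
have alg (A B C E Z : R) : A - B - (C - E) = Z * r * r ->
    A - B - C + E = r ^+ 2 * Z.
  have -> : A - B - C + E = A - B - (C - E) by ring.
  by move=> ->; ring.
exact: alg Ea.
Qed.

Lemma within_dist D G (x : 'rV[R]_n) (e : R) : G z @[z --> within D (nbhs x)] --> G x -> 0 < e ->
  exists2 d, 0 < d & forall y, ball x d y -> D y -> `|G x - G y| < e.
Proof.
move=> cG e0; move/cvgrPdist_lt/(_ _ e0): cG.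
rewrite near_withinE -nbhs_ballE => -[d /= d0 H].
by exists d => // y xy Dy; exact: H.
Qed.

Lemma dist_half (A B X e : R) : `|A - X| < e / 2 -> `|B - X| < e / 2 -> `|A - B| <= e.
Proof. by rewrite ler_norml !ltr_norml; lra. Qed.

(** The second difference does not depend on the order of i and j, so each mixed
    derivative takes one and the same value somewhere in arbitrarily small
    squares at x; continuity does the rest. *)
Lemma pdw_comm_quadrant D F i j (x : 'rV[R]_n) (r0 : R) : perfect D -> Ck 2 D F -> 0 < r0 ->
  (forall a b : R, 0 <= a <= r0 -> 0 <= b <= r0 ->
     D (x + a *: delta_mx 0 i + b *: delta_mx 0 j)) ->
  pdw D i (pdw D j F) x = pdw D j (pdw D i F) x.
Proof.
move=> pD CF r00 Dab; have [->//|ij] := eqVneq i j.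
have Dx : D x by have := Dab 0 0; rewrite !scale0r !addr0; apply; rewrite lexx ltW.
have cont k l : pdw D k (pdw D l F) z @[z --> within D (nbhs x)] --> pdw D k (pdw D l F) x.
  have /subspace_continuousP := Ck_cont (Ck_pdw k (Ck_pdw l CF)); exact.
apply/eqP; rewrite -subr_eq0 -normr_le0; apply/ler_addgt0Pr => e e0; rewrite add0r.
have e2 : 0 < e / 2 by rewrite divr_gt0.
have [d1 d10 H1] := within_dist (cont j i) e2.
have [d2 d20 H2] := within_dist (cont i j) e2.
(* any point of the square of side r lies at distance below 2 r from x *)
pose r := Num.min r0 (Num.min d1 d2) / 3.
have rP : [/\ 0 < r, r <= r0, 2 * r < d1 & 2 * r < d2].
  have m0 : 0 < Num.min r0 (Num.min d1 d2) by rewrite !lt_min r00 d10 d20.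
  have : Num.min r0 (Num.min d1 d2) <= r0 by rewrite ge_min lexx.
  have : Num.min r0 (Num.min d1 d2) <= d1 by rewrite !ge_min lexx orbT.
  have : Num.min r0 (Num.min d1 d2) <= d2 by rewrite !ge_min lexx !orbT.
  by rewrite /r; split; lra.
have [r_gt0 rr0 rd1 rd2] := rP.
have Dab' (a b : R) : 0 <= a <= r -> 0 <= b <= r ->
     D (x + a *: delta_mx 0 i + b *: delta_mx 0 j) by move=> ? ?; apply: Dab; lra.
have Dba' (a b : R) : 0 <= a <= r -> 0 <= b <= r ->
     D (x + a *: delta_mx 0 j + b *: delta_mx 0 i).
  by move=> ? ?; rewrite addrAC; exact: Dab'.
have small (a b d : R) k l : 0 < a < r -> 0 < b < r -> 2 * r < d ->
    ball x d (x + a *: delta_mx 0 k + b *: delta_mx 0 l).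
  move=> a0 b0 rd; split; first lra.
  move=> u v; rewrite ord1 -ball_normE /= !mxE eqxx/=.
  by case: (v == k); case: (v == l); rewrite ?mulr1 ?mulr0 ltr_norml; lra.
have ji : j != i by rewrite eq_sym.
have [a [b [a0 b0 Eab]]] := second_difference pD CF r_gt0 Dab' ij.
have [a' [b' [a0' b0' Eab']]] := second_difference pD CF r_gt0 Dba' ji.
have E : pdw D j (pdw D i F) (x + a *: delta_mx 0 i + b *: delta_mx 0 j) =
  pdw D i (pdw D j F) (x + a' *: delta_mx 0 j + b' *: delta_mx 0 i).
  have r2 : r ^+ 2 != 0 by rewrite expf_neq0// gt_eqF.
  apply: (mulfI r2); apply: (etrans (esym Eab)); apply: etrans _ Eab'.
  rewrite [x + r *: delta_mx 0 j + _]addrAC.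
  by rewrite -!addrA; congr (_ + _); rewrite addrCA.
have le_r (c : R) : 0 < c < r -> 0 <= c <= r by move=> /andP[/ltW-> /ltW->].
apply: (@dist_half _ _ (pdw D j (pdw D i F) (x + a *: delta_mx 0 i + b *: delta_mx 0 j))).
  by rewrite E; apply: H2; [exact: small|apply: Dba'; exact: le_r].
by apply: H1; [exact: small|apply: Dab'; exact: le_r].
Qed.
End Slices.

(** * Coordinates on the collar *)

Section Collars.
Variable R : realType.
Implicit Types (x : 'rV[R]_2) (s : R) (F G : 'rV[R]_(2 + 1) -> R) (q : 'rV[R]_(2 + 1)).

Definition pt x s : 'rV[R]_(2 + 1) := row_mx x s%:M.

Definition tang (i : 'I_2) : 'I_(2 + 1) := lshift 1 i.

Lemma pt_s x s : pt x s 0 ord_s = s.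
Proof. by rewrite /pt /ord_s row_mxEr mxE eqxx mulr1n. Qed.

Lemma pt_x x s : lsubmx (pt x s) = x.
Proof. exact: row_mxKl. Qed.

Lemma ptE q : q = pt (lsubmx q) (q 0 ord_s).
Proof.
rewrite -[LHS]hsubmxK /pt; congr row_mx; apply/rowP => i.
by rewrite !mxE !ord1 eqxx mulr1n.
Qed.

Lemma pt0 x : pt x 0 = row_mx x 0.
Proof. by rewrite /pt raddf0. Qed.

Lemma pt_addtang x s h i : pt x s + h *: delta_mx 0 (tang i) = pt (x + h *: delta_mx 0 i) s.
Proof.
apply/rowP => k; case: (split_ordP k) => j ->.
  by rewrite [LHS]mxE /pt !row_mxEl !mxE (inj_eq (@lshift_inj _ _)).
by rewrite [LHS]mxE /pt !row_mxEr !mxE /tang eq_rlshift/= mulr0 addr0.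
Qed.

Lemma pt_adds x s h : pt x s + h *: delta_mx 0 ord_s = pt x (s + h).
Proof.
apply/rowP => k; case: (split_ordP k) => j ->.
  by rewrite [LHS]mxE /pt !row_mxEl !mxE /ord_s eq_lrshift/= mulr0 addr0.
by rewrite [LHS]mxE /pt !row_mxEr !mxE /ord_s (inj_eq (@rshift_inj _ _)) !ord1/= !mulr1n mulr1.
Qed.

Lemma tang_or_s (i : 'I_(2 + 1)) : i = ord_s \/ exists k, i = tang k.
Proof.
case: (split_ordP i) => j ->; first by right; exists j.
by left; rewrite ord1.
Qed.

Lemma tang_neq_s k : tang k != ord_s.
Proof. by rewrite /tang /ord_s eq_lrshift. Qed.

Lemma perfect_strip (I : set R) :
  (forall s e, I s -> 0 < e -> exists h, [/\ h != 0, `|h| < e & I (s + h)]) ->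
  perfect [set q | I (q 0 ord_s)].
Proof.
move=> acc i q Iq; apply: Build_ProperFilter_ex => A.
rewrite /within/= => /nbhs_ballP[e /= e0 He].
case: (tang_or_s i) He => [->|[k ->]] He.
  have [h [h0 he Ih]] := acc _ _ Iq e0.
  exists h; apply: He => //=; first by rewrite -ball_normE/= sub0r normrN.
  by rewrite /stays/= [q]ptE pt_adds pt_s.
exists (e / 2); apply: He => //=.
- by rewrite -ball_normE/= sub0r normrN gtr0_norm; lra.
- by rewrite gt_eqF//; lra.
- by rewrite /stays/= [q]ptE pt_addtang pt_s.
Qed.

Lemma perfect_collar s0 : 0 < s0 -> perfect (collar s0).
Proof.
move=> s00; apply: (@perfect_strip [set s | 0 <= s <= s0]) => s e /= ss0 e0.
have [slt|sge] := ltP s s0.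
  pose h := Num.min (e / 2) (s0 - s).
  have h0 : 0 < h by rewrite lt_min; lra.
  have h1 : h <= e / 2 by rewrite ge_min lexx.
  have h2 : h <= s0 - s by rewrite ge_min lexx orbT.
  by exists h; rewrite gt_eqF// gtr0_norm//; split=> //; lra.
pose h := Num.min (e / 2) s.
have h0 : 0 < h by rewrite lt_min; lra.
have h1 : h <= e / 2 by rewrite ge_min lexx.
have h2 : h <= s by rewrite ge_min lexx orbT.
by exists (- h); rewrite oppr_eq0 gt_eqF// normrN gtr0_norm//; split=> //; lra.
Qed.

Lemma perfect_open_collar s0 : 0 < s0 -> perfect (open_collar s0).
Proof.
move=> s00; apply: (@perfect_strip [set s | 0 < s <= s0]) => s e /= ss0 e0.
have h0 : 0 < Num.min (e / 2) (s / 2) by rewrite lt_min; lra.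
have h1 : Num.min (e / 2) (s / 2) <= e / 2 by rewrite ge_min lexx.
have h2 : Num.min (e / 2) (s / 2) <= s / 2 by rewrite ge_min lexx orbT.
exists (- Num.min (e / 2) (s / 2)).
by rewrite oppr_eq0 gt_eqF// normrN gtr0_norm//; split=> //; lra.
Qed.

Lemma collar_pt s0 x s : collar s0 (pt x s) = (0 <= s <= s0) :> Prop.
Proof. by rewrite /collar/= pt_s. Qed.

Lemma pt_slice F x : (fun s => F (pt x s)) = fun s => F (pt x 0 + s *: delta_mx 0 ord_s).
Proof. by apply/funext => s; rewrite pt_adds add0r. Qed.

Lemma s_slice_cont s0 F x : {within collar s0, continuous F} ->
  {within `[0, s0], continuous (fun s => F (pt x s))}.
Proof.
move=> cF; rewrite pt_slice.
  apply: slice_cont cF _ => t; rewrite /= in_itv/= pt_adds add0r.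
  by rewrite collar_pt.
Qed.

Lemma s_slice_derive s0 F x s : 0 < s0 -> derivablew (collar s0) ord_s F -> 0 < s < s0 ->
  is_derive s 1 (fun s => F (pt x s)) (pdw (collar s0) ord_s F (pt x s)).
Proof.
move=> s00 dF ss0; rewrite pt_slice.
  apply: (slice_derive (D := collar s0)).
    apply: (@near0P _ _ (Num.min s (s0 - s))); first by rewrite lt_min; lra.
    by move=> h; rewrite lt_min !ltr_norml pt_adds collar_pt; lra.
  rewrite pt_adds add0r; apply: pdwP => //; first exact: perfect_collar.
  by rewrite collar_pt; lra.
Qed.

(** At s = s0 there is no room in the direction of increasing s, so identities
    proved below s0 reach s0 by continuity. *)
Lemma collar_ext s0 F G : 0 < s0 -> {within collar s0, continuous F} ->
    {within collar s0, continuous G} ->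
    (forall q, collar s0 q -> q 0 ord_s < s0 -> F q = G q) ->
  forall q, collar s0 q -> F q = G q.
Proof.
move=> s00 cF cG FG q Cq; have [|qs] := ltP (q 0 ord_s) s0; first exact: FG.
rewrite (ptE q); have -> : q 0 ord_s = s0 by apply/eqP; rewrite eq_le qs; case/andP: Cq => _ ->.
set x := lsubmx q.
have /(continuous_within_itvP _ s00)[_ _ F1] := s_slice_cont (x := x) cF.
have /(continuous_within_itvP _ s00)[_ _ G1] := s_slice_cont (x := x) cG.
suff F2 : G (pt x s) @[s --> s0^'-] --> F (pt x s0) by exact: cvg_unique _ F2 G1.
apply: (cvg_near_eq _ F1); near=> s; apply: FG; rewrite ?collar_pt ?pt_s.
  by apply/andP; split; [near: s; apply: nbhs_left_ge|apply: ltW; near: s; exact: nbhs_left_lt].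
by near: s; exact: nbhs_left_lt.
Unshelve. all: by end_near. Qed.

Lemma pdw_comm s0 F i j q : 0 < s0 -> Ck 2 (collar s0) F -> collar s0 q ->
  pdw (collar s0) i (pdw (collar s0) j F) q = pdw (collar s0) j (pdw (collar s0) i F) q.
Proof.
move=> s00 CF Cq.
apply: (@collar_ext s0 (pdw (collar s0) i (pdw (collar s0) j F))
   (pdw (collar s0) j (pdw (collar s0) i F)) s00 _ _ _ q Cq) => [||{Cq}{}q Cq qs].
- exact: Ck_cont (Ck_pdw i (Ck_pdw j CF)).
- exact: Ck_cont (Ck_pdw j (Ck_pdw i CF)).
have [->//|ij] := eqVneq i j.
apply: (@pdw_comm_quadrant _ _ _ _ _ _ _ (s0 - q 0 ord_s) _ CF).
- exact: perfect_collar.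
- by rewrite subr_gt0.
move=> a b a0 b0; move: Cq ij; rewrite /collar/= => Cq.
have [->|[k ->]] := tang_or_s i; have [->|[l ->]] := tang_or_s j.
- by rewrite eqxx.
- by rewrite (ptE q) pt_adds pt_addtang !pt_s => _; lra.
- by rewrite (ptE q) pt_addtang pt_adds !pt_s => _; lra.
- by rewrite (ptE q) !pt_addtang !pt_s => _; lra.
Qed.

Lemma tang_pd s0 F i x s : 0 < s0 -> 0 <= s <= s0 -> derivablew (collar s0) (tang i) F ->
  is_derive x (delta_mx 0 i : 'rV[R]_2) (fun x => F (pt x s)) (pdw (collar s0) (tang i) F (pt x s)).
Proof.
move=> s00 ss0 dF.
have Cp y : collar s0 (pt y s) by rewrite collar_pt.
have := pdwP (perfect_collar s00) dF (Cp x); set l := pdw _ _ _ _ => -[H].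
have H' : h^-1 *: (((fun x => F (pt x s)) \o shift x) (h *: (delta_mx 0 i : 'rV[R]_2)) - F (pt x s))
   @[h --> (0:R)^'] --> l.
  have H2 : dquot (tang i) F (pt x s) h @[h --> (0:R)^'] --> l.
    apply: cvg_trans H => A; rewrite /nbhs/= /nbhs/= /within/=.
    by apply: filterS => h; apply; rewrite /stays/= pt_addtang.
  apply: (cvg_near_eq _ H2); near=> h => /=.
  by rewrite /dquot pt_addtang [_ + x]addrC.
by apply: DeriveDef; [apply/cvg_ex; exists l|exact: cvg_lim].
Unshelve. all: by end_near. Qed.

End Collars.

(** * Expansions in powers of s at s = 0 *)

Section Jets.
Variable R : realType.
Implicit Types (phi psi : R -> R) (a b c : {poly R}) (k : nat).

(** A limit from the right at 0, wrapped in a record so that the rules for sums and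
    products apply without unfolding the filter. *)
Record lim0 phi (l : R) : Prop := Lim0 { lim0P : phi s @[s --> (0:R)^'+] --> l }.

Lemma near_pos : \forall s \near (0:R)^'+, 0 < s.
Proof. exact: nbhs_right_gt. Qed.

Lemma lim0_near phi psi l : (\forall s \near (0:R)^'+, phi s = psi s) ->
  lim0 phi l -> lim0 psi l.
Proof. by move=> E [H]; split; exact: cvg_near_eq H. Qed.

Lemma lim0_eq phi psi l : (forall s, 0 < s -> phi s = psi s) -> lim0 phi l -> lim0 psi l.
Proof. by move=> E; apply: lim0_near; apply: filterS near_pos. Qed.

Lemma lim0_cst (l : R) : lim0 (fun=> l) l.
Proof. by split; exact: cvg_cst. Qed.

Lemma lim0D phi psi l1 l2 : lim0 phi l1 -> lim0 psi l2 ->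
  lim0 (fun s => phi s + psi s) (l1 + l2).
Proof. by move=> [H1] [H2]; split; exact: cvgD. Qed.

Lemma lim0N phi l : lim0 phi l -> lim0 (fun s => - phi s) (- l).
Proof. by move=> [H]; split; exact: cvgN. Qed.

Lemma lim0B phi psi l1 l2 : lim0 phi l1 -> lim0 psi l2 ->
  lim0 (fun s => phi s - psi s) (l1 - l2).
Proof. by move=> H1 H2; apply: lim0D H1 (lim0N H2). Qed.

Lemma lim0M phi psi l1 l2 : lim0 phi l1 -> lim0 psi l2 ->
  lim0 (fun s => phi s * psi s) (l1 * l2).
Proof. by move=> [H1] [H2]; split; exact: cvgM. Qed.

Lemma lim0_unique phi l1 l2 : lim0 phi l1 -> lim0 phi l2 -> l1 = l2.
Proof. by move=> [H1] [H2]; exact: cvg_unique H1 H2. Qed.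

(** The polynomial a is an expansion of phi up to o(s^k).  Its degree is
    unrestricted, so expansions multiply like polynomials; only the coefficients
    of index at most k are determined by phi ([jet_uniq]). *)
Definition jet k phi a : Prop := lim0 (fun s => (phi s - a.[s]) / s ^+ k) 0.

Lemma horner_lim0 a : lim0 (horner a) a`_0.
Proof.
by rewrite -horner_coef0; split; apply: cvg_at_right_filter; exact: continuous_horner.
Qed.

Lemma id_lim0 : lim0 id 0.
Proof. by have := horner_lim0 'X; rewrite coefX; apply: lim0_eq => s _; rewrite hornerX. Qed.

Lemma expr_lim0 k : lim0 (fun s => s ^+ k.+1) 0.
Proof.
have := horner_lim0 ('X^(k.+1)); rewrite coefXn; apply: lim0_eq => s _.
by rewrite hornerXn.
Qed.

Lemma jet_near k phi psi a : (\forall s \near (0:R)^'+, phi s = psi s) ->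
  jet k phi a -> jet k psi a.
Proof. by move=> E; apply: lim0_near; apply: filterS E => s ->. Qed.

Lemma jet_ext k phi psi a : phi =1 psi -> jet k phi a -> jet k psi a.
Proof. by move=> E; apply: jet_near; apply: nearW. Qed.

Lemma jet_poly k a : jet k (fun s => a.[s]) a.
Proof.
by apply: lim0_eq (lim0_cst 0) => s _; rewrite subrr mul0r.
Qed.

Lemma jet_cst k (u : R) : jet k (fun=> u) u%:P.
Proof. by apply: jet_ext (jet_poly k _) => s; rewrite hornerC. Qed.

Lemma jetD k phi psi a b : jet k phi a -> jet k psi b ->
  jet k (fun s => phi s + psi s) (a + b).
Proof.
move=> Ha Hb; have := lim0D Ha Hb; rewrite addr0; apply: lim0_eq => s _; rewrite hornerD; ring.
Qed.

Lemma jetN k phi a : jet k phi a -> jet k (fun s => - phi s) (- a).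
Proof.
move=> Ha; have := lim0N Ha; rewrite oppr0; apply: lim0_eq => s _; rewrite hornerN; ring.
Qed.

Lemma jetB k phi psi a b : jet k phi a -> jet k psi b ->
  jet k (fun s => phi s - psi s) (a - b).
Proof. by move=> Ha Hb; apply: jetD Ha (jetN Hb). Qed.

Lemma jet_lim0 k phi a : jet k phi a -> lim0 phi a`_0.
Proof.
move=> Ha.
have Hs : lim0 (fun s => s ^+ k) (0 ^+ k).
  case: k {Ha} => [|k]; last by rewrite expr0n; exact: expr_lim0.
  by rewrite expr0; apply: lim0_eq (lim0_cst 1) => s _; rewrite expr0.
have := lim0D (lim0M Ha Hs) (horner_lim0 a); rewrite mul0r add0r; apply: lim0_eq => s s0.
by rewrite mulfVK ?subrK// expf_neq0// gt_eqF.
Qed.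

Lemma jetM k phi psi a b : jet k phi a -> jet k psi b ->
  jet k (fun s => phi s * psi s) (a * b).
Proof.
move=> Ha Hb.
have := lim0D (lim0M Ha (jet_lim0 Hb)) (lim0M (horner_lim0 a) Hb).
rewrite mul0r mulr0 addr0; apply: lim0_eq => s _; rewrite hornerM; ring.
Qed.

Lemma jetZ k phi a (u : R) : jet k phi a -> jet k (fun s => u * phi s) (u%:P * a).
Proof. by move=> Ha; apply: jetM => //; exact: jet_cst. Qed.

Lemma jet_mulX k phi a : jet k phi a -> jet k.+1 (fun s => s * phi s) ('X * a).
Proof.
apply: lim0_eq => s s_gt0; have s0 : s != 0 by rewrite gt_eqF.
rewrite hornerM hornerX -mulrBr exprS invfM mulrA; congr (_ * _).
by rewrite mulrAC divff// mul1r.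
Qed.

Lemma jetS k phi a : jet k.+1 phi a -> jet k phi a.
Proof.
move=> Ha; have := lim0M Ha id_lim0; rewrite mulr0; apply: lim0_eq => s s_gt0; have s0 : s != 0 by rewrite gt_eqF.
by rewrite exprSr invfM mulrA mulfVK.
Qed.

(** Division by s^k is evaluation of [drop_poly k c]. *)
Lemma poly_lead k c : (forall i, (i < k)%N -> c`_i = 0) ->
  lim0 (fun s => c.[s] / s ^+ k) c`_k.
Proof.
move=> c0; have E : c = drop_poly k c * 'X^k.
  rewrite -[LHS](poly_take_drop k) (_ : take_poly k c = 0) ?add0r//.
  by apply/polyP => i; rewrite coef_take_poly coef0; case: ltnP => // /c0.
have := horner_lim0 (drop_poly k c); rewrite coef_drop_poly add0n; apply: lim0_eq => s s_gt0; have s0 : s != 0 by rewrite gt_eqF.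
by rewrite {2}E hornerM hornerXn mulfK// expf_neq0.
Qed.

Lemma poly_small k c : lim0 (fun s => c.[s] / s ^+ k) (0:R) ->
  forall i, (i <= k)%N -> c`_i = 0.
Proof.
elim: k => [|k IH] H i.
  rewrite leqn0 => /eqP ->; apply: lim0_unique (horner_lim0 c) _ => //.
  by move: H; apply: lim0_eq => s _; rewrite expr0 divr1.
have c0 j : (j < k.+1)%N -> c`_j = 0.
  rewrite ltnS; apply: IH; have := lim0M H id_lim0; rewrite mulr0; apply: lim0_eq => s s_gt0; have s0 : s != 0 by rewrite gt_eqF.
  by rewrite exprSr invfM mulrA mulfVK.
rewrite leq_eqVlt => /predU1P[->|/c0//].
exact: lim0_unique (poly_lead c0) H.
Qed.

Lemma jet_uniq k phi a b : jet k phi a -> jet k phi b ->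
  forall i, (i <= k)%N -> a`_i = b`_i.
Proof.
move=> Ha Hb i ik; apply/eqP; rewrite -subr_eq0 -coefB; apply/eqP.
apply: (@poly_small k) ik.
have := lim0B Hb Ha; rewrite subr0; apply: lim0_eq => s _; rewrite hornerD hornerN; ring.
Qed.

Lemma jet_lead k phi psi a b : jet k phi a -> jet k psi b ->
  (forall i, (i < k)%N -> a`_i = b`_i) ->
  lim0 (fun s => (phi s - psi s) / s ^+ k) (a`_k - b`_k).
Proof.
move=> Ha Hb ab.
have c0 i : (i < k)%N -> (a - b)`_i = 0 by move=> ik; rewrite coefB ab// subrr.
have := lim0D (jetB Ha Hb) (poly_lead c0); rewrite add0r coefB; apply: lim0_eq => s _; ring.
Qed.

End Jets.

(** * Taylor coefficients in s of a function on the collar *)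

Section Taylor.
Variable R : realType.
Implicit Types (phi psi : R -> R) (a b c : {poly R}) (k : nat).

Lemma near_right_ball (P : R -> Prop) : (\forall s \near (0:R)^'+, P s) ->
  exists2 d : R, 0 < d & forall s, 0 < s < d -> P s.
Proof.
rewrite near_withinE -nbhs_ballE => -[d /= d0 H]; exists d => // s /andP[s0 sd].
by apply: H => //=; rewrite -ball_normE/= sub0r normrN gtr0_norm.
Qed.

Lemma near_rightP (P : R -> Prop) (d : R) : 0 < d -> (forall s, 0 < s < d -> P s) ->
  \forall s \near (0:R)^'+, P s.
Proof.
move=> d0 H; near=> s; apply: H; apply/andP; split; near: s; first exact: nbhs_right_gt.
exact: nbhs_right_lt.
Unshelve. all: by end_near. Qed.

(** Expansions integrate: the mean value theorem on [0, s] gives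
    phi s - b.[s] = s (dphi c - b^`().[c]) with 0 < c < s, and c^k <= s^k. *)
Lemma jet_int k (d : R) phi dphi (b : {poly R}) : 0 < d ->
  {within `[0, d], continuous phi} ->
  (forall s, 0 < s < d -> is_derive s 1 phi (dphi s)) ->
  b`_0 = phi 0 -> jet k dphi b^`() -> jet k.+1 phi b.
Proof.
move=> d0 cphi dphiP b0 [Hj]; split; apply/cvgrPdist_le => e e0.
move/cvgrPdist_le/(_ e e0): Hj => /near_right_ball[d1 d10 H1].
apply: (@near_rightP _ (Num.min d d1)); first by rewrite lt_min d0.
move=> s; rewrite lt_min => /and3P[s0 sd sd1].
pose g t := phi t - b.[t].
have gP t : t \in `]0, s[ -> is_derive t 1 g (dphi t - b^`().[t]).
  rewrite in_itv/= => ts; apply: is_deriveB.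
  by apply: dphiP; move: ts; lra.
have cg : {within `[0, s], continuous g}.
  move=> t; apply: cvgB.
    apply: (continuous_subspaceW _ cphi) => u /=; rewrite !in_itv/=; lra.
  by apply: continuous_subspaceT; exact: continuous_horner.
have [c cs E] := MVT s0 gP cg.
move: cs; rewrite in_itv/= => cs.
have g0 : g 0 = 0 by rewrite /g horner_coef0 b0 subrr.
rewrite g0 !subr0 in E; rewrite sub0r normrN -/(g s) E.
have cd1 : 0 < c < d1 by lra.
have := H1 c cd1; rewrite sub0r normrN !normrM !normfV.
have ck : 0 < `|c ^+ k| by rewrite normr_gt0 expf_neq0// gt_eqF//; lra.
rewrite ler_pdivrMr// => Hc.
have sk : 0 < `|s ^+ k.+1| by rewrite normr_gt0 expf_neq0// gt_eqF.
rewrite ler_pdivrMr// exprSr normrM mulrA ler_pM2r ?normr_gt0 ?gt_eqF//.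
apply: le_trans Hc _; rewrite ler_pM2l// !normrX lerXn2r ?nnegrE//.
by rewrite !gtr0_norm//; lra.
Qed.

Definition ds_at0 s0 (F : 'rV[R]_(2 + 1) -> R) (j : nat) (x : 'rV[R]_2) : R :=
  pdws (collar s0) (nseq j (ord_s)) F (pt x 0).

Definition taylor s0 k (F : 'rV[R]_(2 + 1) -> R) (x : 'rV[R]_2) : {poly R} :=
  \poly_(j < k.+1) (ds_at0 s0 F j x / j`!%:R).

Lemma pdws_nseqS D j (i : 'I_(2 + 1)) (F : 'rV[R]_(2 + 1) -> R) :
  pdws D (nseq j i) (pdw D i F) = pdws D (nseq j.+1 i) F.
Proof. by elim: j => //= j ->. Qed.

Lemma Ck_pdws k D (l : seq 'I_(2 + 1)) (F : 'rV[R]_(2 + 1) -> R) :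
  Ck (size l + k) D F -> Ck k D (pdws D l F).
Proof.
elim: l k => [|i l IH] k //= CF; apply: Ck_pdw; apply: IH; rewrite -[(size l + k.+1)%N]addSnnS; exact: CF.
Qed.

(** Taylor's formula with Peano remainder, by integrating the expansion of F_s. *)
Lemma Ck_jet s0 k (F : 'rV[R]_(2 + 1) -> R) x : 0 < s0 -> Ck k (collar s0) F ->
  jet k (fun s => F (pt x s)) (taylor s0 k F x).
Proof.
move=> s00; elim: k F => [|k IH] F CF.
  have /(continuous_within_itvP _ s00)[_ F1 _] := s_slice_cont (x := x) (Ck_cont CF).
  have F2 : lim0 (fun s => F (pt x s)) (F (pt x 0)) by [].
  have := lim0B F2 (lim0_cst (F (pt x 0))); rewrite subrr; apply: lim0_eq => s _.
  by rewrite /taylor horner_poly big_ord1 expr0 divr1 mulr1 divr1.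
apply: (@jet_int _ s0 _ (fun s => pdw (collar s0) ord_s F (pt x s))) => //.
- exact: s_slice_cont (Ck_cont CF).
- by move=> s ss0; apply: s_slice_derive => //; exact: Ck_derivable CF.
- by rewrite coef_poly/= divr1.
have -> : (taylor s0 k.+1 F x)^`() = taylor s0 k (pdw (collar s0) ord_s F) x.
  apply/polyP => i; rewrite coef_deriv !coef_poly ltnS; case: ifP => ik; last by rewrite mul0rn.
  rewrite /ds_at0 pdws_nseqS factS natrM -[LHS]mulr_natr.
  have : i.+1%:R != 0 :> R by rewrite pnatr_eq0.
  have : i`!%:R != 0 :> R by rewrite pnatr_eq0 -lt0n fact_gt0.
  by move: (pdws _ _ _ _) (i.+1%:R) (i`!%:R) => z u v *; field; apply/andP.
exact/IH/Ck_pdw.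
Qed.

Lemma taylor_coef s0 k (F : 'rV[R]_(2 + 1) -> R) x j : (j <= k)%N -> (taylor s0 k F x)`_j = ds_at0 s0 F j x / j`!%:R.
Proof. by move=> jk; rewrite coef_poly ltnS jk. Qed.

Lemma ds_at0_s s0 (F : 'rV[R]_(2 + 1) -> R) j x : ds_at0 s0 (pdw (collar s0) ord_s F) j x = ds_at0 s0 F j.+1 x.
Proof. by rewrite /ds_at0 pdws_nseqS. Qed.

Lemma pdws_nseq_tan s0 (F : 'rV[R]_(2 + 1) -> R) j i q : 0 < s0 -> Ck j.+1 (collar s0) F -> collar s0 q ->
  pdws (collar s0) (nseq j ord_s) (pdw (collar s0) i F) q =
  pdw (collar s0) i (pdws (collar s0) (nseq j ord_s) F) q.
Proof.
move=> s00; elim: j q => [//|j IH] q CF Cq.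
change (pdw (collar s0) ord_s (pdws (collar s0) (nseq j ord_s) (pdw (collar s0) i F)) q =
  pdw (collar s0) i (pdw (collar s0) ord_s (pdws (collar s0) (nseq j ord_s) F)) q).
transitivity (pdw (collar s0) ord_s (pdw (collar s0) i (pdws (collar s0) (nseq j ord_s) F)) q).
  by apply: pdw_eq => // y /[!inE] Cy; apply: IH => //; exact: CkS.
apply: pdw_comm => //; apply: Ck_pdws; rewrite size_nseq; apply: Ck_le CF.
by rewrite addnC.
Qed.

(** Commuting d_s past tangential derivatives reduces the derivative of a Taylor
    coefficient in x to the Taylor coefficient of a derivative. *)
Lemma ds_at0_is_derive s0 (F : 'rV[R]_(2 + 1) -> R) j (x : 'rV[R]_2) (i : 'I_2) : 0 < s0 -> Ck j.+1 (collar s0) F ->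
  is_derive x (delta_mx 0 i : 'rV[R]_2) (ds_at0 s0 F j) (ds_at0 s0 (pdw (collar s0) (tang i) F) j x).
Proof.
move=> s00 CF; rewrite /ds_at0 pdws_nseq_tan//; last by rewrite collar_pt lexx ltW.
apply: tang_pd => //; first by rewrite lexx ltW.
by apply: (@Ck_derivable _ _ 0); apply: Ck_pdws; rewrite size_nseq [(j + 1)%N]addn1.
Qed.

Lemma ds_at0_tang s0 (F : 'rV[R]_(2 + 1) -> R) j (x : 'rV[R]_2) (i : 'I_2) : 0 < s0 -> Ck j.+1 (collar s0) F ->
  ds_at0 s0 (pdw (collar s0) (tang i) F) j x = pd i (ds_at0 s0 F j) x.
Proof. by move=> s00 CF; have H := @ds_at0_is_derive s0 F j x i s00 CF; rewrite /pd derive_val. Qed.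

End Taylor.

(** * Derivative rules and the round metric in stereographic coordinates *)

Section Calculus.
Variables (R : realType) (n : nat).
Implicit Types (D : set 'rV[R]_n) (i : 'I_n) (F G : 'rV[R]_n -> R).

Lemma has_pdw_conv D i F G x l k : has_pdw D i F x l -> F =1 G -> l = k -> has_pdw D i G x k.
Proof. by move=> H /funext <- <-. Qed.

Lemma has_pdwN D i F x l : has_pdw D i F x l -> has_pdw D i (fun z => - F z) x (- l).
Proof.
move=> H; have := has_pdwM (has_pdw_cst D i (-1) x) H.
rewrite mul0r add0r mulN1r (_ : (fun z => -1 * F z) = fun z => - F z)//.
by apply/funext => z; rewrite mulN1r.
Qed.

Lemma has_pdwZ D i F x l (u : R) : has_pdw D i F x l -> has_pdw D i (fun z => u * F z) x (u * l).
Proof. by move=> H; have := has_pdwM (has_pdw_cst D i u x) H; rewrite mul0r add0r. Qed.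

Lemma has_pdwX D i F x l k : has_pdw D i F x l ->
  has_pdw D i (fun z => F z ^+ k.+1) x (k.+1%:R * F x ^+ k * l).
Proof.
move=> H; elim: k => [|k IH].
  by rewrite expr0 !mul1r (_ : (fun z => F z ^+ 1) = F)//; apply/funext => z; rewrite expr1.
have := has_pdwM H IH.
have -> : l * F x ^+ k.+1 + F x * (k.+1%:R * F x ^+ k * l) = k.+2%:R * F x ^+ k.+1 * l.
  by rewrite exprS -[k.+2%:R]natr1; ring.
by rewrite (_ : (fun z => F z * F z ^+ k.+1) = (fun z => F z ^+ k.+2)).
Qed.

Lemma has_pdwV D i F x l : F x != 0 -> has_pdw D i F x l ->
  has_pdw D i (fun z => (F z)^-1) x (- (F x ^- 2) * l).
Proof.
move=> F0 H.
have cF := cvg_stays H; case: H => H.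
have cV : (F (x + h *: delta_mx 0 i))^-1 @[h --> within (stays D i x) (0:R)^'] --> (F x)^-1.
  exact: cvgV.
have cF0 : - (F x)^-1 @[_ --> within (stays D i x) (0:R)^'] --> - (F x)^-1 by exact: cvg_cst.
split; rewrite -exprVn expr2 -mulNr.
apply: (cvg_near_eq _ (cvgM (cvgM cF0 cV) H)).
have : \forall h \near within (stays D i x) (0:R)^', F (x + h *: delta_mx 0 i) != 0.
  exact: cvgr_neq0 cF F0.
apply: filterS => h h0 /=; rewrite /dquot.
move: h0 F0; move: (F (x + _)) (F x) (h^-1) => u v w u0 v0.
by field; rewrite u0 v0.
Qed.

(** Multiply the difference quotient by the sum of the two roots. *)
Lemma has_pdw_sqrt D i F x l : 0 < F x -> has_pdw D i F x l ->
  has_pdw D i (fun z => Num.sqrt (F z)) x ((2 * Num.sqrt (F x))^-1 * l).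
Proof.
move=> F0 H; have cF := cvg_stays H; case: H => H.
have s0 : 0 < Num.sqrt (F x) by rewrite sqrtr_gt0.
have cS : Num.sqrt (F (x + h *: delta_mx 0 i)) @[h --> within (stays D i x) (0:R)^'] -->
    Num.sqrt (F x).
  by apply: cvg_comp cF _; exact: sqrt_continuous.
have cF0 : Num.sqrt (F x) @[_ --> within (stays D i x) (0:R)^'] --> Num.sqrt (F x) by exact: cvg_cst.
have s2 : Num.sqrt (F x) + Num.sqrt (F x) != 0 by rewrite gt_eqF// addr_gt0.
split; rewrite mulr_natl mulr2n.
apply: (cvg_near_eq (f := fun h => (Num.sqrt (F (x + h *: delta_mx 0 i)) +
   Num.sqrt (F x))^-1 * dquot i F x h)); last exact: cvgM (cvgV s2 (cvgD cS cF0)) H.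
have : \forall h \near within (stays D i x) (0:R)^', 0 < F (x + h *: delta_mx 0 i).
  exact: cvgr_gt cF _ F0.
apply: filterS => h h0 /=; rewrite /dquot.
rewrite -{2}(sqr_sqrtr (ltW F0)) -{2}(sqr_sqrtr (ltW h0)).
have : Num.sqrt (F (x + h *: 'e_i)) + Num.sqrt (F x) != 0.
  by rewrite gt_eqF// addr_gt0// sqrtr_gt0.
move: (Num.sqrt (F (x + _))) (Num.sqrt (F x)) (h^-1) => u v w uv.
by field.
Qed.

End Calculus.

(** A partial derivative of F at an interior point can be computed from a function G
    of other variables that agrees with F along the coordinate line; here F lives
    on spacetime, and G on the collar with one-sided derivatives. *)
Lemma pd_via (R : realType) n n' (D : set 'rV[R]_n') (F : 'rV[R]_n -> R) (G : 'rV[R]_n' -> R)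
    i i' p q l :
  F p = G q ->
  (\forall h \near (0:R), D (q + h *: delta_mx 0 i') /\
     F (p + h *: delta_mx 0 i) = G (q + h *: delta_mx 0 i')) ->
  has_pdw D i' G q l -> pd i F p = l.
Proof.
move=> E0 nE [H].
have nE' := nbhs_dnbhs nE.
have H2 : dquot i' G q h @[h --> (0:R)^'] --> l.
  apply: cvg_trans H => A; rewrite /nbhs/= /nbhs/= /within/=.
  by move: nE'; apply: filterS2 => h [Sh _]; exact.
apply: cvg_lim => //; apply: (cvg_near_eq _ H2).
move: nE'; apply: filterS => h [_ Eh] /=.
by rewrite /dquot [_ + p]addrC Eh E0.
Qed.

Lemma pd_has_pdw (R : realType) n (F : 'rV[R]_n -> R) i x l : has_pdw setT i F x l -> pd i F x = l.
Proof. by move=> H; apply: (pd_via (erefl _) _ H); near=> h; split. Unshelve. all: by end_near. Qed.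

Section Stereographic.
Variable R : realType.
Implicit Types (x : 'rV[R]_2) (c : bool) (F G : 'rV[R]_2 -> R).

Let i0 : 'I_2 := ord0.
Let i1 : 'I_2 := ord_max.

Definition nsq x : R := x 0 i0 ^+ 2 + x 0 i1 ^+ 2.

(** The inverse of the conformal factor of the round metric. *)
Definition mu x : R := (1 + nsq x) ^+ 2 / 4.

Lemma sum2 (f : 'I_2 -> R) : \sum_i f i = f i0 + f i1.
Proof. by rewrite big_ord_recl big_ord1; congr (_ + f _); apply/val_inj. Qed.

Lemma nsq_ge0 x : 0 <= nsq x.
Proof. by rewrite addr_ge0// sqr_ge0. Qed.

Lemma mu_gt0 x : 0 < mu x.
Proof. by rewrite divr_gt0// exprn_gt0// ltr_pwDl// nsq_ge0. Qed.

Lemma ord2P (i : 'I_2) : i = i0 \/ i = i1.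
Proof. by case: i => [[|[|//]]] h; [left|right]; apply/val_inj. Qed.

Lemma has_pdw_nsq i x : has_pdw setT i nsq x (2 * x 0 i).
Proof.
have := has_pdwD (has_pdwX 1 (has_pdw_coord setT i i0 x)) (has_pdwX 1 (has_pdw_coord setT i i1 x)).
rewrite !expr1 (_ : _ + _ = 2 * x 0 i)//.
by case: (ord2P i) => ->; rewrite ?mulr1 ?mulr0 ?addr0 ?add0r.
Qed.

Definition den x : R := (1 + nsq x)^-1.

Lemma den_neq0 x : 1 + nsq x != 0.
Proof. by rewrite gt_eqF// ltr_pwDl// nsq_ge0. Qed.

Lemma has_pdw_den i x : has_pdw setT i den x (- 2 * x 0 i * den x ^+ 2).
Proof.
have := has_pdwV (den_neq0 x) (has_pdwD (has_pdw_cst setT i 1 x) (has_pdw_nsq i x)).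
by move=> /has_pdw_conv; apply=> //; rewrite /den exprVn; ring.
Qed.

Lemma stereo_tang c x (k : 'I_2) : stereo c x 0 (tang k) = 2 * x 0 k * den x.
Proof. by rewrite /stereo sum2 mxE row_mxEl mxE mulrC /den /nsq; ring. Qed.

Lemma stereo_s c x : stereo c x 0 ord_s = (-1) ^+ c * (2 * den x - 1).
Proof.
rewrite /stereo sum2 mxE row_mxEr mxE mulr1n /den -/(nsq x).
by have := den_neq0 x; move: (nsq x) ((-1) ^+ c) => q u N0; field.
Qed.

Lemma stereo_sphere c x : sphere (stereo c x).
Proof.
rewrite /sphere/= (big_ord_recr 2) /= sum2.
have E (k : 'I_2) : widen_ord (leqnSn 2) k = tang k by apply/val_inj.
have -> : ord_max = ord_s by apply/val_inj.
rewrite !E !stereo_tang stereo_s [((-1) ^+ _ * _) ^+ 2]exprMn sqrr_sign mul1r.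
by rewrite /den; have := den_neq0 x; rewrite /nsq => N0; field.
Qed.

(** Stereographic projection is conformal; both charts have the same factor because
    they differ by a reflection of R^3. *)
Lemma sigmaE c x : sigma c x = ((mu x)^-1)%:M.
Proof.
apply/matrixP => i j; rewrite !mxE (big_ord_recr 2) /= sum2.
have E (k : 'I_2) : widen_ord (leqnSn 2) k = tang k by apply/val_inj.
have -> : ord_max = ord_s by apply/val_inj.
rewrite !E.
have dt (l k : 'I_2) : pd l (fun z => stereo c z 0 (tang k)) x =
    2 * (l == k)%:R * den x - 4 * x 0 k * x 0 l * den x ^+ 2.
  apply: pd_has_pdw.
  have := has_pdwM (has_pdwZ 2 (has_pdw_coord setT l k x)) (has_pdw_den l x).
  by move=> /has_pdw_conv; apply=> [z|]; rewrite ?stereo_tang//; ring.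
have ds (l : 'I_2) : pd l (fun z => stereo c z 0 ord_s) x =
    (-1) ^+ c * (- 4 * x 0 l * den x ^+ 2).
  apply: pd_has_pdw.
  have := has_pdwZ ((-1) ^+ c) (has_pdwD (has_pdwZ 2 (has_pdw_den l x)) (has_pdw_cst setT l (-1) x)).
  by move=> /has_pdw_conv; apply=> [z|]; rewrite ?stereo_s//; ring.
rewrite !dt !ds [(_ ^+ _ * _) * (_ ^+ _ * _)]mulrACA -expr2 sqrr_sign mul1r.
have := den_neq0 x; rewrite /mu /den /nsq.
case: (ord2P i) => ->; case: (ord2P j) => -> /=; move: (x 0 i0) (x 0 i1) => u v N0.
- by rewrite !mulr1n; field.
- by rewrite !mulr0n; field.
- by rewrite !mulr0n; field.
- by rewrite !mulr1n; field.
Qed.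

End Stereographic.

Section Operators.
Variable R : realType.
Implicit Types (x : 'rV[R]_2) (c : bool) (F G : 'rV[R]_2 -> R).

Lemma sigma_inv c x : invmx (sigma c x) = (mu x)%:M.
Proof. by rewrite sigmaE invmx_scalar invrK. Qed.

Lemma sigma_volume c x : volume_density (sigma c) x = (mu x)^-1.
Proof.
rewrite /volume_density sigmaE det_scalar normrX sqrtr_sqr normr_id gtr0_norm//.
by rewrite invr_gt0 mu_gt0.
Qed.

Lemma sigma_grad c F x i : grad (sigma c) F x 0 i = mu x * pd i F x.
Proof. by rewrite /grad sigma_inv mul_mx_scalar !mxE. Qed.

Lemma SdotE c F G x : Sdot c F G x =
  mu x * (pd ord0 F x * pd ord0 G x + pd ord_max F x * pd ord_max G x).
Proof.
rewrite /Sdot /gradprod /inner sigmaE mul_mx_scalar -scalemxAl mxE mxE sum2 ![(_^T)%R _ _]mxE !sigma_grad.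
have : mu x != 0 by rewrite gt_eqF// mu_gt0.
move: (mu x) (pd ord0 F x) (pd ord0 G x) (pd ord_max F x) (pd ord_max G x).
by move=> u f0 g0 f1 g1 u0; field.
Qed.

Lemma SlapE c F x : Slap c F x =
  mu x * (pd ord0 (pd ord0 F) x + pd ord_max (pd ord_max F) x).
Proof.
rewrite /Slap /laplacian /divergence sum2 sigma_volume invrK.
have E i : (fun z => volume_density (sigma c) z * grad (sigma c) F z 0 i) = pd i F.
  apply/funext => z; rewrite sigma_volume sigma_grad mulrA mulVf ?mul1r//.
  by rewrite gt_eqF// mu_gt0.
by rewrite !E.
Qed.

End Operators.

(** * The mean curvature of a graph *)

Section Graph.
Variables (R : realType) (m : R).
Implicit Types (x : 'rV[R]_2) (c : bool) (z : 'rV[R]_(2 + 2)) (q : 'rV[R]_(2 + 1)).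

Definition Acoef (s : R) : R := s ^+ 2 * (1 - 2 * m * s).

(** The equations are invariant under translation in v: all fields below are
    functions on the collar composed with this projection. *)
Definition cproj z : 'rV[R]_(2 + 1) := pt (lsubmx z) (s_of z).

Definition vdir : 'I_(2 + 2) := rshift 2 ord_max.
Definition sdir : 'I_(2 + 2) := rshift 2 ord0.
Definition tdir (i : 'I_2) : 'I_(2 + 2) := lshift 2 i.

Lemma add_delta n (z : 'rV[R]_n) (h : R) I k :
  (z + h *: delta_mx 0 I) 0 k = z 0 k + h * (k == I)%:R.
Proof. by rewrite !mxE eqxx. Qed.

Lemma lsubmxE z k : lsubmx z 0 k = z 0 (lshift 2 k).
Proof. by rewrite mxE. Qed.

Lemma proj_tdir z h i : cproj (z + h *: delta_mx 0 (tdir i)) = cproj z + h *: delta_mx 0 (tang i).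
Proof.
rewrite /cproj pt_addtang; congr pt; last by rewrite /s_of add_delta eq_rlshift mulr0 addr0.
apply/rowP => k; rewrite add_delta !lsubmxE add_delta.
by rewrite /tdir (inj_eq (@lshift_inj _ _)).
Qed.

Lemma proj_sdir z h : cproj (z + h *: delta_mx 0 sdir) = cproj z + h *: delta_mx 0 ord_s.
Proof.
rewrite /cproj pt_adds; congr pt; last by rewrite /s_of add_delta eqxx mulr1.
by apply/rowP => k; rewrite !lsubmxE add_delta eq_lrshift mulr0 addr0.
Qed.

Lemma proj_vdir z h : cproj (z + h *: delta_mx 0 vdir) = cproj z.
Proof.
rewrite /cproj; congr pt.
  by apply/rowP => k; rewrite !lsubmxE add_delta eq_lrshift mulr0 addr0.
by rewrite /s_of add_delta (inj_eq (@rshift_inj _ _)) mulr0 addr0.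
Qed.

Lemma v_tdir z h i : v_of (z + h *: delta_mx 0 (tdir i)) = v_of z.
Proof. by rewrite /v_of add_delta eq_rlshift mulr0 addr0. Qed.

Lemma v_sdir z h : v_of (z + h *: delta_mx 0 sdir) = v_of z.
Proof. by rewrite /v_of add_delta (inj_eq (@rshift_inj _ _)) mulr0 addr0. Qed.

Lemma v_vdir z h : v_of (z + h *: delta_mx 0 vdir) = v_of z + h.
Proof.
rewrite /v_of add_delta (_ : rshift 2 1 = vdir) ?eqxx ?mulr1//.
by congr rshift; apply/val_inj.
Qed.

Lemma proj_s z : cproj z 0 ord_s = s_of z.
Proof. exact: pt_s. Qed.

Lemma definingE c P z : defining c P z = v_of z + in_chart c P (cproj z).
Proof. by rewrite /defining /in_chart pt_x proj_s. Qed.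

Lemma gSch_block c z : gSch m c z =
  s_of z ^- 2 *: block_mx ((mu (lsubmx z))^-1%:M : 'M[R]_2) 0 0
    (block_mx 0%:M 1%:M 1%:M (- Acoef (s_of z))%:M : 'M[R]_(1 + 1)).
Proof. by rewrite /gSch sigmaE. Qed.

Definition ginv z : 'M[R]_(2 + 2) :=
  s_of z ^+ 2 *: block_mx ((mu (lsubmx z))%:M : 'M[R]_2) 0 0
    (block_mx (Acoef (s_of z))%:M 1%:M 1%:M 0 : 'M[R]_(1 + 1)).

Lemma swapblock_mulV (u : R) :
  block_mx 0%:M 1%:M 1%:M (- u)%:M *m block_mx u%:M 1%:M 1%:M 0 = 1%:M :> 'M[R]_(1 + 1).
Proof.
rewrite mulmx_block !(mulmx0, mul0mx, addr0, add0r, mulmx1, mul1mx).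
by rewrite mul_scalar_mx scale0r add0r -raddfD/= addrN raddf0 [RHS]scalar_mx_block.
Qed.

Lemma gSch_mulV c z : s_of z != 0 -> gSch m c z *m ginv z = 1%:M.
Proof.
move=> s0; rewrite gSch_block /ginv -scalemxAl -scalemxAr scalerA mulVf ?expf_neq0// scale1r.
rewrite mulmx_block !(mulmx0, mul0mx, addr0, add0r) -scalar_mxM.
rewrite mulVf ?gt_eqF ?mu_gt0// swapblock_mulV.
by rewrite [RHS]scalar_mx_block.
Qed.

Lemma gSch_inv c z : s_of z != 0 -> invmx (gSch m c z) = ginv z.
Proof.
move=> s0; have E := gSch_mulV c s0; have [u _] := mulmx1_unit E.
by rewrite -[LHS]mulmx1 -E mulKmx.
Qed.

(** A row operation makes the block triangular with diagonal 1, -1. *)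
Lemma det_swapblock (u : R) :
  \det (block_mx 0%:M 1%:M 1%:M u%:M : 'M[R]_(1 + 1)) = -1.
Proof.
have E : block_mx 1%:M 1%:M 0 1%:M *m block_mx 0%:M 1%:M 1%:M u%:M =
  block_mx 1%:M 0 1%:M 1%:M *m (block_mx 1%:M (1 + u)%:M 0 (-1)%:M : 'M[R]_(1 + 1)).
  rewrite !mulmx_block !(mulmx1, mul1mx, mulmx0, mul0mx, addr0, add0r) -!raddfD/=.
  by rewrite add0r addrAC subrr add0r.
have := congr1 determinant E.
by rewrite !det_mulmx !det_ublock det_lblock !det_scalar1 !mul1r.
Qed.

Lemma gSch_volume c z : 0 < s_of z ->
  volume_density (gSch m c) z = s_of z ^- 4 * (mu (lsubmx z))^-1.
Proof.
move=> s0; rewrite /volume_density gSch_block detZ det_ublock det_scalar.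
rewrite det_swapblock.
rewrite mulrN1 mulrN normrN ger0_norm; last first.
  by rewrite mulr_ge0 ?exprn_ge0 ?invr_ge0 ?exprn_ge0// ltW// mu_gt0.
have -> : (s_of z ^- 2) ^+ (2 + 2) * (mu (lsubmx z))^-1 ^+ 2 =
  (s_of z ^- 4 * (mu (lsubmx z))^-1) ^+ 2.
  by rewrite exprMn -!exprVn -!exprM.
rewrite sqrtr_sqr ger0_norm//.
by rewrite mulr_ge0// invr_ge0 ltW ?mu_gt0 ?exprn_gt0.
Qed.

Definition muq q : R := mu (lsubmx q).
Definition Aq q : R := Acoef (q 0 ord_s).

Variables (s0 : R) (c : bool) (P : 'rV[R]_3 -> R -> R).
Let D := collar s0.
Let F := in_chart c P.
Let d (i : 'I_(2 + 1)) := pdw D i F.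
Let t0 : 'I_(2 + 1) := tang ord0.
Let t1 : 'I_(2 + 1) := tang ord_max.

(** Minus the squared length of d(v + P) for the conformal metric s^2 g. *)
Definition Wq q : R :=
  - (Aq q * d ord_s q ^+ 2 + 2 * d ord_s q + muq q * (d t0 q ^+ 2 + d t1 q ^+ 2)).

Hypothesis s00 : 0 < s0.
Hypothesis CF : Ck 2 D F.

Let pD : perfect D := perfect_collar s00.

Lemma near_collar z i : 0 < s_of z < s0 ->
  \forall h \near (0:R), D (cproj z + h *: delta_mx 0 i).
Proof.
move=> zs; apply: (@near0P _ _ (Num.min (s_of z) (s0 - s_of z))).
  by rewrite lt_min; lra.
move=> h; rewrite lt_min !ltr_norml => hz; rewrite /D /cproj.
have [->|[k ->]] := tang_or_s i.
  by rewrite pt_adds collar_pt; lra.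
by rewrite pt_addtang collar_pt; lra.
Qed.

Lemma in_collar z : 0 < s_of z < s0 -> D (cproj z).
Proof. by move=> zs; rewrite /D collar_pt; lra. Qed.

Lemma has_pdw_d i q : D q -> has_pdw D i F q (d i q).
Proof. move=> Dq; apply: pdwP => //; exact: Ck_derivable CF. Qed.

Lemma pd_defining_t z i : 0 < s_of z < s0 ->
  pd (tdir i) (defining c P) z = d (tang i) (cproj z).
Proof.
move=> zs; have Dz := in_collar zs.
have := has_pdwD (has_pdw_cst D (tang i) (v_of z) (cproj z)) (has_pdw_d (tang i) Dz).
rewrite add0r; apply: pd_via; first by rewrite definingE.
by apply: filterS (near_collar (tang i) zs) => h Dh; rewrite definingE proj_tdir v_tdir.
Qed.

Lemma pd_defining_s z : 0 < s_of z < s0 ->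
  pd sdir (defining c P) z = d ord_s (cproj z).
Proof.
move=> zs; have Dz := in_collar zs.
have := has_pdwD (has_pdw_cst D ord_s (v_of z) (cproj z)) (has_pdw_d ord_s Dz).
rewrite add0r; apply: pd_via; first by rewrite definingE.
by apply: filterS (near_collar ord_s zs) => h Dh; rewrite definingE proj_sdir v_sdir.
Qed.

Lemma pd_defining_v z : pd vdir (defining c P) z = 1.
Proof.
have := has_pdwD (has_pdw_coord setT vdir vdir z) (has_pdw_cst setT vdir (F (cproj z)) z).
rewrite eqxx addr0; apply: pd_via; first by rewrite definingE /v_of; congr (z 0 _ + _); apply/val_inj.
near=> h; split=> //; rewrite definingE proj_vdir v_vdir add_delta eqxx mulr1.
by congr (z 0 _ + _ + _); apply/val_inj.
Unshelve. all: by end_near. Qed.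

Definition dF q : 'rV[R]_(2 + 2) :=
  row_mx (\row_i d (tang i) q) (row_mx (d ord_s q)%:M 1%:M : 'rV[R]_(1 + 1)).

Lemma rowE4 (v w : 'rV[R]_(2 + 2)) : (forall i, v 0 (tdir i) = w 0 (tdir i)) ->
  v 0 sdir = w 0 sdir -> v 0 vdir = w 0 vdir -> v = w.
Proof.
move=> vt vs vv; apply/rowP => k; case: (split_ordP k) => j ->; first exact: vt.
by case: (ord2P j) => ->.
Qed.

Lemma row4_t (a : 'rV[R]_2) (b : 'rV[R]_(1 + 1)) i : row_mx a b 0 (tdir i) = a 0 i.
Proof. exact: row_mxEl. Qed.

Lemma row4_s (a : 'rV[R]_2) (u v : 'rV[R]_1) :
  row_mx a (row_mx u v : 'rV[R]_(1 + 1)) 0 sdir = u 0 0.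
Proof.
rewrite row_mxEr (_ : ord0 = lshift 1 ord0 :> 'I_(1 + 1)) ?row_mxEl//.
exact/val_inj.
Qed.

Lemma row4_v (a : 'rV[R]_2) (u v : 'rV[R]_1) :
  row_mx a (row_mx u v : 'rV[R]_(1 + 1)) 0 vdir = v 0 0.
Proof.
rewrite row_mxEr (_ : ord_max = rshift 1 ord0 :> 'I_(1 + 1)) ?row_mxEr//.
exact/val_inj.
Qed.

Lemma differE z : 0 < s_of z < s0 -> differ (defining c P) z = dF (cproj z).
Proof.
move=> zs; apply: rowE4 => [i||].
- by rewrite [LHS]mxE row4_t mxE; exact: pd_defining_t.
- by rewrite [LHS]mxE row4_s mxE mulr1n; exact: pd_defining_s.
- by rewrite [LHS]mxE row4_v mxE mulr1n; exact: pd_defining_v.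
Qed.

Definition gF z : 'rV[R]_(2 + 2) :=
  s_of z ^+ 2 *: row_mx (mu (lsubmx z) *: \row_i d (tang i) (cproj z))
   (row_mx (d ord_s (cproj z) * Acoef (s_of z) + 1)%:M (d ord_s (cproj z))%:M : 'rV[R]_(1 + 1)).

Lemma row_swapblock (a b u : R) :
  (row_mx a%:M b%:M : 'rV[R]_(1 + 1)) *m block_mx u%:M 1%:M 1%:M 0 =
  row_mx (a * u + b)%:M a%:M :> 'rV[R]_(1 + 1).
Proof. by rewrite mul_row_block !mulmx1 mulmx0 addr0 -scalar_mxM -raddfD. Qed.

Lemma gradE z : 0 < s_of z < s0 -> grad (gSch m c) (defining c P) z = gF z.
Proof.
move=> zs; rewrite /grad differE// gSch_inv; last by rewrite gt_eqF//; lra.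
rewrite /ginv -scalemxAr /dF mul_row_block !mulmx0 addr0 add0r mul_mx_scalar.
by rewrite row_swapblock.
Qed.

Lemma grad_t z i : 0 < s_of z < s0 ->
  grad (gSch m c) (defining c P) z 0 (tdir i) =
  s_of z ^+ 2 * (mu (lsubmx z) * d (tang i) (cproj z)).
Proof. by move=> zs; rewrite gradE// /gF mxE row4_t !mxE. Qed.

Lemma grad_s z : 0 < s_of z < s0 ->
  grad (gSch m c) (defining c P) z 0 sdir =
  s_of z ^+ 2 * (d ord_s (cproj z) * Acoef (s_of z) + 1).
Proof. by move=> zs; rewrite gradE// /gF mxE row4_s !mxE. Qed.

Lemma grad_v z : 0 < s_of z < s0 ->
  grad (gSch m c) (defining c P) z 0 vdir = s_of z ^+ 2 * d ord_s (cproj z).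
Proof. by move=> zs; rewrite gradE// /gF mxE row4_v !mxE. Qed.

Lemma sum4 (f : 'I_(2 + 2) -> R) :
  \sum_i f i = f (tdir ord0) + f (tdir ord_max) + f sdir + f vdir.
Proof. by rewrite big_split_ord /= !sum2 addrA. Qed.

Lemma AqE z : Aq (cproj z) = Acoef (s_of z).
Proof. by rewrite /Aq proj_s. Qed.

Lemma muqE z : muq (cproj z) = mu (lsubmx z).
Proof. by rewrite /muq pt_x. Qed.

Lemma gradprodE z : 0 < s_of z < s0 ->
  gradprod (gSch m c) (defining c P) (defining c P) z = - (s_of z ^+ 2 * Wq (cproj z)).
Proof.
move=> zs; rewrite /gradprod /inner {1}/grad.
have s0' : s_of z != 0 by rewrite gt_eqF//; lra.
rewrite mulmxKV; last by have [] := mulmx1_unit (gSch_mulV c s0').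
rewrite mxE sum4 ![(_^T)%R _ _]mxE !grad_t// grad_s// grad_v// differE// /dF !row4_t row4_s row4_v.
rewrite !mxE /= !mulr1n /Wq AqE muqE -/t0 -/t1.
move: (s_of z) (d t0 _) (d t1 _) (d ord_s _) (mu _) (Acoef _) => s p0 p1 p2 u A.
by ring.
Qed.

(** The powers of s: the volume density contributes s^-4, the gradient for g carries
    s^2 (inside [grad]), and its length contributes s^-1. *)
Lemma normal_field z (I : 'I_(2 + 2)) : 0 < s_of z < s0 ->
  volume_density (gSch m c) z * unit_normal m c P z 0 I =
  - (s_of z ^- 5 * (mu (lsubmx z))^-1 * (Num.sqrt (Wq (cproj z)))^-1 *
     grad (gSch m c) (defining c P) z 0 I).
Proof.
move=> zs; have s0' : 0 < s_of z by lra.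
rewrite gSch_volume// /unit_normal mxE gradprodE// opprK sqrtrM ?sqr_ge0// sqrtr_sqr gtr0_norm//.
rewrite [(_ * Num.sqrt _)^-1]invfM; have : mu (lsubmx z) != 0 by rewrite gt_eqF// mu_gt0.
move: (Num.sqrt _)^-1 (grad _ _ _ 0 I) (mu _) (s_of z) (lt0r_neq0 s0') => w G u s s1 u0.
by field; rewrite u0.
Qed.

Hypothesis CW : Ck 1 D Wq.
Let dW (i : 'I_(2 + 1)) := pdw D i Wq.

Lemma has_pdw_W i q : D q -> has_pdw D i Wq q (dW i q).
Proof. move=> Dq; apply: pdwP => //; exact: Ck_derivable CW. Qed.

Lemma has_pdw_dd i j q : D q -> has_pdw D i (d j) q (pdw D i (d j) q).
Proof. move=> Dq; apply: pdwP => //; exact: Ck_derivable (Ck_pdw _ CF). Qed.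

Lemma has_pdw_Vsqrt i q : D q -> 0 < Wq q ->
  has_pdw D i (fun q => (Num.sqrt (Wq q))^-1) q
    (- (2 * Num.sqrt (Wq q) ^+ 3)^-1 * dW i q).
Proof.
move=> Dq W0; have w0 : Num.sqrt (Wq q) != 0 by rewrite gt_eqF// sqrtr_gt0.
apply: has_pdw_conv (has_pdwV w0 (has_pdw_sqrt W0 (has_pdw_W i Dq))) _ _ => //.
by move: (Num.sqrt _) w0 => w w0; field.
Qed.

Lemma has_pdw_Aq q : has_pdw D ord_s Aq q (2 * q 0 ord_s - 6 * m * q 0 ord_s ^+ 2).
Proof.
have H := has_pdw_coord D ord_s ord_s q; rewrite eqxx mulr1n in H.
apply: has_pdw_conv (has_pdwM (has_pdwX 1 H) (has_pdwD (has_pdw_cst D ord_s 1 q) (has_pdwZ (- (2 * m)) H))) _ _.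
  by move=> y; rewrite /Aq /Acoef mulNr.
by rewrite expr1; move: (q 0 ord_s) => s; ring.
Qed.

Lemma nbhs_s z i : 0 < s_of z < s0 ->
  \forall h \near (0:R), 0 < (cproj z + h *: delta_mx 0 i) 0 ord_s < s0.
Proof.
move=> zs; apply: (@near0P _ _ (Num.min (s_of z) (s0 - s_of z))).
  by rewrite lt_min; lra.
move=> h; rewrite lt_min !ltr_norml => hz.
have [->|[k ->]] := tang_or_s i.
  by rewrite pt_adds pt_s; lra.
by rewrite pt_addtang pt_s; lra.
Qed.

(** Three times the mean curvature: the expanded divergence of the normal. *)
Definition curvature q : R :=
  let s := q 0 ord_s in let w := Num.sqrt (Wq q) in
  3 * (1 + Aq q * d ord_s q) / w
  - s * (((2 * s - 6 * m * s ^+ 2) * d ord_s q + Aq q * pdw D ord_s (d ord_s) q) / w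
         - (1 + Aq q * d ord_s q) * dW ord_s q / (2 * w ^+ 3))
  - s * muq q * ((pdw D t0 (d t0) q + pdw D t1 (d t1) q) / w
         - (dW t0 q * d t0 q + dW t1 q * d t1 q) / (2 * w ^+ 3)).

(** These three are the components of the density whose coordinate divergence is
    taken; the remaining variable v does not enter. *)
Definition flux_t (i : 'I_2) (q : 'rV[R]_(2 + 1)) : R :=
  - (q 0 ord_s ^- 3 * ((Num.sqrt (Wq q))^-1 * d (tang i) q)).

Definition flux_s (q : 'rV[R]_(2 + 1)) : R :=
  - (q 0 ord_s ^- 3 * ((muq q)^-1 * ((Num.sqrt (Wq q))^-1 * (d ord_s q * Aq q + 1)))).

Lemma normal_t z i : 0 < s_of z < s0 ->
  volume_density (gSch m c) z * unit_normal m c P z 0 (tdir i) = flux_t i (cproj z).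
Proof.
move=> zs; rewrite normal_field// grad_t// /flux_t proj_s.
have : mu (lsubmx z) != 0 by rewrite gt_eqF// mu_gt0.
have : s_of z != 0 by rewrite gt_eqF//; lra.
move: (s_of z) (mu _) (Num.sqrt _)^-1 (d _ _) => s u w p s1 u1.
by field; rewrite s1 u1.
Qed.

Definition flux_v (q : 'rV[R]_(2 + 1)) : R :=
  - (q 0 ord_s ^- 3 * ((muq q)^-1 * ((Num.sqrt (Wq q))^-1 * d ord_s q))).

Lemma normal_v z : 0 < s_of z < s0 ->
  volume_density (gSch m c) z * unit_normal m c P z 0 vdir = flux_v (cproj z).
Proof.
move=> zs; rewrite normal_field// grad_v// /flux_v proj_s muqE.
have : mu (lsubmx z) != 0 by rewrite gt_eqF// mu_gt0.
have : s_of z != 0 by rewrite gt_eqF//; lra.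
move: (s_of z) (mu _) (Num.sqrt _)^-1 (d _ _) => s u w p s1 u1.
by field; rewrite s1 u1.
Qed.

Lemma has_pdw_muq_s q : has_pdw D ord_s muq q 0.
Proof.
split; rewrite (_ : dquot _ _ _ = fun=> 0); first exact: cvg_cst.
by apply/funext => h; rewrite /dquot [q]ptE pt_adds /muq !pt_x subrr mulr0.
Qed.

Lemma normal_s z : 0 < s_of z < s0 ->
  volume_density (gSch m c) z * unit_normal m c P z 0 sdir = flux_s (cproj z).
Proof.
move=> zs; rewrite normal_field// grad_s// /flux_s proj_s AqE muqE.
have : mu (lsubmx z) != 0 by rewrite gt_eqF// mu_gt0.
have : s_of z != 0 by rewrite gt_eqF//; lra.
move: (s_of z) (mu _) (Num.sqrt _)^-1 (d _ _) (Acoef _) => s u w p A s1 u1.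
by field; rewrite s1 u1.
Qed.

Lemma near_s_of z (I : 'I_(2 + 2)) : 0 < s_of z < s0 ->
  \forall h \near (0:R), 0 < s_of (z + h *: delta_mx 0 I) < s0.
Proof.
move=> zs; case: (split_ordP I) => j ->.
  apply: filterS (nbhs_s (tang j) zs) => h.
  by rewrite -proj_tdir proj_s.
case: (ord2P j) => ->.
  apply: filterS (nbhs_s ord_s zs) => h.
  by rewrite -proj_sdir proj_s.
by near=> h; rewrite -proj_s proj_vdir proj_s.
Unshelve. all: by end_near. Qed.

Lemma mean_curvatureE z : 0 < s_of z < s0 -> 0 < Wq (cproj z) ->
  mean_curvature m c P z = 3^-1 * curvature (cproj z).
Proof.
move=> zs W0; have Dz := in_collar zs; have s_gt0 : 0 < s_of z by lra.
rewrite /mean_curvature /divergence sum4 gSch_volume//; congr (_ * _).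
set Z := fun I => fun y => volume_density (gSch m c) y * unit_normal m c P y 0 I.
have Et i : pd (tdir i) (Z (tdir i)) z =
   - (s_of z ^- 3 * ((- (2 * Num.sqrt (Wq (cproj z)) ^+ 3)^-1 * dW (tang i) (cproj z)) * d (tang i) (cproj z) +
     (Num.sqrt (Wq (cproj z)))^-1 * pdw D (tang i) (d (tang i)) (cproj z))).
  apply: (@pd_via _ _ _ D _ (flux_t i) _ (tang i) _ (cproj z)); first exact: normal_t.
    near=> h; split; first by near: h; exact: near_collar.
    rewrite -proj_tdir; apply: normal_t; near: h; exact: near_s_of.
  have Hs : has_pdw D (tang i) (fun q : 'rV[R]_(2 + 1) => q 0 ord_s ^- 3) (cproj z) 0.
    have H := has_pdw_coord D (tang i) ord_s (cproj z); rewrite (negbTE (tang_neq_s i)) in H.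
    have n0 : cproj z 0 ord_s ^+ 3 != 0 by rewrite proj_s expf_neq0// gt_eqF.
    by apply: has_pdw_conv (has_pdwV n0 (has_pdwX 2 H)) _ _ => //; rewrite !mulr0.
  apply: has_pdw_conv (has_pdwN (has_pdwM Hs (has_pdwM (has_pdw_Vsqrt (tang i) Dz W0) (has_pdw_dd (tang i) (tang i) Dz)))) _ _ => //.
  by rewrite proj_s mul0r add0r.
have Es : pd sdir (Z sdir) z =
   - (- 3 * s_of z ^- 4 * ((mu (lsubmx z))^-1 * ((Num.sqrt (Wq (cproj z)))^-1 *
        (d ord_s (cproj z) * Acoef (s_of z) + 1)))
     + s_of z ^- 3 * ((mu (lsubmx z))^-1 *
        ((- (2 * Num.sqrt (Wq (cproj z)) ^+ 3)^-1 * dW ord_s (cproj z)) *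
           (d ord_s (cproj z) * Acoef (s_of z) + 1)
         + (Num.sqrt (Wq (cproj z)))^-1 * (pdw D ord_s (d ord_s) (cproj z) * Acoef (s_of z)
            + d ord_s (cproj z) * (2 * s_of z - 6 * m * s_of z ^+ 2))))).
  apply: (@pd_via _ _ _ D _ flux_s _ ord_s _ (cproj z)); first exact: normal_s.
    near=> h; split; first by near: h; exact: near_collar.
    rewrite -proj_sdir; apply: normal_s; near: h; exact: near_s_of.
  have Hs : has_pdw D ord_s (fun q : 'rV[R]_(2 + 1) => q 0 ord_s ^- 3) (cproj z) (- 3 * s_of z ^- 4).
    have H := has_pdw_coord D ord_s ord_s (cproj z); rewrite eqxx mulr1n in H.
    have n0 : cproj z 0 ord_s ^+ 3 != 0 by rewrite proj_s expf_neq0// gt_eqF.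
    apply: has_pdw_conv (has_pdwV n0 (has_pdwX 2 H)) _ _ => //; rewrite proj_s.
    by move: (s_of z) (lt0r_neq0 s_gt0) => s s1; field.
  have m0 : muq (cproj z) != 0 by rewrite muqE gt_eqF// mu_gt0.
  have H1 := has_pdwD (has_pdwM (has_pdw_dd ord_s ord_s Dz) (has_pdw_Aq (cproj z))) (has_pdw_cst D ord_s 1 (cproj z)).
  have H2 := has_pdwM (has_pdw_Vsqrt ord_s Dz W0) H1.
  have H3 := has_pdwM Hs (has_pdwM (has_pdwV m0 (has_pdw_muq_s (cproj z))) H2).
  apply: has_pdw_conv (has_pdwN H3) _ _ => //.
  by rewrite !proj_s AqE muqE mulr0 mul0r add0r addr0.
have Ev : pd vdir (Z vdir) z = 0.
  have := has_pdw_cst setT vdir (flux_v (cproj z)) z.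
  apply: pd_via; first exact: normal_v.
  near=> h; split=> //; rewrite -[in RHS](proj_vdir z h); apply: normal_v.
  by near: h; exact: near_s_of.
rewrite !Et Es Ev addr0 /curvature proj_s AqE muqE -/t0 -/t1.
have : Num.sqrt (Wq (cproj z)) != 0 by rewrite gt_eqF// sqrtr_gt0.
have : mu (lsubmx z) != 0 by rewrite gt_eqF// mu_gt0.
move: (Num.sqrt _) (mu _) (dW _ _) (dW _ _) (dW _ _) (pdw D ord_s _ _) (pdw D t0 _ _) (pdw D t1 _ _).
move: (s_of z) (lt0r_neq0 s_gt0) (d t0 _) (d t1 _) (d ord_s _) (Acoef _) => s s1 p0 p1 p2 A.
move=> w u W2 W0' W1 p22 p00 p11 u1 w1.
by field; rewrite s1 u1 w1.
Unshelve. all: by end_near. Qed.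

End Graph.

(** * Spacelike graphs and the equation of constant mean curvature *)

Section SpacelikeGraph.
Variables (R : realType) (m s0 : R) (c : bool) (P : 'rV[R]_3 -> R -> R).
Implicit Types (x : 'rV[R]_2) (z : 'rV[R]_(2 + 2)) (q : 'rV[R]_(2 + 1)).
Let D := collar s0.
Let F := in_chart c P.
Let d (i : 'I_(2 + 1)) := pdw D i F.
Let t0 : 'I_(2 + 1) := tang ord0.
Let t1 : 'I_(2 + 1) := tang ord_max.
Let W := Wq m s0 c P.
Let dW (i : 'I_(2 + 1)) := pdw D i W.

Hypothesis s00 : 0 < s0.
Let pD : perfect D := perfect_collar s00.

Lemma Ck_muq k : Ck k D (@muq R).
Proof.
have C0 := Ck_coord k t0 pD; have C1 := Ck_coord k t1 pD.
have H := CkX 2 pD (CkD pD (Ck_cst k 1 pD) (CkD pD (CkX 2 pD C0) (CkX 2 pD C1))).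
apply: Ck_eq (CkM pD (Ck_cst k 4^-1 pD) H) => q _.
by rewrite /muq /mu /nsq !mxE mulrC.
Qed.

Lemma Ck_Aq k : Ck k D (Aq m).
Proof.
have C0 := Ck_coord k ord_s pD.
have H := CkD pD (Ck_cst k 1 pD) (CkN pD (CkM pD (Ck_cst k (2 * m) pD) C0)).
by apply: Ck_eq (CkM pD (CkX 2 pD C0) H) => q _.
Qed.

Lemma Ck_W k : Ck k.+1 D F -> Ck k D W.
Proof.
move=> CF; have Cd i : Ck k D (d i) := Ck_pdw i CF.
have H1 := CkM pD (Ck_Aq k) (CkX 2 pD (Cd ord_s)).
have H2 := CkM pD (Ck_cst k 2 pD) (Cd ord_s).
have H3 := CkM pD (Ck_muq k) (CkD pD (CkX 2 pD (Cd t0)) (CkX 2 pD (Cd t1))).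
by apply: Ck_eq (CkN pD (CkD pD (CkD pD H1 H2) H3)) => q _.
Qed.

Lemma graph_point_s x s : s_of (graph_point c P x s) = s.
Proof.
rewrite /s_of /graph_point (_ : rshift 2 0 = sdir) ?row4_s ?mxE//.
Qed.

Lemma graph_point_proj x s : cproj (graph_point c P x s) = pt x s.
Proof. by rewrite /cproj graph_point_s /graph_point row_mxKl. Qed.

Lemma row_swapblock_r (a b u : R) :
  (row_mx a%:M b%:M : 'rV[R]_(1 + 1)) *m block_mx 0%:M 1%:M 1%:M (- u)%:M =
  row_mx b%:M (a - b * u)%:M :> 'rV[R]_(1 + 1).
Proof.
rewrite mul_row_block !mulmx1 -!scalar_mxM mulr0 raddf0 add0r mulrN.
by rewrite -raddfD.
Qed.

Lemma innerE z (X : 'rV[R]_(2 + 2)) :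
  inner (gSch m c) z X X = s_of z ^- 2 *
   ((mu (lsubmx z))^-1 * (X 0 (tdir ord0) ^+ 2 + X 0 (tdir ord_max) ^+ 2)
    + 2 * X 0 sdir * X 0 vdir - Acoef m (s_of z) * X 0 vdir ^+ 2).
Proof.
have E : X = row_mx (\row_i X 0 (tdir i))
    (row_mx (X 0 sdir)%:M (X 0 vdir)%:M : 'rV[R]_(1 + 1)).
  apply: rowE4 => [i||]; first by rewrite row4_t mxE.
    by rewrite row4_s mxE.
  by rewrite row4_v mxE.
rewrite /inner gSch_block {1}E -scalemxAr mul_row_block !mulmx0 addr0 add0r mul_mx_scalar.
rewrite row_swapblock_r -scalemxAl mxE mxE sum4 ![(_^T)%R _ _]mxE !row4_t row4_s row4_v !mxE.
rewrite /= !mulr1n.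
move: (s_of z ^- 2) (Acoef m _) (mu _)^-1 (X 0 _) (X 0 _) (X 0 _) (X 0 _) => s A u a b e f.
by ring.
Qed.

Lemma differ_dot z (X : 'rV[R]_(2 + 2)) : Ck 2 D F -> 0 < s_of z < s0 ->
  (differ (defining c P) z *m X^T) 0 0 =
   d t0 (cproj z) * X 0 (tdir ord0) + d t1 (cproj z) * X 0 (tdir ord_max)
   + d ord_s (cproj z) * X 0 sdir + X 0 vdir.
Proof.
move=> CF zs; rewrite (differE s00 CF zs) mxE sum4 ![(_^T)%R _ _]mxE /dF !row4_t row4_s row4_v.
by rewrite !mxE /= !mulr1n mul1r.
Qed.

(** Suppose W <= 0, let n = - W be the squared length of the gradient N of v + P in
    the conformal metric, and test with X = n d_v - N.  It is tangent to the graph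
    since d(v + P) takes the value 1 on d_v and n on N, and its squared length is
    - (A n^2 + n) <= 0. *)
Lemma spacelike_W z : Ck 2 D F -> 0 < s_of z < s0 -> 0 <= m -> 2 * m * s0 < 1 ->
  spacelike_at m c P z -> 0 < W (cproj z).
Proof.
move=> CF zs m0 ms H; rewrite ltNge; apply/negP => W0.
have A0 : 0 <= Acoef m (s_of z).
  rewrite /Acoef mulr_ge0 ?sqr_ge0// subr_ge0; apply: le_trans (ltW ms).
  by rewrite ler_wpM2l ?mulr_ge0//; lra.
set p := d ord_s (cproj z); set n := - W (cproj z).
have n0 : 0 <= n by rewrite /n oppr_ge0.
have nE : n = Acoef m (s_of z) * p ^+ 2 + 2 * p +
   mu (lsubmx z) * (d t0 (cproj z) ^+ 2 + d t1 (cproj z) ^+ 2).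
  by rewrite /n /W /Wq opprK AqE muqE.
pose X : 'rV[R]_(2 + 2) := row_mx (\row_i (- (mu (lsubmx z) * d (tang i) (cproj z))))
   (row_mx (- (p * Acoef m (s_of z) + 1))%:M (n - p)%:M : 'rV[R]_(1 + 1)).
have Xt i : X 0 (tdir i) = - (mu (lsubmx z) * d (tang i) (cproj z)) by rewrite row4_t mxE.
have Xs : X 0 sdir = - (p * Acoef m (s_of z) + 1) by rewrite row4_s mxE mulr1n.
have Xv : X 0 vdir = n - p by rewrite row4_v mxE mulr1n.
have X0 : X != 0.
  apply/eqP => X0; move: Xs Xv; rewrite X0 !mxE => Es Ev.
  (* X = 0 would give P_s = n >= 0 and 1 + A P_s = 0 *)
  have pn : p = n by lra.
  have : 0 <= p * Acoef m (s_of z) by rewrite mulr_ge0// pn.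
  by move: Es; lra.
have := H X X0; rewrite differ_dot// innerE !Xt Xs Xv -/p -/t0 -/t1.
have u0 : mu (lsubmx z) != 0 by rewrite gt_eqF// mu_gt0.
have E : 0 < s_of z ^- 2 by rewrite invr_gt0 exprn_gt0//; lra.
have alg (A u p0 p1 pp k : R) : u != 0 -> k = A * pp ^+ 2 + 2 * pp + u * (p0 ^+ 2 + p1 ^+ 2) ->
   (p0 * - (u * p0) + p1 * - (u * p1) + pp * - (pp * A + 1) + (k - pp) = 0) /\
   (u^-1 * ((- (u * p0)) ^+ 2 + (- (u * p1)) ^+ 2) + 2 * - (pp * A + 1) * (k - pp)
     - A * (k - pp) ^+ 2 = - (A * k ^+ 2 + k)).
  by move=> u1 ->; split; [ring|field].
have [-> ->] := alg _ _ _ _ _ _ u0 nE.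
move=> /(_ erefl); rewrite pmulr_rgt0// oppr_gt0 ltNge addr_ge0//.
by rewrite mulr_ge0// sqr_ge0.
Qed.

(** The converse for a graph with vanishing tangential derivatives, where the
    length of a tangent vector is a sum of squares weighted by 1 / mu and W. *)
Lemma spacelike_radial z : Ck 2 D F -> 0 < s_of z < s0 ->
  d t0 (cproj z) = 0 -> d t1 (cproj z) = 0 -> 0 < W (cproj z) -> spacelike_at m c P z.
Proof.
move=> CF zs d0 d1; rewrite /W /Wq -/D -/F -/(d _) -/t0 -/t1 -/(d _) -/(d _) AqE d0 d1.
rewrite expr0n /= addr0 mulr0 addr0 => W0 X X0.
rewrite differ_dot// innerE d0 d1 !mul0r !add0r => dX.
have s1 : 0 < s_of z ^- 2 by rewrite invr_gt0 exprn_gt0//; lra.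
rewrite pmulr_rgt0//.
have -> : X 0 vdir = - (d ord_s (cproj z) * X 0 sdir) by apply/eqP; rewrite -addr_eq0 addrC dX.
have u0 : 0 < (mu (lsubmx z))^-1 by rewrite invr_gt0 mu_gt0.
set A := Acoef m _ in W0 *; set p := d ord_s _ in W0 dX *.
have -> : (mu (lsubmx z))^-1 * (X 0 (tdir ord0) ^+ 2 + X 0 (tdir ord_max) ^+ 2) +
  2 * X 0 sdir * - (p * X 0 sdir) - A * (- (p * X 0 sdir)) ^+ 2 =
  (mu (lsubmx z))^-1 * (X 0 (tdir ord0) ^+ 2 + X 0 (tdir ord_max) ^+ 2) +
  X 0 sdir ^+ 2 * (- (A * p ^+ 2 + 2 * p)).
  by move: (mu _)^-1 (X 0 _) (X 0 _) (X 0 _) => u a b e; ring.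
have T0 := addr_ge0 (sqr_ge0 (X 0 (tdir ord0))) (sqr_ge0 (X 0 (tdir ord_max))).
have T1 := mulr_ge0 (ltW u0) T0.
have T2 := mulr_ge0 (sqr_ge0 (X 0 sdir)) (ltW W0).
rewrite lt0r (addr_ge0 T1 T2) andbT; apply: contra X0; rewrite (paddr_eq0 T1 T2).
rewrite !mulf_eq0 (gt_eqF u0) (gt_eqF W0)/= orbF paddr_eq0 ?sqr_ge0// !sqrf_eq0.
move=> /andP[/andP[/eqP x0 /eqP x1]]; rewrite orbb => /eqP x2.
apply/eqP; apply: rowE4 => [i||]; rewrite ?mxE.
- by case: (ord2P i) => ->.
- exact: x2.
- by move: dX; rewrite x2 mulr0 add0r.
Qed.

(** The equation H = 1, cleared of the denominators sqrt W and W^(3/2) so that it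
    still makes sense where W vanishes. *)
Definition cmc_eq x s : Prop :=
  let q := pt x s in let w := Num.sqrt (W q) in let p := d ord_s q in
  let A := Acoef m s in
  3 * (W q * w) = 3 * (W q * (1 + A * p)) - s * (
    W q * ((2 * s - 6 * m * s ^+ 2) * p + A * pdw D ord_s (d ord_s) q)
    - dW ord_s q * (1 + A * p) / 2
    + mu x * (W q * (pdw D t0 (d t0) q + pdw D t1 (d t1) q)
              - (dW t0 q * d t0 q + dW t1 q * d t1 q) / 2)).

Lemma cmc_eqP x s : Ck 2 D F -> 0 < s < s0 -> 0 < W (pt x s) ->
  mean_curvature m c P (graph_point c P x s) = 1 <-> cmc_eq x s.
Proof.
move=> CF ss W0.
have zs : 0 < s_of (graph_point c P x s) < s0 by rewrite graph_point_s.
have CW : Ck 1 D W by exact: Ck_W.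
rewrite (mean_curvatureE s00 CF CW zs) graph_point_proj//.
rewrite /curvature /cmc_eq pt_s /Aq /muq pt_s pt_x -/W -/D -/F -/t0 -/t1 /dW /d.
have w0 : 0 < Num.sqrt (W (pt x s)) by rewrite sqrtr_gt0.
have : W (pt x s) = Num.sqrt (W (pt x s)) ^+ 2 by rewrite sqr_sqrtr// ltW.
move: (pdw D ord_s (pdw D ord_s F) _) (pdw D t0 (pdw D t0 F) _) (pdw D t1 (pdw D t1 F) _).
move: (pdw D ord_s W _) (pdw D t0 W _) (pdw D t1 W _).
move: (pdw D ord_s F _) (pdw D t0 F _) (pdw D t1 F _) (Acoef m s) (mu x) w0.
move: (W _) (Num.sqrt (W _)) => V w p2 p0 p1 A u w0 W2 W0' W1 p22 p00 p11 ->.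
have w1 : w != 0 by rewrite gt_eqF.
set C := (X in 3^-1 * X); set rhs := 3 * (w ^+ 2 * (1 + A * _)) - _; set lhs := 3 * (w ^+ 2 * w).
have E : 3^-1 * C - 1 = (rhs - lhs) / (3 * w ^+ 3).
  by rewrite /C /rhs /lhs; field.
have w3 : (3 * w ^+ 3)^-1 != 0 by rewrite invr_eq0 mulf_neq0// expf_neq0.
split=> H; apply/eqP.
  have /eqP := E; rewrite H subrr eq_sym mulf_eq0 (negbTE w3) orbF subr_eq0.
  by rewrite eq_sym.
by rewrite -subr_eq0 E -H subrr mul0r.
Qed.

End SpacelikeGraph.

(** * The boundary value of W *)

Section RealFacts.
Variable R : realType.

Lemma shift_in (a b t : R) : `|t| < Num.min a (b - a) -> 0 <= a + t <= b.
Proof. by rewrite lt_min !ltr_norml; lra. Qed.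

Lemma shift_in_around (a b r t : R) : `|a - b + t| < r -> b - r <= a + t <= b + r.
Proof. by rewrite ltr_norml; lra. Qed.

Lemma sqrt_small (V : R) : V < 1 / 16 -> 0 <= Num.sqrt V < 1 / 4.
Proof.
move=> V16; rewrite sqrtr_ge0 /= -[1 / 4]gtr0_norm; last lra.
by rewrite -sqrtr_sqr ltr_sqrt; lra.
Qed.

Lemma dist_lt1 (a b : R) : `|a - b| < 1 -> `|b| < `|a| + 1.
Proof.
move=> ab; rewrite -[b](subKr a); apply: le_lt_trans (ler_normB _ _) _.
by rewrite ltrD2l.
Qed.

Lemma sqr_lt_norm (a r : R) : 0 < r -> a ^+ 2 < r ^+ 2 -> `|a| < r.
Proof.
move=> r0; rewrite -(real_normK (num_real a)) ltr_sqr// nnegrE; exact: ltW.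
Qed.

Lemma one_lt16 : (1 < 1 / 16 :> R) = false.
Proof. by apply/negbTE; rewrite -leNgt; lra. Qed.

(** The contradiction at an interior maximum of W eta, in numbers: V, W0, W1, W2 are
    W and its derivatives, Ap and s T = sT the small terms of the equation, and
    W_i eta = - W eta_i expresses criticality.  After division by V the equation
    reads 3 sqrt W eta = 3 (1 + A P_s) eta - sT eta + s (...), where K was chosen
    to make the last bracket nonnegative, and where 3 sqrt W < 3/4 while
    3 (1 + A P_s) - sT > 2. *)
Lemma barrier_absurd (V w Ap st sT s u p0 p1 W0 W1 W2 lap y0 y1 K rho M eta : R) :
  0 < V -> 0 <= w < 1 / 4 -> `|Ap| < 1 / 4 -> `|sT| < 1 / 4 -> 0 < s -> 0 < eta ->
  `|u * p0| < M -> `|u * p1| < M -> `|y0| <= rho -> `|y1| <= rho -> 8 * (rho * M) <= K ->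
  sT = s * (st + u * lap) ->
  W0 * eta = 2 * V * y0 -> W1 * eta = 2 * V * y1 -> W2 * eta = K * V ->
  3 * (V * w) = 3 * (V * (1 + Ap)) - s * (V * st - W2 * (1 + Ap) / 2
     + u * (V * lap - (W0 * p0 + W1 * p1) / 2)) -> False.
Proof.
move=> V0 w4 A4 T4 s_gt0 e0 G0 G1 Y0 Y1 KM sTE E0 E1 E2 E.
have {}E : V * (3 * w * eta) = V * (3 * (1 + Ap) * eta - sT * eta +
    s * (K * (1 + Ap) / 2 + (y0 * (u * p0) + y1 * (u * p1)))).
  transitivity (3 * (V * w) * eta); first ring.
  rewrite E sTE; transitivity (3 * (V * (1 + Ap)) * eta - s * (V * st * eta - (W2 * eta) * (1 + Ap) / 2
     + u * (V * lap * eta - ((W0 * eta) * p0 + (W1 * eta) * p1) / 2))); first by field.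
  by rewrite E0 E1 E2; field.
have {}E := mulfI (lt0r_neq0 V0) E.
have M0 : 0 < M by apply: le_lt_trans G0.
have r0 : 0 <= rho by apply: le_trans Y0.
have yG (y G : R) : `|y| <= rho -> `|G| < M -> - (rho * M) <= y * G.
  move=> yr GM; have : `|y * G| <= rho * M by rewrite normrM ler_pM// ltW.
  by rewrite ler_norml => /andP[].
have H0 := yG _ _ Y0 G0; have H1 := yG _ _ Y1 G1.
have rM : 0 <= rho * M by rewrite mulr_ge0// ltW.
move: A4 T4; rewrite !ltr_norml => A4 T4.
have HK : 0 <= K * (1 + Ap) / 2 + (y0 * (u * p0) + y1 * (u * p1)) by nra.
have Hs := mulr_ge0 (ltW s_gt0) HK.
have : 3 * w * eta < 3 * (1 + Ap) * eta - sT * eta.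
  rewrite -mulrBl ltr_pM2r//; lra.
by rewrite E; lra.
Qed.

End RealFacts.

Section BoundaryValueOfW.
Variables (R : realType) (m s0 : R) (c : bool) (P : 'rV[R]_3 -> R -> R).
Implicit Types (x : 'rV[R]_2) (q : 'rV[R]_(2 + 1)).
Let D := collar s0.
Let F := in_chart c P.
Let d (i : 'I_(2 + 1)) := pdw D i F.
Let t0 : 'I_(2 + 1) := tang ord0.
Let t1 : 'I_(2 + 1) := tang ord_max.
Let W := Wq m s0 c P.
Let dW (i : 'I_(2 + 1)) := pdw D i W.

Hypothesis s00 : 0 < s0.
Let pD : perfect D := perfect_collar s00.
Hypothesis CF : Ck 2 D F.
Hypothesis Wpos : forall x s, 0 < s < s0 -> 0 < W (pt x s).
Hypothesis cmc : forall x s, 0 < s < s0 -> cmc_eq m s0 c P x s.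

Let CW : Ck 1 D W := Ck_W m s00 CF.

Lemma slice_lim0 G x : Ck 0 D G -> lim0 (fun s => G (pt x s)) (G (pt x 0)).
Proof.
move=> CG; have := jet_lim0 (Ck_jet x s00 CG).
by rewrite taylor_coef// divr1.
Qed.

Lemma near0_pos : \forall s \near (0:R)^'+, 0 < s < s0.
Proof. exact: (near_rightP s00). Qed.

Lemma lim0_sqrt phi (l : R) : lim0 phi l -> lim0 (fun s => Num.sqrt (phi s)) (Num.sqrt l).
Proof. by move=> [H]; split; apply: cvg_comp H _; exact: sqrt_continuous. Qed.

Lemma lim0_conv phi (l k : R) : lim0 phi l -> l = k -> lim0 phi k.
Proof. by move=> H <-. Qed.

Lemma W_ge0 x s : 0 <= s < s0 -> 0 <= W (pt x s).
Proof.
move=> /andP[]; rewrite le_eqVlt => /predU1P[<- _|s1 s2]; last by rewrite ltW// Wpos// s1.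
have [H] := slice_lim0 x (CkS CW).
rewrite -(cvg_lim _ H)//; apply: limr_ge; first exact: cvgP H.
by apply: filterS near0_pos => u uu; rewrite ltW// Wpos.
Qed.

(** At s = 0 the equation becomes W sqrt W = W. *)
Lemma W_boundary01 x : W (pt x 0) = 0 \/ W (pt x 0) = 1.
Proof.
set V := W (pt x 0).
have LW : lim0 (fun s => W (pt x s)) V by apply: slice_lim0; exact: CkS.
have Ld i : lim0 (fun s => d i (pt x s)) (d i (pt x 0)).
  by apply: slice_lim0; apply: (Ck_le _ (Ck_pdw i CF)).
have Contact i j : lim0 (fun s => pdw D j (d i) (pt x s)) (pdw D j (d i) (pt x 0)).
  by apply: slice_lim0; apply: (Ck_pdw _ (Ck_pdw i CF)).
have LdW i : lim0 (fun s => dW i (pt x s)) (dW i (pt x 0)).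
  by apply: slice_lim0; apply: (Ck_pdw i CW).
have LA : lim0 (fun s => Acoef m s) 0.
  have := lim0M (expr_lim0 R 1) (lim0B (lim0_cst 1) (lim0M (lim0_cst (2 * m)) (id_lim0 R))).
  by rewrite mul0r.
have Ls := id_lim0 R.
have L1 := lim0M (lim0_cst 3) (lim0M LW (lim0_sqrt LW)).
have LB := lim0D (lim0B (lim0M LW (lim0D (lim0M (lim0B (lim0M (lim0_cst 2) Ls) (lim0M (lim0_cst (6 * m)) (expr_lim0 R 1))) (Ld ord_s)) (lim0M LA (Contact ord_s ord_s))))
   (lim0M (lim0M (LdW ord_s) (lim0D (lim0_cst 1) (lim0M LA (Ld ord_s)))) (lim0_cst 2^-1)))
   (lim0M (lim0_cst (mu x)) (lim0B (lim0M LW (lim0D (Contact t0 t0) (Contact t1 t1)))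
     (lim0M (lim0D (lim0M (LdW t0) (Ld t0)) (lim0M (LdW t1) (Ld t1))) (lim0_cst 2^-1)))).
have L2 := lim0B (lim0M (lim0_cst 3) (lim0M LW (lim0D (lim0_cst 1) (lim0M LA (Ld ord_s)))))
  (lim0M Ls LB).
have L2' : lim0 (fun s => 3 * (W (pt x s) * Num.sqrt (W (pt x s)))) (3 * V).
  apply: lim0_conv (lim0_near _ L2) _; last by rewrite !mul0r subr0 addr0 mulr1.
  by apply: filterS near0_pos => s ss; exact/esym/(cmc x ss).
have := lim0_unique L1 L2' => /mulfI E.
have {}E : V * Num.sqrt V = V by apply: E; rewrite pnatr_eq0.
have [->|V0] := eqVneq V 0; first by left.
right; have V1 : 0 <= V by apply: W_ge0; rewrite lexx.
rewrite -(sqr_sqrtr V1); have -> : Num.sqrt V = 1; last by rewrite expr1n.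
by apply: (mulfI V0); rewrite E mulr1.
Qed.

Lemma ball_pt (G : 'rV[R]_(2 + 1) -> R) x0 (e : R) : Ck 0 D G -> 0 < e ->
  exists2 del : R, 0 < del & forall q, ball (pt x0 0) del q -> D q -> `|G (pt x0 0) - G q| < e.
Proof.
move=> [CG _]; apply: within_dist; move/subspace_continuousP: CG; apply.
by rewrite /D collar_pt lexx ltW.
Qed.

Lemma interior_max (Phi : 'rV[R]_(2 + 1) -> R) q i (r : R) : Ck 1 D Phi -> 0 < r ->
  (forall t : R, `|t| < r -> D (q + t *: delta_mx 0 i) /\
     Phi (q + t *: delta_mx 0 i) <= Phi q) ->
  pdw D i Phi q = 0.
Proof.
move=> CP r0 H.
have dP (t : R) : t \in `](- r), r[ ->
    is_derive t 1 (fun t => Phi (q + t *: delta_mx 0 i)) (pdw D i Phi (q + t *: delta_mx 0 i)).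
  rewrite in_itv/= => tr; apply: (slice_derive (D := D)).
    apply: (@near0P _ _ (Num.min (t + r) (r - t))); first by rewrite lt_min; lra.
    by move=> h; rewrite lt_min !ltr_norml => hh; apply: (H (t + h) _).1; rewrite ltr_norml; lra.
  apply: pdwP => //; first exact: Ck_derivable CP.
  by apply: (H t _).1; rewrite ltr_norml.
have z0 : (0 : R) \in `](- r), r[ by rewrite in_itv/=; lra.
have dmax : is_derive (0 : R) 1 (fun t => Phi (q + t *: delta_mx 0 i)) 0.
  apply: (@derive1_at_max _ _ (- r) r) => //; first lra.
    by move=> t tr; have [] := dP t tr.
  move=> t; rewrite in_itv/= scale0r addr0 => tr; apply: (H t _).2.
  by rewrite ltr_norml.
have := dP 0 z0; rewrite scale0r addr0 => dq.
by rewrite -[LHS](@derive_val _ _ _ _ _ _ _ dq) (@derive_val _ _ _ _ _ _ _ dmax).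
Qed.

Lemma compact_box q0 (rho s2 : R) :
  compact [set q : 'rV[R]_(2 + 1) | (forall i, q0 0 (tang i) - rho <= q 0 (tang i) <= q0 0 (tang i) + rho)
     /\ 0 <= q 0 ord_s <= s2].
Proof.
have := @rV_compact R (2 + 1) (fun i => if i == ord_s then `[0, s2]%classic
   else `[q0 0 i - rho, q0 0 i + rho]%classic).
have H i : compact (if i == ord_s then `[0, s2]%classic
   else `[q0 0 i - rho, q0 0 i + rho]%classic).
  by case: ifP => _; exact: segment_compact.
move=> /(_ H); congr compact; apply/seteqP; split => q /=.
  move=> Hq; split=> [i|].
    by have := Hq (tang i); rewrite (negbTE (tang_neq_s i)) /= in_itv.
  by have := Hq ord_s; rewrite /= in_itv.
move=> [H1 H2] i; have [->|[k ->]] := tang_or_s i; first by rewrite eqxx/= in_itv.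
by rewrite (negbTE (tang_neq_s k)) /= in_itv; exact: H1.
Qed.

(** If W vanished at x0, then W, A P_s and s T would be small in a neighbourhood of
    (x0, 0).  Maximize W eta over a box there, where
    eta = rho^2 - |x - x0|^2 - K s.  The maximum is positive since W > 0 inside, so
    it is attained where eta > 0, off the lateral and upper faces, and where
    W > 0, hence at s > 0: at s = 0 the only value of W below 1/16 is 0.  So the
    maximum is a critical point of W eta, and [barrier_absurd] applies. *)
Lemma W_boundary_neq0 x0 : W (pt x0 0) <> 0.
Proof.
move=> W0; set q0 := pt x0 0.
have q0s : q0 0 ord_s = 0 by rewrite pt_s.
have Cs : Ck 0 D (fun q => q 0 ord_s) by exact: Ck_coord.
have Cd i : Ck 0 D (d i) by apply: (Ck_le _ (Ck_pdw i CF)).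
have Cdd i j : Ck 0 D (pdw D j (d i)) by apply: (Ck_pdw _ (Ck_pdw i CF)).
pose st q := (2 * q 0 ord_s - 6 * m * q 0 ord_s ^+ 2) * d ord_s q
  + Aq m q * pdw D ord_s (d ord_s) q.
pose lap q := pdw D t0 (d t0) q + pdw D t1 (d t1) q.
pose sT q := q 0 ord_s * (st q + muq q * lap q).
pose Ap q := Aq m q * d ord_s q.
pose G i q := muq q * d (tang i) q.
have CAp : Ck 0 D Ap by apply: CkM => //; exact: Ck_Aq.
have CG i : Ck 0 D (G i) by apply: CkM => //; exact: Ck_muq.
have CsT : Ck 0 D sT.
  apply: CkM => //; apply: CkD => //.
    apply: CkD => //; apply: CkM => //; last exact: Ck_Aq.
    apply: CkD => //; first by apply: CkM => //; exact: Ck_cst.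
    by apply: CkN => //; apply: CkM => //; [exact: Ck_cst|exact: CkX].
  exact: CkM pD (Ck_muq s00 0) (CkD pD (Cdd t0 t0) (Cdd t1 t1)).
have Ap0 : Ap q0 = 0 by rewrite /Ap /Aq q0s /Acoef expr0n /= !mul0r.
have sT0 : sT q0 = 0 by rewrite /sT q0s mul0r.
(* a bound near (x0, 0) on the components of the gradient of P *)
pose M := `|G ord0 q0| + `|G ord_max q0| + 1.
have M0 : 0 < M by rewrite ltr_wpDl// addr_ge0.
have [del del0 Hdel] : exists2 del : R, 0 < del & forall q, ball q0 del q -> D q ->
   [/\ W q < 1 / 16, `|Ap q| < 1 / 4, `|sT q| < 1 / 4, `|G ord0 q| < M & `|G ord_max q| < M].
  have e16 : (0 : R) < 1 / 16 by lra.
  have e4 : (0 : R) < 1 / 4 by lra.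
  have e1 : (0 : R) < 1 by [].
  have [d1 d10 H1] := ball_pt x0 (CkS CW) e16.
  have [d2 d20 H2] := ball_pt x0 CAp e4.
  have [d3 d30 H3] := ball_pt x0 CsT e4.
  have [d4 d40 H4] := ball_pt x0 (CG ord0) e1.
  have [d5 d50 H5] := ball_pt x0 (CG ord_max) e1.
  exists (Num.min d1 (Num.min d2 (Num.min d3 (Num.min d4 d5)))).
    by rewrite !lt_min d10 d20 d30 d40.
  move=> q qb Dq.
  have {}H1 := H1 q (le_ball _ qb) Dq; have {}H2 := H2 q (le_ball _ qb) Dq.
  have {}H3 := H3 q (le_ball _ qb) Dq; have {}H4 := H4 q (le_ball _ qb) Dq.
  have {}H5 := H5 q (le_ball _ qb) Dq.
  have {}H1 := H1 ltac:(by rewrite !ge_min lexx).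
  have {}H2 := H2 ltac:(by rewrite !ge_min lexx ?orbT).
  have {}H3 := H3 ltac:(by rewrite !ge_min lexx ?orbT).
  have {}H4 := H4 ltac:(by rewrite !ge_min lexx ?orbT).
  have {}H5 := H5 ltac:(by rewrite !ge_min lexx ?orbT).
  split.
  - by move: H1; rewrite -/q0 W0 sub0r normrN => /(le_lt_trans (ler_norm _)).
  - by move: H2; rewrite -/q0 Ap0 sub0r normrN.
  - by move: H3; rewrite -/q0 sT0 sub0r normrN.
  - by apply: lt_le_trans (dist_lt1 H4) _; rewrite /M lerD2r lerDl.
  - by apply: lt_le_trans (dist_lt1 H5) _; rewrite /M lerD2r lerDr.
pose rho := del / 2; pose s2 := Num.min (del / 2) (s0 / 2).
have rho0 : 0 < rho by rewrite /rho; lra.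
have s20 : 0 < s2 by rewrite lt_min !divr_gt0.
have s2d : s2 <= del / 2 by rewrite ge_min lexx.
have s2s : s2 <= s0 / 2 by rewrite ge_min lexx orbT.
have s2lt : s2 < s0 by apply: le_lt_trans s2s _; rewrite ltr_pdivrMr// ltr_pMr ?ltr1n.
(* the first summand dominates the tangential drift of eta in the equation, the
   second makes eta negative on the face s = s2 *)
pose K := 8 * (rho * M) + rho ^+ 2 / s2.
have rM : 0 < 8 * (rho * M) by rewrite !mulr_gt0.
have rs : 0 < rho ^+ 2 / s2 by rewrite divr_gt0// exprn_gt0.
have K0 : 0 < K by rewrite addr_gt0.
have Ks2 : rho ^+ 2 < K * s2.
  by rewrite /K mulrDl divfK ?gt_eqF// ltrDr mulr_gt0.
pose y i q := q 0 (tang i) - x0 0 i.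
have q0t i : q0 0 (tang i) = x0 0 i by rewrite /q0 /pt row_mxEl.
pose eta q := rho ^+ 2 - (y ord0 q ^+ 2 + y ord_max q ^+ 2) - K * q 0 ord_s.
have Cy i : Ck 1 D (y i) by apply: CkD => //; [exact: Ck_coord|exact: Ck_cst].
have Ceta : Ck 1 D eta.
  apply: CkD => //; last by apply: CkN => //; apply: CkM => //; [exact: Ck_cst|exact: Ck_coord].
  apply: CkD => //; first exact: Ck_cst.
  by apply: CkN => //; apply: CkD => //; exact: CkX.
pose Phi q := W q * eta q.
have CPhi : Ck 1 D Phi by exact: CkM.
pose B := [set q : 'rV[R]_(2 + 1) | (forall i, q0 0 (tang i) - rho <= q 0 (tang i) <= q0 0 (tang i) + rho)
     /\ 0 <= q 0 ord_s <= s2].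
have BD q : B q -> D q by move=> [_ qs]; rewrite /D /collar/=; lra.
have Bball q : B q -> ball q0 del q.
  move=> [Ht Hs]; split=> // i j; rewrite ord1 -ball_normE/= {i}.
  have [->|[k ->]] := tang_or_s j.
    by rewrite q0s sub0r normrN ger0_norm; lra.
  by have := Ht k; rewrite ltr_norml /rho; lra.
have cPhi : {within B, continuous Phi}.
  by apply: continuous_subspaceW BD (Ck_cont CPhi).
have B0 : B !=set0.
  by exists q0; split=> [i|]; rewrite ?q0s; lra.
have [q /[!inE] Bq qmax] := EVT_max_rV B0 (@compact_box q0 rho s2) cPhi.
(* evaluate at a point (x0, s1) so low that eta > 0 *)
have Phi_pos : 0 < Phi q.
  pose s1 := Num.min (s2 / 2) (rho ^+ 2 / K / 2).
  have rK : 0 < rho ^+ 2 / K by rewrite divr_gt0// exprn_gt0.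
  have s10 : 0 < s1 by rewrite lt_min; lra.
  have s1s : s1 <= s2 / 2 by rewrite ge_min lexx.
  have s1K : s1 <= rho ^+ 2 / K / 2 by rewrite ge_min lexx orbT.
  have B1 : pt x0 s1 \in B.
    rewrite inE; split=> [i|]; last by rewrite pt_s; lra.
    by rewrite q0t /pt row_mxEl; lra.
  apply: lt_le_trans (qmax _ B1); apply: mulr_gt0; first by apply: Wpos; lra.
  rewrite /eta /y /pt !row_mxEl !subrr expr0n /= addr0 subr0 -/(pt x0 s1) pt_s subr_gt0.
  have : K * s1 <= K * (rho ^+ 2 / K / 2) by rewrite ler_pM2l.
  have -> : K * (rho ^+ 2 / K / 2) = rho ^+ 2 / 2 by field; rewrite gt_eqF.
  by move=> /le_lt_trans; apply; rewrite ltr_pdivrMr// ltr_pMr ?ltr1n ?exprn_gt0.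
have [Bt Bs] := Bq; have Dq := BD _ Bq; have [W16 A4 T4 GM0 GM1] := Hdel q (Bball q Bq) Dq.
have qE : q = pt (lsubmx q) (q 0 ord_s) := ptE q.
have Wq0 : 0 <= W q by rewrite qE; apply: W_ge0; case/andP: Bs => -> /le_lt_trans; exact.
have Wq_gt0 : 0 < W q.
  rewrite lt_neqAle Wq0 andbT; apply/eqP => W0'; move: Phi_pos.
  by rewrite /Phi -W0' mul0r ltxx.
have eta0 : 0 < eta q by move: Phi_pos; rewrite /Phi pmulr_rgt0.
have qs0 : 0 < q 0 ord_s.
  case/andP: Bs => qs _; rewrite lt_neqAle qs andbT; apply/eqP => q0E.
  move: W16 Wq_gt0; rewrite qE -q0E.
  by case: (W_boundary01 (lsubmx q)) => ->; rewrite ?ltxx ?one_lt16.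
have ys : y ord0 q ^+ 2 + y ord_max q ^+ 2 + K * q 0 ord_s < rho ^+ 2.
  by move: eta0; rewrite /eta -addrA -opprD subr_gt0.
have Kq : 0 <= K * q 0 ord_s by rewrite mulr_ge0 ?ltW.
have yr i : `|y i q| < rho.
  apply: sqr_lt_norm => //; apply: le_lt_trans ys.
  case: (ord2P i) => ->; first by rewrite -addrA lerDl addr_ge0 ?sqr_ge0.
  by rewrite addrAC lerDr addr_ge0 ?sqr_ge0.
have qs2 : q 0 ord_s < s2.
  rewrite -(ltr_pM2l K0); apply: lt_trans Ks2; apply: le_lt_trans ys.
  by rewrite lerDr addr_ge0 ?sqr_ge0.
(* q can be moved in every coordinate direction without leaving the box *)
have crit i : exists2 r : R, 0 < r & forall t : R, `|t| < r -> B (q + t *: delta_mx 0 i).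
  have [->|[k ->]] := tang_or_s i.
    exists (Num.min (q 0 ord_s) (s2 - q 0 ord_s)); first by rewrite lt_min qs0 subr_gt0.
    move=> t tr; split=> [l|].
      by rewrite add_delta (negbTE (tang_neq_s l)) mulr0 addr0; exact: Bt.
    by rewrite add_delta eqxx mulr1; exact: shift_in.
  exists (rho - `|y k q|); first by rewrite subr_gt0.
  move=> t tr; split=> [l|].
    rewrite add_delta; have [->|lk] := eqVneq l k.
      rewrite eqxx mulr1 q0t.
      apply: shift_in_around; apply: le_lt_trans (ler_normD _ _) _.
      by rewrite -ltrBDl.
    by rewrite (inj_eq (@lshift_inj _ _)) (negbTE lk) mulr0 addr0; exact: Bt.
  by rewrite add_delta eq_sym (negbTE (tang_neq_s k)) mulr0 addr0.
have dPhi i : pdw D i Phi q = 0.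
  have [r r0 Hr] := crit i; apply: (interior_max CPhi r0) => t /Hr Bqt.
  by split; [exact: BD|apply: qmax; rewrite inE].
pose deta (i : 'I_(2 + 1)) : R := - (2 * y ord0 q * (i == t0)%:R + 2 * y ord_max q * (i == t1)%:R)
   - K * (i == ord_s)%:R.
have detaP i : has_pdw D i eta q (deta i).
  have Hy k : has_pdw D i (y k) q (i == tang k)%:R.
    have := has_pdwD (has_pdw_coord D i (tang k) q) (has_pdw_cst D i (- x0 0 k) q).
    by rewrite addr0.
  have H := has_pdwD (has_pdwD (has_pdw_cst D i (rho ^+ 2) q)
     (has_pdwN (has_pdwD (has_pdwX 1 (Hy ord0)) (has_pdwX 1 (Hy ord_max)))))
     (has_pdwN (has_pdwZ K (has_pdw_coord D i ord_s q))).
  by apply: has_pdw_conv H _ _ => //; rewrite !expr1 add0r.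
have crE i : dW i q * eta q = - (W q * deta i).
  have H : has_pdw D i W q (dW i q) by apply: pdwP => //; exact: Ck_derivable CW.
  have := has_pdw_pdw pD Dq (has_pdwM H (detaP i)); rewrite dPhi => /eqP.
  by rewrite eq_sym addr_eq0 => /eqP.
have w4 := sqrt_small W16.
have t01 : (t0 == t1) = false by rewrite (inj_eq (@lshift_inj _ _)).
have t10 : (t1 == t0) = false by rewrite (inj_eq (@lshift_inj _ _)).
have ts k : (tang k == ord_s) = false by apply/negbTE/tang_neq_s.
have st_ k : (ord_s == tang k) = false by rewrite eq_sym ts.
have qs0' : 0 < q 0 ord_s < s0 by rewrite qs0 /=; exact: lt_trans s2lt.
have := cmc (lsubmx q) qs0'; rewrite /cmc_eq -qE.
apply: (@barrier_absurd _ _ _ (Ap q) (st q) (sT q) _ _ _ _ _ _ _ _ (y ord0 q) (y ord_max q) K rho M (eta q)) => //.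
- exact: ltW.
- exact: ltW.
- by rewrite lerDl ltW.
- by rewrite crE /deta eqxx t01 ts mulr1n !mulr0n -/W; move: (W q) (y _ q) (y _ q) => V a b; ring.
- by rewrite crE /deta eqxx t10 ts mulr1n !mulr0n -/W; move: (W q) (y _ q) (y _ q) => V a b; ring.
- by rewrite crE /deta eqxx !st_ mulr1n !mulr0n -/W; move: (W q) (y _ q) (y _ q) => V a b; ring.
Qed.

End BoundaryValueOfW.

(** * The first four orders of the equation *)

Section Coefficients.
Variable R : realType.
Implicit Types (a b : {poly R}).

Lemma coefM_0 a b : (a * b)`_0 = a`_0 * b`_0.
Proof. by rewrite coefM big_ord1. Qed.

Lemma coefM_1 a b : (a * b)`_1 = a`_0 * b`_1 + a`_1 * b`_0.
Proof. by rewrite coefM !big_ord_recl big_ord0 addr0. Qed.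

Lemma coefM_2 a b : (a * b)`_2 = a`_0 * b`_2 + a`_1 * b`_1 + a`_2 * b`_0.
Proof. by rewrite coefM !big_ord_recl big_ord0 addr0 !addrA. Qed.

Lemma coefM_3 a b : (a * b)`_3 = a`_0 * b`_3 + a`_1 * b`_2 + a`_2 * b`_1 + a`_3 * b`_0.
Proof. by rewrite coefM !big_ord_recl big_ord0 addr0 !addrA. Qed.

Definition coef_rules :=
  (@coefN R, @coefB R, @coefD R, @coefCM R, @coefMC R, @coefXM R, @coef1 R,
   coefM_0, coefM_1, coefM_2, coefM_3).

Lemma W_coefs (A p g0 g1 : {poly R}) (u : R) :
  [/\ A`_0 = 0, A`_1 = 0 & A`_2 = 1] ->
  let E := - (A * (p * p) + 2%:P * p + u%:P * (g0 * g0 + g1 * g1)) in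
  [/\ E`_0 = - (2 * p`_0 + u * (g0`_0 * g0`_0 + g1`_0 * g1`_0)),
      E`_1 = - (2 * p`_1 + 2 * (u * (g0`_0 * g0`_1 + g1`_0 * g1`_1))) &
      E`_2 = - (p`_0 ^+ 2 + 2 * p`_2 + 2 * (u * (g0`_0 * g0`_2 + g1`_0 * g1`_2))
         + u * (g0`_1 * g0`_1 + g1`_1 * g1`_1))].
Proof. by move=> [A0 A1 A2] E; rewrite /E !coef_rules A0 A1 A2; split; ring. Qed.

(** The right side of the equation, the letters standing for the expansions of
    A, A_s, P_s, P_ss, W, W_s, the two second tangential derivatives of P, the
    tangential derivatives of W and those of P. *)
Lemma cmc_rhs_coefs (A L p ps V Vs h0 h1 v0 v1 g0 g1 : {poly R}) (u m : R) :
  [/\ A`_0 = 0, A`_1 = 0, A`_2 = 1 & A`_3 = - (2 * m)] ->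
  [/\ L`_0 = 0, L`_1 = 2 & L`_2 = - (6 * m)] ->
  let B := V * (L * p + A * ps) - Vs * (1 + A * p) * (2^-1)%:P
    + u%:P * (V * (h0 + h1) - (v0 * g0 + v1 * g1) * (2^-1)%:P) in
  let E := 3%:P * (V * (1 + A * p)) - 'X * B in
  [/\ E`_1 = 3 * V`_1 - (- (Vs`_0 / 2) + u * (V`_0 * (h0`_0 + h1`_0)
                - (v0`_0 * g0`_0 + v1`_0 * g1`_0) / 2)),
      E`_2 = 3 * (V`_2 + V`_0 * p`_0) - (V`_0 * (2 * p`_0) - Vs`_1 / 2
         + u * (V`_0 * (h0`_1 + h1`_1) + V`_1 * (h0`_0 + h1`_0)
                - (v0`_0 * g0`_1 + v0`_1 * g0`_0 + v1`_0 * g1`_1 + v1`_1 * g1`_0) / 2)) &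
      E`_3 = 3 * (V`_3 + V`_1 * p`_0 + V`_0 * (p`_1 - 2 * m * p`_0))
         - (V`_0 * (2 * p`_1 - 6 * m * p`_0 + ps`_0) + V`_1 * (2 * p`_0)
            - (Vs`_2 + Vs`_0 * p`_0) / 2
            + u * (V`_0 * (h0`_2 + h1`_2) + V`_1 * (h0`_1 + h1`_1) + V`_2 * (h0`_0 + h1`_0)
                - (v0`_0 * g0`_2 + v0`_1 * g0`_1 + v0`_2 * g0`_0
                   + v1`_0 * g1`_2 + v1`_1 * g1`_1 + v1`_2 * g1`_0) / 2))].
Proof.
move=> [A0 A1 A2 A3] [L0 L1 L2] B E; rewrite /E /B !coef_rules /=.
by rewrite A0 A1 A2 A3 L0 L1 L2; split; ring.
Qed.

(** The triangular system behind the expansion.  The letter b is the expansion of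
    sqrt W; b * b = V gives its coefficients, so that V b has leading terms
    1 + (3/2) V1 s + ... .  Order 1 of the equation gives V1, order 2 gives V2, and
    at order 3 the coefficient V3 occurs on both sides with the same factor 3/4,
    which leaves a relation between lower coefficients only. *)
Lemma cmc_orders (A L p ps V Vs h0 h1 v0 v1 g0 g1 b : {poly R})
    (u m a1 a2 a3 V1 V2 V3 f0 f1 f2 k0 k1 k2 h00 h01 h02 h10 h11 h12 y1 y2 z1 z2 : R) :
  [/\ A`_0 = 0, A`_1 = 0, A`_2 = 1 & A`_3 = - (2 * m)] ->
  [/\ L`_0 = 0, L`_1 = 2 & L`_2 = - (6 * m)] ->
  [/\ p`_0 = a1, p`_1 = a2, p`_2 = a3 / 2 & ps`_0 = a2] ->
  [/\ V`_0 = 1, V`_1 = V1, V`_2 = V2 / 2 & V`_3 = V3 / 6] ->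
  [/\ Vs`_0 = V1, Vs`_1 = V2 & Vs`_2 = V3 / 2] ->
  [/\ g0`_0 = f0, g0`_1 = f1 & g0`_2 = f2 / 2] ->
  [/\ g1`_0 = k0, g1`_1 = k1 & g1`_2 = k2 / 2] ->
  [/\ h0`_0 = h00, h0`_1 = h01 & h0`_2 = h02 / 2] ->
  [/\ h1`_0 = h10, h1`_1 = h11 & h1`_2 = h12 / 2] ->
  [/\ v0`_0 = 0, v0`_1 = y1 & v0`_2 = y2 / 2] ->
  [/\ v1`_0 = 0, v1`_1 = z1 & v1`_2 = z2 / 2] ->
  b`_0 = 1 ->
  (forall i, (i <= 3)%N ->
     V`_i = (- (A * (p * p) + 2%:P * p + u%:P * (g0 * g0 + g1 * g1)))`_i) ->
  (forall i, (i <= 3)%N -> (b * b)`_i = V`_i /\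
   (3%:P * (V * b))`_i = (3%:P * (V * (1 + A * p)) - 'X * (
    V * (L * p + A * ps) - Vs * (1 + A * p) * (2^-1)%:P
    + u%:P * (V * (h0 + h1) - (v0 * g0 + v1 * g1) * (2^-1)%:P)))`_i) ->
  [/\ 1 = - (2 * a1 + u * (f0 * f0 + k0 * k0)),
      V1 = - (2 * a2 + 2 * (u * (f0 * f1 + k0 * k1))) &
      V2 = - (2 * a1 ^+ 2 + 2 * a3 + 2 * (u * (f0 * f2 + k0 * k2)) + 2 * (u * (f1 * f1 + k1 * k1)))] /\
  [/\ V1 = - (u * (h00 + h10)),
      V2 = - (1 / 2) * (u * (h00 + h10)) ^+ 2 + 4 * a1 - 4 * (u * (h01 + h11))
           + 2 * (u * (y1 * f0 + z1 * k0)) &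
      0 = 5 / 2 * V2 * (u * (h00 + h10)) + 3 / 4 * V1 ^+ 3 - 4 * V1 * (u * (h01 + h11))
          - 2 * (u * (h02 + h12)) + 6 * V1 * a1 + u * (y2 * f0 + z2 * k0)
          + 2 * (u * (y1 * f1 + z1 * k1))].
Proof.
move=> HA HL [p0 p1 p2 ps0] [V_0 V_1 V_2 V_3] [Vs0 Vs1 Vs2] [G00 G01 G02] [G10 G11 G12].
move=> [H00 H01 H02] [H10 H11 H12] [v00 v01 v02] [v10 v11 v12] b0 HW Hc.
have [A0 A1 A2 _] := HA.
have [W0 W1 W2] := W_coefs p g0 g1 u (And3 A0 A1 A2).
have [E1 E2 E3] := cmc_rhs_coefs p ps V Vs h0 h1 v0 v1 g0 g1 u HA HL.
split.
  move: (HW 0 isT) (HW 1 isT) (HW 2 isT).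
  rewrite W0 W1 W2 p0 p1 p2 V_0 V_1 V_2 G00 G01 G02 G10 G11 G12 => K0 K1 K2.
  by split=> //; lra.
have [B1 C1] := Hc 1 isT; have [B2 C2] := Hc 2 isT; have [B3 C3] := Hc 3 isT.
move: B1 B2 B3 C1 C2 C3.
rewrite E1 E2 E3 !coefCM !coefM_1 !coefM_2 !coefM_3 b0 p0 p1 ps0 V_0 V_1 V_2 V_3 Vs0 Vs1 Vs2.
rewrite G00 G01 G02 G10 G11 G12 H00 H01 H02 H10 H11 H12 v00 v01 v02 v10 v11 v12.
move: (b`_1) (b`_2) (b`_3).
move=> {HA HL p0 p1 p2 ps0 V_0 V_1 V_2 V_3 Vs0 Vs1 Vs2 G00 G01 G02 G10 G11 G12 b0 HW Hc
  H00 H01 H02 H10 H11 H12 v00 v01 v02 v10 v11 v12 A0 A1 A2 W0 W1 W2 E1 E2 E3}.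
move=> b1 b2 b3 B1 B2 B3 C1 C2 C3.
have b1E : b1 = V1 / 2 by lra.
rewrite b1E in B2 B3 C1 C2 C3.
have b2E : b2 = V2 / 4 - V1 ^+ 2 / 8 by lra.
rewrite b2E in B3 C2 C3.
have b3E : b3 = V3 / 12 - V1 / 2 * (V2 / 4 - V1 ^+ 2 / 8) by lra.
rewrite b3E in C3.
have V1E : V1 = - (u * (h00 + h10)) by lra.
have hE : u * (h00 + h10) = - V1 by lra.
have hV1 : V1 * (u * (h00 + h10)) = - V1 ^+ 2 by rewrite hE; ring.
have hV2 : V2 * (u * (h00 + h10)) = - (V1 * V2) by rewrite hE; ring.
move=> {B1 B2 B3 b1E b2E b3E C1}.
split=> //; rewrite hE ?sqrrN; lra.
Qed.

Lemma taylor_coefs (q : {poly R}) (e : nat -> R) :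
  (forall j, (j <= 2)%N -> q`_j = e j / j`!%:R) ->
  [/\ q`_0 = e 0%N, q`_1 = e 1%N & q`_2 = e 2%N / 2].
Proof. by move=> H; rewrite !H// !divr1. Qed.

Lemma lim0V phi (l : R) : l != 0 -> lim0 phi l -> lim0 (fun s => (phi s)^-1) l^-1.
Proof. by move=> l0 [H]; split; exact: cvgV. Qed.

Lemma lim0_gt phi (l u : R) : lim0 phi l -> u < l -> \forall s \near (0:R)^'+, u < phi s.
Proof. by move=> [H] ul; exact: cvgr_gt H _ ul. Qed.

(** From an expansion b to order k, the next coefficient u is half that of a - b^2,
    because sqrt phi - b = (phi - b^2) / (sqrt phi + b) and sqrt phi + b tends
    to 2. *)
Lemma jet_sqrt k phi a : jet k phi a -> a`_0 = 1 ->
  exists b, [/\ b`_0 = 1 & jet k (fun s => Num.sqrt (phi s)) b].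
Proof.
elim: k a => [|k IH] a Ha a0.
  exists 1%:P; rewrite coefC eqxx; split=> //.
  have := lim0B (lim0_sqrt (jet_lim0 Ha)) (lim0_cst 1); rewrite a0 sqrtr1 subrr.
  by apply: lim0_eq => s _; rewrite hornerC expr0 divr1.
have [b [b0 Hb]] := IH a (jetS Ha) a0.
pose u := (a - b * b)`_k.+1 / 2; exists (b + u%:P * 'X^(k.+1)); split.
  by rewrite coefD coefCM coefXn mulr0 addr0.
have Hphi := jet_lim0 Ha; rewrite a0 in Hphi.
have pos := lim0_gt Hphi ltr01.
have W0 : lim0 (fun s => Num.sqrt (phi s)) 1 by rewrite -sqrtr1; exact: lim0_sqrt.
have Hbb : forall i, (i <= k)%N -> (b * b)`_i = a`_i.
  have : jet k phi (b * b).
    apply: jet_near (jetM Hb Hb); apply: filterS pos => s s0.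
    by rewrite -expr2 sqr_sqrtr// ltW.
  by move=> H i ik; rewrite (jet_uniq H (jetS Ha)).
have c0 i : (i < k.+1)%N -> (a - b * b)`_i = 0.
  by rewrite ltnS => ik; rewrite coefB Hbb// subrr.
have Hb0 := horner_lim0 b; rewrite b0 in Hb0.
have d0 : (1 + 1 : R) != 0 by rewrite gt_eqF.
have Lq := lim0M (lim0D Ha (poly_lead c0)) (lim0V d0 (lim0D W0 Hb0)).
have Lu : lim0 (fun=> u) u := lim0_cst u.
have := lim0B Lq Lu; rewrite add0r {2}/u -[1 + 1]/(2%:R) subrr.
apply: lim0_near.
have posb : \forall s \near (0:R)^'+, 0 < b.[s] by exact: lim0_gt Hb0 ltr01.
near=> s.
have s0 : 0 < s by near: s; exact: near_pos.
have p0 : 0 < phi s by near: s.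
have q0 : 0 < b.[s] by near: s.
have w0 : 0 < Num.sqrt (phi s) by rewrite sqrtr_gt0.
rewrite !hornerE -{1}(sqr_sqrtr (ltW p0)).
have n0 : Num.sqrt (phi s) + b.[s] != 0 by rewrite gt_eqF// addr_gt0.
have sk : s ^+ k.+1 != 0 by rewrite expf_neq0// gt_eqF.
move: (Num.sqrt _) (b.[s]) (s ^+ k.+1) (a.[s]) n0 sk => w B S A n0 sk.
by field; rewrite n0 sk.
Unshelve. all: by end_near. Qed.

End Coefficients.

Section BoundaryExpansion.
Variables (R : realType) (m s0 : R) (c : bool) (P : 'rV[R]_3 -> R -> R).
Implicit Types (x : 'rV[R]_2).
Let D := collar s0.
Let F := in_chart c P.
Let d (i : 'I_(2 + 1)) := pdw D i F.
Let t0 : 'I_(2 + 1) := tang ord0.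
Let t1 : 'I_(2 + 1) := tang ord_max.
Let W := Wq m s0 c P.
Let dW (i : 'I_(2 + 1)) := pdw D i W.

Hypothesis s00 : 0 < s0.
Hypothesis CF : Ck 4 D F.
Hypothesis W1 : forall x, W (pt x 0) = 1.
Hypothesis cmc : forall x s, 0 < s < s0 -> cmc_eq m s0 c P x s.

Let CW : Ck 3 D W := Ck_W m s00 CF.
Let Cd i : Ck 3 D (d i) := Ck_pdw i CF.

Let a (j : nat) := ds_at0 s0 F j.
Let v (j : nat) := ds_at0 s0 W j.

Definition Apoly : {poly R} := 'X^2 * (1 - (2 * m)%:P * 'X).
Definition dApoly : {poly R} := 2%:P * 'X - (6 * m)%:P * 'X^2.

Lemma ApolyE s : Apoly.[s] = Acoef m s.
Proof. by rewrite /Apoly !hornerE. Qed.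

Lemma dApolyE s : dApoly.[s] = 2 * s - 6 * m * s ^+ 2.
Proof. by rewrite /dApoly !hornerE. Qed.

Lemma Apoly_coef : [/\ Apoly`_0 = 0, Apoly`_1 = 0, Apoly`_2 = 1 & Apoly`_3 = - (2 * m)].
Proof.
by rewrite /Apoly; split;
  rewrite ?(coefM_0, coefM_1, coefM_2, coefM_3) !(coefB, coefCM, coefX, coefXn, coef1) /=; ring.
Qed.

Lemma dApoly_coef : [/\ dApoly`_0 = 0, dApoly`_1 = 2 & dApoly`_2 = - (6 * m)].
Proof. by rewrite /dApoly; split; rewrite !(coefB, coefCM, coefX, coefXn) /=; ring. Qed.

Let p x := taylor s0 3 (d ord_s) x.
Let g (i : 'I_2) x := taylor s0 3 (d (tang i)) x.
Let pss x := taylor s0 2 (pdw D ord_s (d ord_s)) x.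
Let h (i : 'I_2) x := taylor s0 2 (pdw D (tang i) (d (tang i))) x.
Let V x := taylor s0 3 W x.
Let Vs x := taylor s0 2 (dW ord_s) x.
Let Vt (i : 'I_2) x := taylor s0 2 (dW (tang i)) x.

Lemma p_coef x j : (j <= 3)%N -> (p x)`_j = a j.+1 x / j`!%:R.
Proof. by move=> j3; rewrite /p taylor_coef// ds_at0_s. Qed.

Lemma g_coef i x j : (j <= 3)%N -> (g i x)`_j = pd i (a j) x / j`!%:R.
Proof. by move=> j3; rewrite /g taylor_coef// ds_at0_tang//; apply: Ck_le CF. Qed.

Lemma pss_coef x j : (j <= 2)%N -> (pss x)`_j = a j.+2 x / j`!%:R.
Proof. by move=> j3; rewrite /pss taylor_coef// !ds_at0_s. Qed.

Lemma ds_at0_tang_fun i j : (j <= 3)%N -> ds_at0 s0 (d (tang i)) j = pd i (a j).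
Proof. by move=> j3; apply/funext => x; rewrite ds_at0_tang//; apply: Ck_le CF. Qed.

Lemma h_coef i x j : (j <= 2)%N -> (h i x)`_j = pd i (pd i (a j)) x / j`!%:R.
Proof.
move=> j2; rewrite /h taylor_coef// ds_at0_tang//; last by apply: Ck_le (Cd _).
by rewrite ds_at0_tang_fun// (leq_trans j2).
Qed.

Lemma V_coef x j : (j <= 3)%N -> (V x)`_j = v j x / j`!%:R.
Proof. by move=> j3; rewrite /V taylor_coef. Qed.

Lemma Vs_coef x j : (j <= 2)%N -> (Vs x)`_j = v j.+1 x / j`!%:R.
Proof. by move=> j3; rewrite /Vs taylor_coef// ds_at0_s. Qed.

Lemma Vt_coef i x j : (j <= 2)%N -> (Vt i x)`_j = pd i (v j) x / j`!%:R.
Proof. by move=> j3; rewrite /Vt taylor_coef// ds_at0_tang//; apply: Ck_le CW. Qed.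

(** The definition of W, read on expansions. *)
Lemma W_coef x i : (i <= 3)%N -> (V x)`_i =
  (- (Apoly * (p x * p x) + 2%:P * p x +
      (mu x)%:P * (g ord0 x * g ord0 x + g ord_max x * g ord_max x)))`_i.
Proof.
move=> i3; apply: (jet_uniq (k := 3) (phi := fun s => W (pt x s))) => //.
  exact: Ck_jet.
have Jp := Ck_jet x s00 (Cd ord_s).
have J0 := Ck_jet x s00 (Cd t0); have J1 := Ck_jet x s00 (Cd t1).
have H := jetN (jetD (jetD (jetM (jet_poly 3 Apoly) (jetM Jp Jp)) (jetZ 2 Jp))
   (jetZ (mu x) (jetD (jetM J0 J0) (jetM J1 J1)))).
apply: jet_ext H => s; rewrite /W /Wq /Aq /muq pt_s pt_x ApolyE -/(d _) -/t0 -/t1.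
by rewrite !expr2.
Qed.

(** The equation, read on expansions.  Its bracket is known only to order 2, where
    second derivatives of P stop being expandable, but it carries a factor s. *)
Lemma cmc_coef x : exists b : {poly R}, b`_0 = 1 /\
  forall i, (i <= 3)%N -> (b * b)`_i = (V x)`_i /\
   (3%:P * (V x * b))`_i = (3%:P * (V x * (1 + Apoly * p x)) - 'X * (
    V x * (dApoly * p x + Apoly * pss x) - Vs x * (1 + Apoly * p x) * (2^-1)%:P
    + (mu x)%:P * (V x * (h ord0 x + h ord_max x)
       - (Vt ord0 x * g ord0 x + Vt ord_max x * g ord_max x) * (2^-1)%:P)))`_i.
Proof.
have JV := Ck_jet x s00 CW.
have V0 : (taylor s0 3 W x)`_0 = 1 by rewrite taylor_coef// divr1 /ds_at0 /= W1.
have [b [b0 Jb]] := jet_sqrt JV V0.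
have near_s : \forall s \near (0:R)^'+, 0 < s < s0 by exact: (near_rightP s00).
exists b; split=> // i i3; split.
  apply: (jet_uniq (k := 3) (phi := fun s => W (pt x s))) => //.
  have pos := lim0_gt (jet_lim0 JV) (ltac:(by rewrite V0; exact: ltr01)).
  apply: jet_near (jetM Jb Jb); apply: filterS pos => s s_gt0.
  by rewrite -expr2 sqr_sqrtr// ltW.
have Jp := Ck_jet x s00 (Cd ord_s).
have J0 := Ck_jet x s00 (Cd t0); have J1 := Ck_jet x s00 (Cd t1).
have J1A := jetD (jet_cst 3 1) (jetM (jet_poly 3 Apoly) Jp).
apply: (jet_uniq (k := 3) (phi := fun s => 3 * (W (pt x s) * Num.sqrt (W (pt x s))))) => //.
  exact: jetZ (jetM JV Jb).
have Jpss := Ck_jet x s00 (Ck_pdw ord_s (Cd ord_s)).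
have Jh i' := Ck_jet x s00 (Ck_pdw (tang i') (Cd (tang i'))).
have JW i' := Ck_jet x s00 (Ck_pdw i' CW).
have JB := jetD (jetB (jetM (jetS JV) (jetD (jetM (jet_poly 2 dApoly) (jetS Jp)) (jetM (jet_poly 2 Apoly) Jpss)))
    (jetM (jetM (JW ord_s) (jetS J1A)) (jet_cst 2 2^-1)))
  (jetZ (mu x) (jetB (jetM (jetS JV) (jetD (Jh ord0) (Jh ord_max)))
     (jetM (jetD (jetM (JW t0) (jetS J0)) (jetM (JW t1) (jetS J1))) (jet_cst 2 2^-1)))).
have JE := jetB (jetZ 3 (jetM JV J1A)) (jet_mulX JB).
apply: jet_near JE; apply: filterS near_s => s ss.
by have := cmc x ss; rewrite /cmc_eq /= ApolyE dApolyE => ->.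
Qed.

Let sl (G : 'rV[R]_2 -> R) x := Slap c G x.
Let sd (G H : 'rV[R]_2 -> R) x := Sdot c G H x.

Lemma v0E : v 0 = fun=> 1.
Proof. by apply/funext => x; exact: W1. Qed.

Lemma pd_v0 i x : pd i (v 0) x = 0.
Proof. by rewrite v0E; apply: pd_has_pdw; exact: has_pdw_cst. Qed.

(** The six equations for the derivatives a j of P and v j of W at s = 0. *)
Lemma cmc_orders_at x :
  [/\ 1 = - (2 * a 1 x + sd (a 0) (a 0) x),
      v 1 x = - (2 * a 2 x + 2 * sd (a 0) (a 1) x) &
      v 2 x = - (2 * a 1 x ^+ 2 + 2 * a 3 x + 2 * sd (a 0) (a 2) x + 2 * sd (a 1) (a 1) x)] /\
  [/\ v 1 x = - sl (a 0) x,
      v 2 x = - (1 / 2) * sl (a 0) x ^+ 2 + 4 * a 1 x - 4 * sl (a 1) x + 2 * sd (v 1) (a 0) x &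
      0 = 5 / 2 * v 2 x * sl (a 0) x + 3 / 4 * v 1 x ^+ 3 - 4 * v 1 x * sl (a 1) x
          - 2 * sl (a 2) x + 6 * v 1 x * a 1 x + sd (v 2) (a 0) x
          + 2 * sd (v 1) (a 1) x].
Proof.
have [b [b0 Hb]] := cmc_coef x.
rewrite /sl /sd !SlapE !SdotE.
have Hp := taylor_coefs (fun j (j2 : (j <= 2)%N) => @p_coef x j (leqW j2)).
have Hg i := taylor_coefs (fun j (j2 : (j <= 2)%N) => @g_coef i x j (leqW j2)).
have Hh i := taylor_coefs (@h_coef i x).
have HV := taylor_coefs (fun j (j2 : (j <= 2)%N) => @V_coef x j (leqW j2)).
have HVs := taylor_coefs (@Vs_coef x).
have Ht i := taylor_coefs (@Vt_coef i x).
have Hps := taylor_coefs (@pss_coef x).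
have HV3 : (V x)`_3 = v 3 x / 6 := @V_coef x 3 isT.
have [p0 p1 p2] := Hp; have [ps0 _ _] := Hps; have [V0 V1 V2] := HV.
have [r0 r1 r2] := Ht ord0; have [q0 q1 q2] := Ht ord_max.
exact: (cmc_orders Apoly_coef dApoly_coef (And4 p0 p1 p2 ps0)
  (And4 (etrans V0 (W1 x)) V1 V2 HV3) HVs (Hg ord0) (Hg ord_max) (Hh ord0) (Hh ord_max)
  (And3 (etrans r0 (pd_v0 _ x)) r1 r2) (And3 (etrans q0 (pd_v0 _ x)) q1 q2)
  b0 (@W_coef x) Hb).
Qed.

End BoundaryExpansion.

(** * The derivatives of order at most three and the compatibility condition *)

Section UniversalExpressions.
Variable R : realType.

Definition dneg (e : dexpr R) := DMul (DConst (-1)) e.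

Definition df1 : dexpr R :=
  DMul (DConst (- (1 / 2))) (DAdd (DConst 1) (DDot (DVar R) (DVar R))).

Definition df2 : dexpr R :=
  DAdd (DMul (DConst (1 / 2)) (DDot (DDot (DVar R) (DVar R)) (DVar R)))
    (DMul (DConst (1 / 2)) (DLap (DVar R))).

Definition dl2 : dexpr R :=
  DAdd (DAdd (DAdd (DMul (DConst (- (1 / 2))) (DMul (DLap (DVar R)) (DLap (DVar R))))
      (DMul (DConst 2) (DLap (DDot (DVar R) (DVar R)))))
    (DMul (DConst (-2)) (DDot (DLap (DVar R)) (DVar R))))
    (DMul (DConst (-2)) (DAdd (DConst 1) (DDot (DVar R) (DVar R)))).

(** Solve the second-order coefficient of the definition of W for P_sss, with
    P_s = f1, P_ss = f2, W_ss = l2. *)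
Definition df3 : dexpr R :=
  DAdd (DAdd (DAdd (DMul (DConst (- (1 / 2))) dl2) (dneg (DMul df1 df1)))
    (dneg (DDot (DVar R) df2))) (dneg (DDot df1 df1)).

Lemma deval_df1 c f : deval c df1 f = f1 c f.
Proof. by []. Qed.

Lemma deval_df2 c f : deval c df2 f = f2 c f.
Proof. by []. Qed.

Lemma deval_dl2 c f x : deval c dl2 f x = l2 c f x.
Proof.
rewrite /l2 /normgrad2 /=.
change (fun x0 : 'rV_2 => Sdot c f f x0) with (Sdot c f f).
by move: (Slap c f x) (Slap c _ x) (Sdot c _ _ x) (Sdot c _ _ x) => A B C E; ring.
Qed.

Lemma deval_df3 c f x : deval c df3 f x =
  - (1 / 2) * l2 c f x - f1 c f x ^+ 2 - Sdot c f (f2 c f) x - Sdot c (f1 c f) (f1 c f) x.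
Proof.
transitivity (- (1 / 2) * deval c dl2 f x + - 1 * (deval c df1 f x * deval c df1 f x)
  + - 1 * Sdot c f (deval c df2 f) x + - 1 * Sdot c (deval c df1 f) (deval c df1 f) x) => //.
by rewrite deval_dl2 deval_df1 deval_df2; ring.
Qed.

End UniversalExpressions.

Section Consequences.
Variables (R : realType) (m s0 : R) (c : bool) (P : 'rV[R]_3 -> R -> R).
Implicit Types (x : 'rV[R]_2).
Let D := collar s0.
Let F := in_chart c P.
Let W := Wq m s0 c P.

Hypothesis s00 : 0 < s0.
Hypothesis CF : Ck 4 D F.
Hypothesis W1 : forall x, W (pt x 0) = 1.
Hypothesis cmc : forall x s, 0 < s < s0 -> cmc_eq m s0 c P x s.

Let CW : Ck 3 D W := Ck_W m s00 CF.
Let a (j : nat) := ds_at0 s0 F j.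
Let v (j : nat) := ds_at0 s0 W j.
Let f := a 0.

(** Used to differentiate |grad f|^2 = - 2 f1 - 1 and Lap f = - l1, which are
    differentiable only because f1 and l1 are Taylor coefficients. *)
Lemma pd_affine (G H : 'rV[R]_2 -> R) (al be : R) i x l :
  (forall y, G y = al * H y + be) -> is_derive x (delta_mx 0 i : 'rV[R]_2) H l ->
  pd i G x = al * l.
Proof.
move=> /funext -> dH; rewrite /pd.
have E : (fun y => al * H y + be) = (al *: H + cst be) by apply/funext.
by rewrite E derive_val addr0.
Qed.

Lemma a_derive j i x : (j <= 3)%N ->
  is_derive x (delta_mx 0 i : 'rV[R]_2) (a j) (pd i (a j) x).
Proof.
move=> j3; have Cj : Ck j.+1 D F by exact: Ck_le CF.
by rewrite -(ds_at0_tang x i s00 Cj); exact: ds_at0_is_derive.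
Qed.

Lemma v_derive j i x : (j <= 2)%N ->
  is_derive x (delta_mx 0 i : 'rV[R]_2) (v j) (pd i (v j) x).
Proof.
move=> j3; have Cj : Ck j.+1 D W by exact: Ck_le CW.
by rewrite -(ds_at0_tang x i s00 Cj); exact: ds_at0_is_derive.
Qed.

Lemma pd_a_derive j i x : (j <= 2)%N ->
  is_derive x (delta_mx 0 i : 'rV[R]_2) (pd i (a j)) (pd i (pd i (a j)) x).
Proof.
move=> j2.
have Cj : Ck j.+1 D F by apply: Ck_le CF; exact: leq_trans j2 _.
have E : pd i (a j) = ds_at0 s0 (pdw D (tang i) F) j by apply/funext => y; rewrite ds_at0_tang.
have Cj' : Ck j.+1 D (pdw D (tang i) F) by apply: Ck_le (Ck_pdw _ CF).
by rewrite E -(ds_at0_tang x i s00 Cj'); exact: ds_at0_is_derive.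
Qed.

Lemma SdotC G H x : Sdot c G H x = Sdot c H G x.
Proof. by rewrite !SdotE; congr (_ * (_ + _)); rewrite mulrC. Qed.

Lemma a1E : a 1 = f1 c f.
Proof.
apply/funext => x; have [[+ _ _] _] := cmc_orders_at s00 CF W1 cmc x.
rewrite /f1 /normgrad2 -/(a 0) -/(a 1) -/f.
by move: (Sdot c f f x) (a 1 x) => S A; lra.
Qed.

Lemma v1E : v 1 = l1 c f.
Proof. by apply/funext => x; have [_ [H _ _]] := cmc_orders_at s00 CF W1 cmc x; exact: H. Qed.

Lemma normgradE y : normgrad2 c f y = -2 * a 1 y + - 1.
Proof. by rewrite a1E /f1; move: (normgrad2 c f y) => S; field. Qed.

Lemma Sdot_normgrad G x : Sdot c (normgrad2 c f) G x = - 2 * Sdot c (a 1) G x.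
Proof.
rewrite !SdotE !(pd_affine normgradE (a_derive _ x (isT : (1 <= 3)%N))).
by rewrite -/(a 1); move: (mu x) (pd _ _ x) (pd _ _ x) (pd _ _ _) (pd _ _ _) => u A B C E; ring.
Qed.

Lemma Slap_normgrad x : Slap c (normgrad2 c f) x = - 2 * Slap c (a 1) x.
Proof.
have E i : pd i (normgrad2 c f) = fun y => - 2 * pd i (a 1) y + 0.
  by apply/funext => y; rewrite addr0 (pd_affine normgradE (a_derive i y (isT : (1 <= 3)%N))).
have E2 i : pd i (pd i (normgrad2 c f)) x = - 2 * pd i (pd i (a 1)) x.
  rewrite E; exact: (pd_affine (fun y => erefl) (pd_a_derive i x (isT : (1 <= 2)%N))).
rewrite !SlapE !E2.
by move: (mu x) (pd _ _ x) (pd _ _ x) => u A B; ring.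
Qed.

Lemma a2E : a 2 = f2 c f.
Proof.
apply/funext => x; have [[_ H _] [H' _ _]] := cmc_orders_at s00 CF W1 cmc x.
rewrite /f2 Sdot_normgrad SdotC; move: H; rewrite H' -/(a 0) -/(a 1) -/(a 2) -/f.
by move: (Sdot c f (a 1) x) (a 2 x) (Slap c f x) => S A B; lra.
Qed.

Lemma v2E : v 2 = l2 c f.
Proof.
apply/funext => x; have [_ [_ + _]] := cmc_orders_at s00 CF W1 cmc x.
have SE y : Slap c f y = - 1 * v 1 y + 0 by rewrite v1E /l1; ring.
have SdE : Sdot c (Slap c f) f x = - Sdot c (v 1) f x.
  rewrite !SdotE !(pd_affine SE (v_derive _ x (isT : (1 <= 2)%N))).
  by move: (mu x) (pd _ _ x) (pd _ _ x) (pd _ _ _) (pd _ _ _) => u A B C E; ring.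
rewrite /l2 SdE Slap_normgrad normgradE -/(a 0) -/(a 1) -/(v 1) -/(v 2) -/f => ->.
by move: (Slap c f x) (Slap c (a 1) x) (Sdot c _ f x) (a 1 x) => A B C E; ring.
Qed.

Lemma a3E x : a 3 x = deval c (df3 R) f x.
Proof.
have [[_ _ +] _] := cmc_orders_at s00 CF W1 cmc x.
rewrite deval_df3 -/(v 2) -/(a 0) -/(a 1) -/(a 2) -/(a 3) -/f v2E a1E a2E.
by move: (l2 c f x) (f1 c f x) (a 3 x) (Sdot _ _ _ x) (Sdot _ _ _ x) => A B C E G; lra.
Qed.

Lemma compatibility x :
  0 = 5 / 2 * l2 c f x * Slap c f x + 3 / 4 * l1 c f x ^+ 3
          - 4 * l1 c f x * Slap c (f1 c f) x - 2 * Slap c (f2 c f) x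
          + 6 * l1 c f x * f1 c f x
          + Sdot c (l2 c f) f x + 2 * Sdot c (l1 c f) (f1 c f) x.
Proof.
have [_ [_ _ +]] := cmc_orders_at s00 CF W1 cmc x.
by rewrite -/(v 1) -/(v 2) -/(a 0) -/(a 1) -/(a 2) -/f v1E v2E a1E a2E.
Qed.

End Consequences.

(** * Pairs of functions that agree to a given order *)

Section Setup.
Variables (R : realType) (m s0 : R) (P : 'rV[R]_3 -> R -> R).
Hypothesis m0 : 0 <= m.
Hypothesis cmcP : spacelike_cmc1 m s0 P.
Hypothesis C2P : Ck_up_to_scri 2 s0 P.

Lemma cmc_s0 : 0 < s0. Proof. by case: cmcP. Qed.

Lemma cmc_Wpos c x s : 0 < s < s0 -> 0 < Wq m s0 c P (pt x s).
Proof.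
move=> ss; have [s00 ms _ H] := cmcP; have [H1 _] := H c x s ss.
have zs : 0 < s_of (graph_point c P x s) < s0 by rewrite graph_point_s.
by have := spacelike_W s00 (C2P c) zs m0 ms H1; rewrite graph_point_proj.
Qed.

Lemma cmc_equation c x s : 0 < s < s0 -> cmc_eq m s0 c P x s.
Proof.
move=> ss; have [s00 ms _ H] := cmcP; have [_ H2] := H c x s ss.
exact: (cmc_eqP s00 (C2P c) ss (cmc_Wpos c x ss)).1 H2.
Qed.

Lemma cmc_W1 c x : Wq m s0 c P (pt x 0) = 1.
Proof.
have s00 := cmc_s0.
have [H|//] := W_boundary01 s00 (C2P c) (@cmc_Wpos c) (@cmc_equation c) x.
by case: (W_boundary_neq0 s00 (C2P c) (@cmc_Wpos c) (@cmc_equation c) H).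
Qed.

End Setup.

Lemma scri_dsE (R : realType) s0 c k (P : 'rV[R]_3 -> R -> R) x :
  scri_ds s0 c k P x = ds_at0 s0 (in_chart c P) k x.
Proof. by rewrite /ds_at0 pt0. Qed.

Lemma boundary_valueE (R : realType) s0 c (P : 'rV[R]_3 -> R -> R) :
  boundary_value P c = ds_at0 s0 (in_chart c P) 0.
Proof. by apply/funext => x; rewrite /ds_at0 /= /in_chart pt_x pt_s. Qed.

Section DualCalculus.
Variable R : realType.
Implicit Types (phi psi : R -> R) (k : nat) (l c : R).

(** phi and psi have the same limit l, and phi - psi = c s^k + o(s^k). *)
Record contact k phi psi l c : Prop := Contact {
  contact_l : lim0 phi l;
  contact_r : lim0 psi l;
  contact_quot : lim0 (fun s => (phi s - psi s) / s ^+ k) c }.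

Lemma contact_same k phi l : lim0 phi l -> contact k phi phi l 0.
Proof. by move=> H; split=> //; apply: lim0_eq (lim0_cst 0) => s _; rewrite subrr mul0r. Qed.

Lemma contact_cst k l : contact k (fun=> l) (fun=> l) l 0.
Proof. exact/contact_same/lim0_cst. Qed.

Lemma contactD k phi psi l c phi' psi' l' c' : contact k phi psi l c -> contact k phi' psi' l' c' ->
  contact k (fun s => phi s + phi' s) (fun s => psi s + psi' s) (l + l') (c + c').
Proof.
move=> [H1 H2 H3] [K1 K2 K3]; split; try exact: lim0D.
by apply: lim0_eq (lim0D H3 K3) => s _; ring.
Qed.

Lemma contactN k phi psi l c : contact k phi psi l c ->
  contact k (fun s => - phi s) (fun s => - psi s) (- l) (- c).
Proof.
move=> [H1 H2 H3]; split; try exact: lim0N.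
by apply: lim0_eq (lim0N H3) => s _; ring.
Qed.

Lemma contactM k phi psi l c phi' psi' l' c' : contact k phi psi l c -> contact k phi' psi' l' c' ->
  contact k (fun s => phi s * phi' s) (fun s => psi s * psi' s) (l * l') (c * l' + l * c').
Proof.
move=> [H1 H2 H3] [K1 K2 K3]; split; try exact: lim0M.
by apply: lim0_eq (lim0D (lim0M H3 K1) (lim0M H2 K3)) => s _; ring.
Qed.

Lemma contact_mulX k phi psi l c : contact k phi psi l c ->
  contact k.+1 (fun s => s * phi s) (fun s => s * psi s) 0 c.
Proof.
move=> [H1 H2 H3]; split.
- by have := lim0M (id_lim0 R) H1; rewrite mul0r.
- by have := lim0M (id_lim0 R) H2; rewrite mul0r.
apply: lim0_eq H3 => s s0; rewrite exprS.
have : s ^+ k != 0 by rewrite expf_neq0// gt_eqF.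
by move: (s ^+ k) (phi s) (psi s) (lt0r_neq0 s0) => u A B s1 u1; field; rewrite s1 u1.
Qed.

Lemma contact_lower k phi psi l c : contact k.+1 phi psi l c -> contact k phi psi l 0.
Proof.
move=> [H1 H2 H3]; split=> //.
have := lim0M H3 (id_lim0 R); rewrite mulr0; apply: lim0_eq => s s0; rewrite exprS.
have : s ^+ k != 0 by rewrite expf_neq0// gt_eqF.
by move: (s ^+ k) (phi s) (psi s) (lt0r_neq0 s0) => u A B s1 u1; field; rewrite s1 u1.
Qed.

Lemma contact_sqrt k phi psi c : contact k phi psi 1 c ->
  contact k (fun s => Num.sqrt (phi s)) (fun s => Num.sqrt (psi s)) 1 (c / 2).
Proof.
move=> [H1 H2 H3].
have K1 : lim0 (fun s => Num.sqrt (phi s)) 1 by rewrite -sqrtr1; exact: lim0_sqrt.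
have K2 : lim0 (fun s => Num.sqrt (psi s)) 1 by rewrite -sqrtr1; exact: lim0_sqrt.
split=> //.
have d0 : (1 + 1 : R) != 0 by rewrite gt_eqF.
have := lim0M H3 (lim0V d0 (lim0D K1 K2)); apply: lim0_near.
have pos1 := lim0_gt H1 ltr01; have pos2 := lim0_gt H2 ltr01.
near=> s.
have p1 : 0 < phi s by near: s.
have p2 : 0 < psi s by near: s.
have s0 : 0 < s by near: s; exact: near_pos.
have n0 : Num.sqrt (phi s) + Num.sqrt (psi s) != 0 by rewrite gt_eqF// addr_gt0// sqrtr_gt0.
rewrite -{1}(sqr_sqrtr (ltW p1)) -{1}(sqr_sqrtr (ltW p2)).
have sk : s ^+ k != 0 by rewrite expf_neq0// gt_eqF.
move: (Num.sqrt (phi s)) (Num.sqrt (psi s)) (s ^+ k) n0 sk => A B u n0 u0.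
by field; rewrite n0 u0.
Unshelve. all: by end_near. Qed.

(** Functions with equal derivatives up to order k at s = 0: the next coefficients
    govern the difference. *)
Lemma contact_taylor k s0 t0 (F G : 'rV[R]_(2 + 1) -> R) x : 0 < s0 -> 0 < t0 ->
  Ck k.+1 (collar s0) F -> Ck k.+1 (collar t0) G ->
  (forall j, (j <= k)%N -> ds_at0 s0 F j x = ds_at0 t0 G j x) ->
  contact k.+1 (fun s => F (pt x s)) (fun s => G (pt x s)) (ds_at0 s0 F 0 x)
   ((ds_at0 s0 F k.+1 x - ds_at0 t0 G k.+1 x) / k.+1`!%:R).
Proof.
move=> s00 t00 CF CG E.
have JF := Ck_jet x s00 CF; have JG := Ck_jet x t00 CG.
split.
- by have := jet_lim0 JF; rewrite taylor_coef// divr1.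
- by have := jet_lim0 JG; rewrite taylor_coef// divr1 E.
rewrite mulrBl -!(@taylor_coef _ _ k.+1)//.
apply: (jet_lead JF JG) => i ik; rewrite !taylor_coef// ?(ltnW ik)//.
by rewrite E.
Qed.

Lemma contact_taylor0 k s0 t0 (F G : 'rV[R]_(2 + 1) -> R) x : 0 < s0 -> 0 < t0 ->
  Ck k.+1 (collar s0) F -> Ck k.+1 (collar t0) G ->
  (forall j, (j <= k.+1)%N -> ds_at0 s0 F j x = ds_at0 t0 G j x) ->
  contact k.+1 (fun s => F (pt x s)) (fun s => G (pt x s)) (ds_at0 s0 F 0 x) 0.
Proof.
move=> s00 t00 CF CG E.
have := contact_taylor s00 t00 CF CG (fun j jk => E j (leqW jk)).
by rewrite (E k.+1 (leqnn _)) subrr mul0r.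
Qed.

(** The converse of [contact_taylor]. *)
Lemma contact_ds_at0 k s0 t0 (F G : 'rV[R]_(2 + 1) -> R) x l c : 0 < s0 -> 0 < t0 ->
  Ck k.+1 (collar s0) F -> Ck k.+1 (collar t0) G ->
  contact k.+1 (fun s => F (pt x s)) (fun s => G (pt x s)) l c ->
  (forall j, (j <= k)%N -> ds_at0 s0 F j x = ds_at0 t0 G j x) /\
  ds_at0 s0 F k.+1 x - ds_at0 t0 G k.+1 x = c * k.+1`!%:R.
Proof.
move=> s00 t00 CF CG [H1 H2 H3].
have JF := Ck_jet x s00 CF; have JG := Ck_jet x t00 CG.
have JB : jet k.+1 (fun s => F (pt x s) - G (pt x s)) (c%:P * 'X^(k.+1)).
  have := lim0B H3 (lim0_cst c); rewrite subrr; apply: lim0_eq => s s0'.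
  rewrite hornerM hornerC hornerXn [RHS]mulrBl mulfK// expf_neq0// gt_eqF//.
have E i : (i <= k.+1)%N -> ds_at0 s0 F i x / i`!%:R - ds_at0 t0 G i x / i`!%:R = c * (i == k.+1)%:R.
  move=> ik; have := jet_uniq (jetB JF JG) JB ik.
  by rewrite coefB !taylor_coef// coefCM coefXn.
have f0 i : i`!%:R != 0 :> R by rewrite pnatr_eq0 -lt0n fact_gt0.
split=> [j jk|].
  have := E j (leqW jk); rewrite (ltn_eqF _) ?ltnS// mulr0 -mulrBl => /eqP.
  by rewrite mulf_eq0 invr_eq0 (negbTE (f0 j)) orbF subr_eq0 => /eqP.
have := E k.+1 (leqnn _); rewrite eqxx mulr1 -mulrBl => <-.
by rewrite divfK.
Qed.

End DualCalculus.

(** * Uniqueness of the expansion beyond the fourth order *)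

Section Uniqueness.
Variables (R : realType) (m s0 t0 : R) (c : bool) (P Q : 'rV[R]_3 -> R -> R).
Implicit Types (x : 'rV[R]_2) (j k : nat).
Let D := collar s0.
Let E := collar t0.
Let F := in_chart c P.
Let G := in_chart c Q.
Let W := Wq m s0 c P.
Let Z := Wq m t0 c Q.
Hypotheses (s00 : 0 < s0) (t00 : 0 < t0).
Hypotheses (CF : smooth D F) (CG : smooth E G).
Hypotheses (W1 : forall x, W (pt x 0) = 1) (Z1 : forall x, Z (pt x 0) = 1).
Hypotheses (cmcP : forall x s, 0 < s < s0 -> cmc_eq m s0 c P x s)
           (cmcQ : forall x s, 0 < s < t0 -> cmc_eq m t0 c Q x s).

Let CW k : Ck k D W := Ck_W m s00 (CF k.+1).
Let CZ k : Ck k E Z := Ck_W m t00 (CG k.+1).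

Let a j := ds_at0 s0 F j.
Let b j := ds_at0 t0 G j.

Lemma Acoef_lim0 : lim0 (Acoef m) 0.
Proof.
have := lim0M (expr_lim0 R 1) (lim0B (lim0_cst 1) (lim0M (lim0_cst (2 * m)) (id_lim0 R))).
by rewrite mul0r.
Qed.

Section Step.
Variable n : nat.
Hypothesis ab : forall j, (j <= n.+2)%N -> a j = b j.

Let k := n.+1.

Lemma ds_at0_tang_eq j i : (j <= n.+2)%N -> ds_at0 s0 (pdw D (tang i) F) j = ds_at0 t0 (pdw E (tang i) G) j.
Proof.
move=> jn; apply/funext => x; rewrite (ds_at0_tang _ _ s00 (CF j.+1)) (ds_at0_tang _ _ t00 (CG j.+1)).
by rewrite -/(a j) ab.
Qed.

Let C x := (a n.+3 x - b n.+3 x) / n.+2`!%:R.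

Lemma contact_ps x : exists l, contact n.+2 (fun s => pdw D ord_s F (pt x s))
  (fun s => pdw E ord_s G (pt x s)) l (C x).
Proof.
exists (a 1%N x); have := contact_taylor (k := n.+1) (x := x) s00 t00 (Ck_pdw ord_s (CF _)) (Ck_pdw ord_s (CG _)).
rewrite !ds_at0_s; apply=> j jn; rewrite !ds_at0_s -/(a _) ab//.
Qed.

Lemma contact_pt i x : exists l, contact n.+2 (fun s => pdw D (tang i) F (pt x s))
  (fun s => pdw E (tang i) G (pt x s)) l 0.
Proof.
exists (ds_at0 s0 (pdw D (tang i) F) 0 x); apply: (contact_taylor0 s00 t00 (Ck_pdw (tang i) (CF _)) (Ck_pdw (tang i) (CG _))) => j jn.
by rewrite ds_at0_tang_eq.
Qed.

(** Of the terms of W only 2 P_s contributes: A vanishes at s = 0 and the tangential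
    derivatives agree to higher order. *)
Lemma contact_W x : contact n.+2 (fun s => W (pt x s)) (fun s => Z (pt x s)) 1 (- (2 * C x)).
Proof.
have LA := contact_same n.+2 Acoef_lim0.
have [p Lp] := contact_ps x; have [q0 L0] := contact_pt ord0 x; have [q1 L1] := contact_pt ord_max x.
have L := contactN (contactD (contactD (contactM LA (contactM Lp Lp)) (contactM (contact_cst n.+2 2) Lp))
   (contactM (contact_cst n.+2 (mu x)) (contactD (contactM L0 L0) (contactM L1 L1)))).
have [H1 H2 H3] := L.
have EW s : W (pt x s) = - (Acoef m s * (pdw D ord_s F (pt x s) * pdw D ord_s F (pt x s)) + 2 * pdw D ord_s F (pt x s) +
   mu x * (pdw D (tang ord0) F (pt x s) * pdw D (tang ord0) F (pt x s) +
     pdw D (tang ord_max) F (pt x s) * pdw D (tang ord_max) F (pt x s))).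
  by rewrite /W /Wq /Aq /muq pt_s pt_x -!expr2.
have EZ s : Z (pt x s) = - (Acoef m s * (pdw E ord_s G (pt x s) * pdw E ord_s G (pt x s)) + 2 * pdw E ord_s G (pt x s) +
   mu x * (pdw E (tang ord0) G (pt x s) * pdw E (tang ord0) G (pt x s) +
     pdw E (tang ord_max) G (pt x s) * pdw E (tang ord_max) G (pt x s))).
  by rewrite /Z /Wq /Aq /muq pt_s pt_x -!expr2.
split.
- by have := jet_lim0 (Ck_jet x s00 (CW 0)); rewrite taylor_coef// divr1 /ds_at0 /= W1.
- by have := jet_lim0 (Ck_jet x t00 (CZ 0)); rewrite taylor_coef// divr1 /ds_at0 /= Z1.
have -> : - (2 * C x) = - (0 * (p * p) + 0 * (C x * p + p * C x) + (0 * p + 2 * C x) +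
   (0 * (q0 * q0 + q1 * q1) + mu x * (0 * q0 + q0 * 0 + (0 * q1 + q1 * 0)))) by ring.
by apply: lim0_eq H3 => s _; rewrite EW EZ.
Qed.

Lemma ds_at0_W_eq j : (j <= n.+1)%N -> ds_at0 s0 W j = ds_at0 t0 Z j.
Proof.
move=> jn; apply/funext => x.
by have [H _] := contact_ds_at0 s00 t00 (CW _) (CZ _) (contact_W x); exact: H.
Qed.

Lemma contact_Ws x : exists l, contact n.+1 (fun s => pdw D ord_s W (pt x s))
  (fun s => pdw E ord_s Z (pt x s)) l (- (2 * C x) * n.+2%:R).
Proof.
exists (ds_at0 s0 W 1 x); have := contact_taylor (k := n) (x := x) s00 t00 (Ck_pdw ord_s (CW _)) (Ck_pdw ord_s (CZ _)).
rewrite !ds_at0_s; have [_ ->] := contact_ds_at0 s00 t00 (CW _) (CZ _) (contact_W x).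
have f0 : n.+1`!%:R != 0 :> R by rewrite pnatr_eq0 -lt0n fact_gt0.
rewrite factS natrM mulrA mulfK//; apply=> j jn.
by rewrite !ds_at0_s ds_at0_W_eq.
Qed.

Lemma contact_Wt i x : exists l, contact n.+1 (fun s => pdw D (tang i) W (pt x s))
  (fun s => pdw E (tang i) Z (pt x s)) l 0.
Proof.
exists (ds_at0 s0 (pdw D (tang i) W) 0 x); apply: (contact_taylor0 s00 t00 (Ck_pdw (tang i) (CW _)) (Ck_pdw (tang i) (CZ _))) => j jn.
by rewrite (ds_at0_tang _ _ s00 (CW j.+1)) (ds_at0_tang _ _ t00 (CZ j.+1)) ds_at0_W_eq.
Qed.

Lemma contact_h i x : exists l, contact n.+1 (fun s => pdw D (tang i) (pdw D (tang i) F) (pt x s))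
  (fun s => pdw E (tang i) (pdw E (tang i) G) (pt x s)) l 0.
Proof.
exists (ds_at0 s0 (pdw D (tang i) (pdw D (tang i) F)) 0 x); apply: (contact_taylor0 s00 t00 (Ck_pdw _ (Ck_pdw (tang i) (CF _))) (Ck_pdw _ (Ck_pdw (tang i) (CG _)))) => j jn.
rewrite (ds_at0_tang _ _ s00 (Ck_pdw (tang i) (CF j.+2))) (ds_at0_tang _ _ t00 (Ck_pdw (tang i) (CG j.+2))).
by rewrite ds_at0_tang_eq// (leq_trans jn).
Qed.

Lemma contact_pss x : exists l c', contact n.+1 (fun s => pdw D ord_s (pdw D ord_s F) (pt x s))
  (fun s => pdw E ord_s (pdw E ord_s G) (pt x s)) l c'.
Proof.
exists (a 2%N x); have := contact_taylor (k := n) (x := x) s00 t00 (Ck_pdw ord_s (Ck_pdw ord_s (CF _))) (Ck_pdw ord_s (Ck_pdw ord_s (CG _))).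
rewrite !ds_at0_s => H; eexists; apply: H => j jn.
by rewrite !ds_at0_s -/(a _) ab.
Qed.

(** Compare the coefficients of s^(n+2) in the two equations; see the remarks on
    the fourth derivative at the top.  The indicial factor is 3 - (n + 2). *)
Lemma contact_equation x : n != 1%N -> a n.+3 x = b n.+3 x.
Proof.
move=> n1; have n3 : (3 == n.+2)%N = false by case: (n) n1 => [|[|?]].
have LA k := contact_same k Acoef_lim0.
have [p Lp] := contact_ps x; have Lp' := contact_lower Lp.
have L1A := contactD (contact_cst n.+2 1) (contactM (LA n.+2) Lp).
have LW := contact_W x; have LW' := contact_lower LW.
have [pss [c' Lpss]] := contact_pss x; have [ws Lws] := contact_Ws x.
have [h0 Lh0] := contact_h ord0 x; have [h1 Lh1] := contact_h ord_max x.
have [w0 Lw0] := contact_Wt ord0 x; have [w1 Lw1] := contact_Wt ord_max x.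
have [q0 Lq0] := contact_pt ord0 x; have [q1 Lq1] := contact_pt ord_max x.
have LL : contact n.+1 (fun s => 2 * s - 6 * m * s ^+ 2) (fun s => 2 * s - 6 * m * s ^+ 2) 0 0.
  apply: contact_same; have := lim0B (lim0M (lim0_cst 2) (id_lim0 R)) (lim0M (lim0_cst (6 * m)) (expr_lim0 R 1)).
  by rewrite !mulr0 subrr.
have L1 := contactM (contact_cst n.+2 3) (contactM LW (contact_sqrt LW)).
have LB := contactD (contactD (contactM LW' (contactD (contactM LL Lp') (contactM (LA _) Lpss)))
    (contactN (contactM (contactM Lws (contact_lower L1A)) (contact_cst n.+1 2^-1))))
  (contactM (contact_cst n.+1 (mu x)) (contactD (contactM LW' (contactD Lh0 Lh1))
     (contactN (contactM (contactD (contactM Lw0 (contact_lower Lq0))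
                 (contactM Lw1 (contact_lower Lq1))) (contact_cst n.+1 2^-1))))).
have L2 := contactD (contactM (contact_cst n.+2 3) (contactM LW L1A)) (contactN (contact_mulX LB)).
have near_st : \forall s \near (0:R)^'+, 0 < s < s0 /\ 0 < s < t0.
  apply: (@near_rightP _ _ (Num.min s0 t0)); first by rewrite lt_min s00 t00.
  by move=> s /andP[-> ]; rewrite lt_min => /andP[-> ->].
have Ec := (fun H => lim0_unique (contact_quot L1) (lim0_near H (contact_quot L2))).
have {}Ec := Ec ltac:(apply: filterS near_st => s [ss st];
  exact: (congr1 (fun u => u / s ^+ n.+2)
    (f_equal2 (fun u w => u - w) (esym (cmcP x ss)) (esym (cmcQ x st))))).
have E0 : C x * (3 - n.+2%:R) = 0.
  move: Ec => {LA Lp Lp' L1A LW LW' Lpss LL L1 LB L2 near_st Lws Lh0 Lh1 Lw0 Lw1 Lq0 Lq1}.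
  by move: (C x) (mu x) (n.+2%:R) => u w K Ec; lra.
move/eqP: E0; rewrite mulf_eq0 subr_eq0 (eqr_nat _ 3 n.+2) n3 orbF.
rewrite /C mulf_eq0 invr_eq0 pnatr_eq0 -leqn0 leqNgt fact_gt0 orbF subr_eq0.
by move/eqP.
Qed.

End Step.

(** The s-derivatives up to order 4 start the induction beyond the exceptional
    order. *)
Lemma ds_at0_determined : a 0%N = b 0%N -> a 1%N = b 1%N -> a 2%N = b 2%N -> a 3%N = b 3%N -> a 4%N = b 4%N ->
  forall j, a j = b j.
Proof.
move=> e0 e1 e2 e3 e4.
suff H k : forall j, (j <= k.+4)%N -> a j = b j by move=> j; exact: (H j j (leqW (leqW (leqW (leqnSn j))))).
elim: k => [|k IH] j.
  case: j => [_|[_|[_|[_|[_|j jk]]]]]; [exact e0|exact e1|exact e2|exact e3|exact e4|].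
  by exfalso; move: jk; rewrite !ltnS ltn0.
move=> {e0 e1 e2 e3 e4}.
rewrite leq_eqVlt => /predU1P[->|]; last by rewrite ltnS => /IH.
by apply/funext => x; apply: (@contact_equation k.+2) => // i; exact: IH.
Qed.

End Uniqueness.

(** Mixed derivatives at s = 0 are x-derivatives of the s-derivatives. *)
Lemma pdws_determined (R : realType) (s0 t0 : R) (F G : 'rV[R]_(2 + 1) -> R) l :
  0 < s0 -> 0 < t0 -> smooth (collar s0) F -> smooth (collar t0) G ->
  (forall j, ds_at0 s0 F j = ds_at0 t0 G j) ->
  forall j, ds_at0 s0 (pdws (collar s0) l F) j = ds_at0 t0 (pdws (collar t0) l G) j.
Proof.
move=> s00 t00 CF CG FG; elim: l => [//|i l IH] j.
have CF' k : Ck k (collar s0) (pdws (collar s0) l F) by apply: Ck_pdws; exact: CF.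
have CG' k : Ck k (collar t0) (pdws (collar t0) l G) by apply: Ck_pdws; exact: CG.
apply/funext => x; change (ds_at0 s0 (pdw (collar s0) i (pdws (collar s0) l F)) j x =
  ds_at0 t0 (pdw (collar t0) i (pdws (collar t0) l G)) j x).
have [->|[k ->]] := tang_or_s i; first by rewrite !ds_at0_s IH.
by rewrite (ds_at0_tang _ _ s00 (CF' _)) (ds_at0_tang _ _ t00 (CG' _)) IH.
Qed.

(** * Inverses, square roots and primitives of class C^k *)

Section Composition.
Variables (R : realType) (n : nat).
Implicit Types (D : set 'rV[R]_n) (i : 'I_n) (F G : 'rV[R]_n -> R).

Lemma CkV k D F : perfect D -> (forall z, D z -> F z != 0) -> Ck k D F ->
  Ck k D (fun z => (F z)^-1).
Proof.
move=> pD F0; have cV G : {within D, continuous G} -> (forall z, D z -> G z != 0) ->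
    {within D, continuous (fun z => (G z)^-1)}.
  move=> cG G0; apply/subspace_continuousP => z Dz; apply: cvgV; first exact: G0.
  by move/subspace_continuousP : cG; apply.
elim: k => [|k IH] CF; first by split=> //; apply: cV F0; exact: Ck_cont CF.
have dF i := Ck_derivable i CF.
have H i z : D z -> has_pdw D i (fun z => (F z)^-1) z (- (F z ^- 2) * pdw D i F z).
  by move=> Dz; apply: has_pdwV (F0 _ Dz) _; exact: pdwP (dF i) Dz.
split; first by apply: cV F0; exact: Ck_cont CF.
move=> i; split; first by apply: has_pdw_derivable => z Dz; eexists; exact: H.
have := CkM pD (CkN pD (CkX 2 pD (IH (CkS CF)))) (Ck_pdw i CF).
by apply: Ck_eq => z /[!inE] Dz; rewrite (has_pdw_pdw pD Dz (H i z Dz)) exprVn.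
Qed.

Lemma Ck_sqrt k D F : perfect D -> (forall z, D z -> 0 < F z) -> Ck k D F ->
  Ck k D (fun z => Num.sqrt (F z)).
Proof.
move=> pD F0; have cS G : {within D, continuous G} ->
    {within D, continuous (fun z => Num.sqrt (G z))}.
  by move=> cG z; apply: continuous_comp; [exact: cG|exact: sqrt_continuous].
elim: k => [|k IH] CF; first by split=> //; apply: cS; exact: Ck_cont CF.
have dF i := Ck_derivable i CF.
have H i z : D z ->
    has_pdw D i (fun z => Num.sqrt (F z)) z ((2 * Num.sqrt (F z))^-1 * pdw D i F z).
  by move=> Dz; apply: has_pdw_sqrt (F0 _ Dz) _; exact: pdwP (dF i) Dz.
split; first by apply: cS; exact: Ck_cont CF.
move=> i; split; first by apply: has_pdw_derivable => z Dz; eexists; exact: H.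
have C2 := CkM pD (Ck_cst k 2 pD) (IH (CkS CF)).
have C0 z : D z -> 2 * Num.sqrt (F z) != 0.
  by move=> /F0 Fz; rewrite gt_eqF// mulr_gt0// sqrtr_gt0.
apply: Ck_eq (CkM pD (CkV pD C0 C2) (Ck_pdw i CF)) => z /[!inE] Dz.
by rewrite (has_pdw_pdw pD Dz (H i z Dz)).
Qed.

Lemma has_pdw_comp_coord D i (j : 'I_n) (G : R -> R) (l : R) (z : 'rV[R]_n) : is_derive (z 0 j) 1 G l ->
  has_pdw D i (fun z => G (z 0 j)) z ((i == j)%:R * l).
Proof.
move=> H; have [ij|ij] := eqVneq i j; last first.
  rewrite mul0r; split; rewrite (_ : dquot i _ z = fun=> 0); first exact: cvg_cst.
  by apply/funext => h; rewrite /dquot !mxE eqxx/= eq_sym (negbTE ij) mulr0 addr0 subrr mulr0.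
rewrite mul1r -{}ij in H *; split.
have [/cvg_ex[l' Hl'] lG] := H.
have El : l' = l by rewrite -lG; apply/esym; exact: cvg_lim Hl'.
have K : h^-1 *: ((G \o shift (z 0 i)) (h *: (1:R)) - G (z 0 i)) @[h --> (0:R)^'] --> l.
  by rewrite -El; exact: Hl'.
have {}K : h^-1 *: ((G \o shift (z 0 i)) (h *: (1:R)) - G (z 0 i))
    @[h --> within (stays D i z) (0:R)^'] --> l by exact: cvg_within_filter.
apply: (cvg_near_eq _ K).
by near=> h; rewrite /dquot !mxE /= !eqxx/= /GRing.scale/= mulr1 addrC.
Unshelve. all: by end_near. Qed.

(** The primitive may be taken on an interval larger than the range of the j-th
    coordinate on D, which is why its derivative is two-sided. *)
Lemma Ck_antiderivative k D (j : 'I_n) (G g : R -> R) : perfect D ->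
  (forall z, D z -> is_derive (z 0 j) 1 G (g (z 0 j))) ->
  Ck k D (fun z => g (z 0 j)) -> Ck k.+1 D (fun z => G (z 0 j)).
Proof.
move=> pD H Cg; split.
  apply/subspace_continuousP => z Dz; apply: cvg_within_filter.
  apply: (@continuous_comp _ _ _ (fun z : 'rV[R]_n => z 0 j) G z); first exact: coord_continuous.
  have [dG _] := H z Dz.
  exact/differentiable_continuous/derivable1_diffP.
move=> i; split; first by apply: has_pdw_derivable => z Dz; eexists; exact: has_pdw_comp_coord (H z Dz).
apply: Ck_eq (CkM pD (Ck_cst k (i == j)%:R pD) Cg) => z /[!inE] Dz.
by rewrite (has_pdw_pdw pD Dz (has_pdw_comp_coord D i (H z Dz))).
Qed.

End Composition.

Lemma contactV (R : realType) k (phi psi : R -> R) l c : l != 0 -> contact k phi psi l c ->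
  contact k (fun s => (phi s)^-1) (fun s => (psi s)^-1) l^-1 (- (c / l ^+ 2)).
Proof.
move=> l0 [H1 H2 H3]; have V1 := lim0V l0 H1; have V2 := lim0V l0 H2; split=> //.
have nz phi' : lim0 phi' l -> \forall s \near (0:R)^'+, phi' s != 0.
  by move=> [H]; exact: cvgr_neq0 H l0.
have := lim0N (lim0M (lim0M H3 V1) V2).
rewrite -mulrA -invfM -expr2; apply: lim0_near.
have n1 := nz _ H1; have n2 := nz _ H2.
near=> s.
have p1 : phi s != 0 by near: s.
have p2 : psi s != 0 by near: s.
have sk : s ^+ k != 0 by rewrite expf_neq0// gt_eqF//; near: s; exact: near_pos.
by move: (phi s) (psi s) (s ^+ k) p1 p2 sk => u v w u0 v0 w0; field; rewrite u0 v0 w0.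
Unshelve. all: by end_near. Qed.

(** * Two rotationally symmetric solutions *)

(** With A = D^2 - q^2 and P_s = g one has 1 + A g = q / D and W = 1 / D^2, and the
    equation becomes 3 / D^3 = (3 q - s dq) / D^3.  The letters dq, dA, dD, dg, dW
    are derivatives in s; a, b, u only multiply tangential derivatives of P, which
    are 0. *)
Lemma radial_cmc (R : realType) (s q D A dq dA dD u a b : R) : D != 0 -> q + D != 0 ->
  D ^+ 2 = q ^+ 2 + A -> 3 * q - s * dq = 3 -> 2 * D * dD = 2 * q * dq + dA ->
  let g := - (D * (q + D))^-1 in
  let dg := - (- (D * (q + D)) ^- 2 * (dD * (q + D) + D * (dq + dD))) in
  let W := D ^- 2 in
  let dW := - D ^+ 2 ^- 2 * (2 * D ^+ 1 * dD) in
  3 * (W * D^-1) = 3 * (W * (1 + A * g)) -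
    s * (W * (dA * g + A * dg) - dW * (1 + A * g) / 2
      + u * (W * (0 + 0) - (a * 0 + b * 0) / 2)).
Proof.
move=> D0 qD0 ED Eq EdD g dg W dW.
have EA : A = D ^+ 2 - q ^+ 2 by rewrite ED; ring.
have Ag : 1 + A * g = q / D by rewrite /g EA; field; rewrite D0 qD0.
have E : dA * g + A * dg = dq / D - q * dD / D ^+ 2.
  have EdA : dA = 2 * D * dD - 2 * q * dq by rewrite EdD; ring.
  by rewrite EdA /g /dg EA; field; rewrite D0 qD0.
rewrite Ag E /W /dW.
have -> : 3 * (D ^- 2 * D^-1) = (3 * q - s * dq) / D ^+ 3 by rewrite Eq; field.
by field.
Qed.

Section Example.
Variables (R : realType) (m C : R).
Hypotheses (m0 : 0 <= m) (C0 : 0 <= C <= 1).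

Definition rad_q (s : R) : R := 1 + C * s ^+ 3.
Definition rad_D (s : R) : R := Num.sqrt (rad_q s ^+ 2 + Acoef m s).

(** The root of - (A g^2 + 2 g) = 1 / rad_D^2 that is regular where A = 0. *)
Definition rad_g (s : R) : R := - (rad_D s * (rad_q s + rad_D s))^-1.

(** Starting the integral at a negative number makes this a primitive on a
    neighbourhood of s = 0. *)
Definition rad_G (s : R) : R := (\int[lebesgue_measure]_(t in `[(- 2^-1), s]) rad_g t)%R.
Definition rad_P (y : 'rV[R]_3) (s : R) : R := rad_G s - rad_G 0.

(** Such that 2 m s < 1 still holds for s up to 2 rad_s0. *)
Definition rad_s0 : R := (4 * (m + 1))^-1.

Lemma rad_s0_gt0 : 0 < rad_s0.
Proof. by rewrite /rad_s0 invr_gt0; move: m0; lra. Qed.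

Lemma rad_s0_lt : rad_s0 <= 4^-1.
Proof. by rewrite /rad_s0 lef_pV2 ?posrE; move: m0; lra. Qed.

Lemma m_rad_s0 : 4 * m * rad_s0 < 1.
Proof. by rewrite /rad_s0 ltr_pdivrMr; move: m0; lra. Qed.

Section Point.
Variable s : R.
Hypothesis sI : - 2^-1 <= s <= 2 * rad_s0.

Lemma rad_q_gt0 : 0 < rad_q s.
Proof.
have s1 := rad_s0_lt; have C1 := C0; have sI' := sI.
have s3 : 0 <= C * (s ^+ 3 + 8^-1).
  have -> : s ^+ 3 + 8^-1 = (s + 2^-1) * ((s - 4^-1) ^+ 2 + 3 / 16) by field.
  have := sqr_ge0 (s - 4^-1) => sq.
  by apply: mulr_ge0; last apply: mulr_ge0; lra.
by rewrite /rad_q; lra.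
Qed.

Lemma rad_A_ge0 : 0 <= Acoef m s.
Proof.
have ms := m_rad_s0; have m0' := m0; have sI' := sI.
rewrite mulr_ge0 ?sqr_ge0// subr_ge0.
apply: le_trans (_ : 2 * m * (2 * rad_s0) <= 1); last lra.
by rewrite ler_wpM2l; lra.
Qed.

Lemma rad_D2_gt0 : 0 < rad_q s ^+ 2 + Acoef m s.
Proof. by rewrite ltr_wpDr ?rad_A_ge0// exprn_gt0// rad_q_gt0. Qed.

Lemma rad_D_gt0 : 0 < rad_D s.
Proof. by rewrite sqrtr_gt0 rad_D2_gt0. Qed.

Lemma rad_g_den : rad_D s * (rad_q s + rad_D s) != 0.
Proof.
have D0 := rad_D_gt0; have q0 := rad_q_gt0.
by apply: lt0r_neq0; apply: mulr_gt0 => //; exact: addr_gt0.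
Qed.

Lemma rad_g_cont : {for s, continuous rad_g}.
Proof.
have Xc k : t ^+ k @[t --> s] --> s ^+ k by exact: exprn_continuous.
have cc (u : R) : u @[_ --> s] --> u by exact: cvg_cst.
have qc : rad_q t @[t --> s] --> rad_q s by apply: cvgD => //; apply: cvgM.
have Ac : Acoef m t @[t --> s] --> Acoef m s.
  apply: cvgM => //; apply: cvgB => //; apply: cvgM => //; exact: cvg_id.
have Dc : rad_D t @[t --> s] --> rad_D s.
  apply: (@cvg_comp _ _ _ (fun t => rad_q t ^+ 2 + Acoef m t) Num.sqrt); last exact: sqrt_continuous.
  apply: cvgD => //; exact: cvgM.
apply: cvgN; apply: cvgV; first exact: rad_g_den.
by apply: cvgM => //; apply: cvgD.
Qed.

End Point.

Lemma rad_G_derive s : 0 <= s <= rad_s0 -> is_derive s 1 rad_G (rad_g s).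
Proof.
move=> ss; have s00 := rad_s0_gt0.
have itg : (@lebesgue_measure R).-integrable `[(- 2^-1), 2 * rad_s0] (EFin \o rad_g).
  apply: continuous_compact_integrable; first exact: segment_compact.
  apply/subspace_continuousP => t /=; rewrite in_itv/= => tI.
  by apply: cvg_within_filter; exact: rad_g_cont.
have su : s < 2 * rad_s0 by lra.
have as_ : - 2^-1 < s by lra.
have sI : - 2^-1 <= s <= 2 * rad_s0 by lra.
have [dG EG] := continuous_FTC1_closed su itg as_ (rad_g_cont sI).
by apply: DeriveDef; [exact: dG|rewrite -derive1E].
Qed.

Lemma rad_P_chart c : in_chart c rad_P = fun z : 'rV[R]_(2 + 1) => rad_G (z 0 ord_s) - rad_G 0.
Proof. by []. Qed.

Section Regularity.
Variable D : set 'rV[R]_(2 + 1).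
Hypothesis pD : perfect D.
Hypothesis Ds : forall z, D z -> 0 <= z 0 ord_s <= rad_s0.

Let Dwide z : D z -> - 2^-1 <= z 0 ord_s <= 2 * rad_s0.
Proof. by move=> /Ds; have := rad_s0_gt0; lra. Qed.

Lemma Ck_rad_g k : Ck k D (fun z => rad_g (z 0 ord_s)).
Proof.
have cs u := Ck_cst k u pD.
have Cs := Ck_coord k ord_s pD.
have Cq : Ck k D (fun z => rad_q (z 0 ord_s)).
  exact: CkD pD (cs 1) (CkM pD (cs C) (CkX 3 pD Cs)).
have CA : Ck k D (fun z => Acoef m (z 0 ord_s)).
  apply: CkM pD (CkX 2 pD Cs) (CkD pD (cs 1) (CkN pD (CkM pD (cs (2 * m)) Cs))).
have CD : Ck k D (fun z => rad_D (z 0 ord_s)).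
  apply: Ck_sqrt pD _ (CkD pD (CkX 2 pD Cq) CA) => z /Dwide; exact: rad_D2_gt0.
apply: CkN pD (CkV pD _ (CkM pD CD (CkD pD Cq CD))) => z /Dwide; exact: rad_g_den.
Qed.

Lemma Ck_rad_P c k : Ck k D (in_chart c rad_P).
Proof.
apply: CkS; rewrite rad_P_chart; apply: CkD pD _ (Ck_cst _ _ pD).
by apply: (Ck_antiderivative pD _ (Ck_rad_g k)) => z /Ds; exact: rad_G_derive.
Qed.

Lemma has_pdw_rad_P c i z : D z -> has_pdw D i (in_chart c rad_P) z ((i == ord_s)%:R * rad_g (z 0 ord_s)).
Proof.
move=> Dz; have := has_pdwD (has_pdw_comp_coord D i (rad_G_derive (Ds Dz))) (has_pdw_cst D i (- rad_G 0) z).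
by rewrite addr0.
Qed.

Lemma pdw_rad_P c i z : D z -> pdw D i (in_chart c rad_P) z = (i == ord_s)%:R * rad_g (z 0 ord_s).
Proof. by move=> Dz; rewrite (has_pdw_pdw pD Dz (has_pdw_rad_P c i Dz)). Qed.

End Regularity.

Let D := collar rad_s0.
Let pD : perfect D := perfect_collar rad_s0_gt0.

Let Dwide (z : 'rV[R]_(2 + 1)) : D z -> - 2^-1 <= z 0 ord_s <= 2 * rad_s0.
Proof. by rewrite /D /collar/= => Dz; have := rad_s0_gt0; lra. Qed.

Lemma rad_P_W c z : D z -> Wq m rad_s0 c rad_P z = (rad_D (z 0 ord_s) ^+ 2)^-1.
Proof.
move=> Dz; rewrite /Wq !(pdw_rad_P pD (fun _ H => H)) // eqxx !(negbTE (tang_neq_s _)) !mul0r mul1r.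
rewrite expr0n /= addr0 mulr0 addr0 /Aq /rad_g.
have := sqr_sqrtr (ltW (rad_D2_gt0 (Dwide Dz))); rewrite -/(rad_D _) => E.
have -> : Acoef m (z 0 ord_s) = rad_D (z 0 ord_s) ^+ 2 - rad_q (z 0 ord_s) ^+ 2 by rewrite E; ring.
have := rad_g_den (Dwide Dz); rewrite mulf_eq0 negb_or => /andP[].
by move: (rad_D _) (rad_q _) => d q d0 qd0; field; rewrite d0 qd0.
Qed.

Lemma rad_P_cmc_eq c x s : 0 < s < rad_s0 -> cmc_eq m rad_s0 c rad_P x s.
Proof.
move=> ss; set z := pt x s.
have Dz : D z by rewrite /D collar_pt; lra.
have tz i y : D y -> pdw D (tang i) (in_chart c rad_P) y = 0.
  by move=> Dy; rewrite (pdw_rad_P pD (fun _ H => H)) // (negbTE (tang_neq_s _)) mul0r.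
have sz y : D y -> pdw D ord_s (in_chart c rad_P) y = rad_g (y 0 ord_s).
  by move=> Dy; rewrite (pdw_rad_P pD (fun _ H => H)) // eqxx mul1r.
have Hq : has_pdw D ord_s (fun y => rad_q (y 0 ord_s)) z (3 * C * s ^+ 2).
  have H := has_pdw_coord D ord_s ord_s z; rewrite eqxx mulr1n in H.
  apply: has_pdw_conv (has_pdwD (has_pdw_cst D ord_s 1 z) (has_pdwZ C (has_pdwX 2 H))) _ _ => //.
  by rewrite pt_s; ring.
have HA := has_pdw_Aq m rad_s0 z; rewrite -/D pt_s in HA.
have Hsq : has_pdw D ord_s (fun y => rad_D (y 0 ord_s)) z
    ((2 * rad_D s)^-1 * (2 * rad_q s * (3 * C * s ^+ 2) + (2 * s - 6 * m * s ^+ 2))).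
  have := has_pdw_sqrt (rad_D2_gt0 (Dwide Dz)) (has_pdwD (has_pdwX 1 Hq) HA).
  by rewrite expr1 /Aq pt_s.
move: Hsq; set dD := (X in has_pdw _ _ _ _ X) => HD.
have DD y : D y -> rad_D (y 0 ord_s) * (rad_q (y 0 ord_s) + rad_D (y 0 ord_s)) != 0.
  by move=> /Dwide; exact: rad_g_den.
have Hg := has_pdwN (has_pdwV (DD z Dz) (has_pdwM HD (has_pdwD Hq HD))).
have d2 : rad_D (z 0 ord_s) ^+ 2 != 0.
  by rewrite expf_neq0//; have := DD z Dz; rewrite mulf_eq0 negb_or => /andP[].
have HW := has_pdwV d2 (has_pdwX 1 HD).
have Wz y : D y -> Wq m rad_s0 c rad_P y = (rad_D (y 0 ord_s) ^+ 2)^-1 by exact: rad_P_W.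
rewrite /cmc_eq -/z.
rewrite (@pdw_eq _ _ D ord_s (pdw D ord_s (in_chart c rad_P)) (fun y => rad_g (y 0 ord_s)) z Dz); last by move=> y /[!inE]; exact: sz.
rewrite (@pdw_eq _ _ D ord_s (Wq m rad_s0 c rad_P) (fun y => (rad_D (y 0 ord_s) ^+ 2)^-1) z Dz); last by move=> y /[!inE]; exact: Wz.
have t0 i : pdw D (tang i) (pdw D (tang i) (in_chart c rad_P)) z = 0.
  rewrite (@pdw_eq _ _ D (tang i) _ (fun=> 0) z Dz); last by move=> y /[!inE]; exact: tz.
  exact: has_pdw_pdw pD Dz (has_pdw_cst _ _ _ _).
rewrite (has_pdw_pdw pD Dz Hg) (has_pdw_pdw pD Dz HW) -/D !t0 !tz// sz// Wz// /z pt_s.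
rewrite sqrtrV ?sqr_ge0// sqrtr_sqr gtr0_norm ?rad_D_gt0//; last by move: (Dwide Dz); rewrite pt_s.
have sw : - 2^-1 <= s <= 2 * rad_s0 by have := Dwide Dz; rewrite pt_s.
have Ds0 := lt0r_neq0 (rad_D_gt0 sw).
have qD0 := lt0r_neq0 (addr_gt0 (rad_q_gt0 sw) (rad_D_gt0 sw)).
apply: radial_cmc => //.
- exact: sqr_sqrtr (ltW (rad_D2_gt0 sw)).
- by rewrite /rad_q; ring.
- by rewrite /dD mulVKf// mulf_neq0 ?pnatr_eq0.
Qed.

Lemma rad_P_spacelike_cmc1 : spacelike_cmc1 m rad_s0 rad_P.
Proof.
have s00 := rad_s0_gt0.
split=> //; first by have := m_rad_s0; move: m0; lra.
  move=> c k; apply: (Ck_rad_P (perfect_open_collar s00)) => z /=.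
  by rewrite /open_collar/=; lra.
move=> c x s ss; have Dz : D (pt x s) by rewrite /D collar_pt; lra.
have CF : Ck 2 D (in_chart c rad_P) by exact: (Ck_rad_P pD).
have W0 : 0 < Wq m rad_s0 c rad_P (pt x s).
  by rewrite rad_P_W// invr_gt0 exprn_gt0// (rad_D_gt0 (Dwide Dz)).
split; last exact/(cmc_eqP s00 CF ss W0)/rad_P_cmc_eq.
have tz i : pdw D (tang i) (in_chart c rad_P) (pt x s) = 0.
  by rewrite (pdw_rad_P pD (fun _ H => H)) // (negbTE (tang_neq_s _)) mul0r.
by apply: (spacelike_radial s00 CF); rewrite ?graph_point_proj ?graph_point_s//; exact: tz.
Qed.

Lemma rad_P_boundary y : rad_P y 0 = 0.
Proof. by rewrite /rad_P subrr. Qed.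

Lemma rad_P_Ck k : Ck_up_to_scri k rad_s0 rad_P.
Proof. by move=> c; exact: (Ck_rad_P pD). Qed.

End Example.

Lemma neq_of_sub (R : realType) (a b c : R) : a - b = c -> c != 0 -> a <> b.
Proof. by move=> <- /eqP ab e; apply: ab; rewrite e subrr. Qed.

(** The functions rad_q differ by s^3, hence so do the functions rad_D, and the
    derivatives P_s differ by s^3 + o(s^3); P_ssss then differs by 6. *)
Lemma rad_P_ds4 (R : realType) (m : R) : 0 <= m -> forall c x,
  scri_ds (rad_s0 m) c 4 (rad_P m 1) x <> scri_ds (rad_s0 m) c 4 (rad_P m 0) x.
Proof.
move=> m0 c x; have s00 := rad_s0_gt0 m0; set s0 := rad_s0 m in s00 *.
have C1 : 0 <= (1:R) <= 1 by rewrite ler01 lexx.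
have C0 : 0 <= (0:R) <= 1 by rewrite ler01 lexx.
rewrite !scri_dsE -(ds_at0_s s0 (in_chart c (rad_P m 1)) 3 x) -(ds_at0_s s0 (in_chart c (rad_P m 0)) 3 x).
have pD := perfect_collar s00.
have C4 C (CC : 0 <= C <= 1) : Ck 3 (collar s0) (pdw (collar s0) ord_s (in_chart c (rad_P m C))).
  exact/Ck_pdw/(Ck_rad_P m0 CC pD).
have LA := contact_same 3 (Acoef_lim0 m).
have Lq : contact 3 (rad_q 1) (rad_q 0) (1 : R) 1.
  have L C : lim0 (rad_q C) (1 : R).
    have := lim0D (lim0_cst 1) (lim0M (lim0_cst C) (expr_lim0 R 2)).
    by rewrite mulr0 addr0.
  split; try exact: L; apply: lim0_eq (lim0_cst 1) => s s1.
  by rewrite /rad_q; field; rewrite gt_eqF.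
have LD : contact 3 (rad_D m 1) (rad_D m 0) 1 1.
  have DE C : rad_D m C = fun s => Num.sqrt (rad_q C s * rad_q C s + Acoef m s).
    by apply/funext => s; rewrite /rad_D expr2.
  have := contactD (contactM Lq Lq) LA; rewrite mulr1 addr0 => /contact_sqrt.
  by rewrite !DE addr0 mulfV ?pnatr_eq0.
have d0 : 1 * (1 + 1) != 0 :> R by rewrite gt_eqF//; lra.
have [G1 G2 G3] := contactN (contactV d0 (contactM LD (contactD Lq LD))).
have E C (CC : 0 <= C <= 1) : \forall s \near (0:R)^'+,
    rad_g m C s = pdw (collar s0) ord_s (in_chart c (rad_P m C)) (pt x s).
  apply: (near_rightP s00) => s ss.
  rewrite (pdw_rad_P m0 CC pD (fun _ H => H)) ?eqxx ?mul1r ?pt_s//.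
  by rewrite collar_pt; lra.
have L : contact 3 (fun s => pdw (collar s0) ord_s (in_chart c (rad_P m 1)) (pt x s))
    (fun s => pdw (collar s0) ord_s (in_chart c (rad_P m 0)) (pt x s))
    (- (1 * (1 + 1))^-1) (- - ((1 * (1 + 1) + 1 * (1 + 1)) / (1 * (1 + 1)) ^+ 2)).
  split; [exact: lim0_near (E _ C1) G1|exact: lim0_near (E _ C0) G2|].
  apply: lim0_near G3; apply: filterS2 (E _ C1) (E _ C0) => s e1 e0.
  by rewrite -e1 -e0.
have [_ H] := contact_ds_at0 s00 s00 (C4 _ C1) (C4 _ C0) L.
apply: (neq_of_sub H).
by rewrite mulf_neq0 ?pnatr_eq0// gt_eqF//; lra.
Qed.

(** * The theorem *)

Section Main.
Variables (R : realType) (m : R).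
Hypothesis m0 : 0 <= m.
Implicit Types (P Q : 'rV[R]_3 -> R -> R).

Lemma determined_by_boundary s0 P c x : spacelike_cmc1 m s0 P -> Ck_up_to_scri 4 s0 P ->
  [/\ scri_ds s0 c 1 P x = deval c (df1 R) (boundary_value P c) x,
      scri_ds s0 c 2 P x = deval c (df2 R) (boundary_value P c) x &
      scri_ds s0 c 3 P x = deval c (df3 R) (boundary_value P c) x].
Proof.
move=> cmcP C4; have s00 := cmc_s0 cmcP.
have C2 : Ck_up_to_scri 2 s0 P by move=> c'; exact: Ck_le (C4 c').
have W1 := cmc_W1 m0 cmcP C2 c; have E := @cmc_equation _ _ _ _ m0 cmcP C2 c.
rewrite !scri_dsE (boundary_valueE s0).
split.
- by rewrite (a1E s00 (C4 c) W1 E) deval_df1.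
- by rewrite (a2E s00 (C4 c) W1 E) deval_df2.
- exact: a3E s00 (C4 c) W1 E x.
Qed.

Lemma expansion_determined s0 t0 P Q :
  spacelike_cmc1 m s0 P -> smooth_up_to_scri s0 P ->
  spacelike_cmc1 m t0 Q -> smooth_up_to_scri t0 Q ->
  (forall y, sphere y -> P y 0 = Q y 0) ->
  (forall c x, scri_ds s0 c 4 P x = scri_ds t0 c 4 Q x) ->
  forall c l x, scri_derivative s0 c l P x = scri_derivative t0 c l Q x.
Proof.
move=> cmcP CP cmcQ CQ PQ0 PQ4 c l x.
have s00 := cmc_s0 cmcP; have t00 := cmc_s0 cmcQ.
have CP' k : Ck_up_to_scri k s0 P by move=> c'; exact: CP.
have CQ' k : Ck_up_to_scri k t0 Q by move=> c'; exact: CQ.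
have f0 : boundary_value P c = boundary_value Q c.
  by apply/funext => y; exact: PQ0 (stereo_sphere c y).
have B y := determined_by_boundary c y cmcP (CP' 4).
have B' y := determined_by_boundary c y cmcQ (CQ' 4).
have H := ds_at0_determined s00 t00 (CP c) (CQ c) (cmc_W1 m0 cmcP (CP' 2) c)
  (cmc_W1 m0 cmcQ (CQ' 2) c) (@cmc_equation _ _ _ _ m0 cmcP (CP' 2) c)
  (@cmc_equation _ _ _ _ m0 cmcQ (CQ' 2) c).
rewrite /scri_derivative -!pt0.
apply: (congr1 (fun g => g x) (pdws_determined l s00 t00 (CP c) (CQ c) (H _ _ _ _ _) 0)).
- by rewrite -!boundary_valueE.
- by apply/funext => y; rewrite -!scri_dsE; case: (B y) (B' y) => -> _ _ [-> _ _]; rewrite f0.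
- by apply/funext => y; rewrite -!scri_dsE; case: (B y) (B' y) => _ -> _ [_ -> _]; rewrite f0.
- by apply/funext => y; rewrite -!scri_dsE; case: (B y) (B' y) => _ _ -> [_ _ ->]; rewrite f0.
- by apply/funext => y; rewrite -!scri_dsE.
Qed.

End Main.

Theorem theorem1p1 (R : realType) (m : R) (hm : 0 <= m) :
  (* (i) *)
  (exists E1 E2 E3 : dexpr R,
    forall (s0 : R) (P : 'rV[R]_3 -> R -> R),
      spacelike_cmc1 m s0 P -> Ck_up_to_scri 4 s0 P ->
      forall (c : bool) (x : 'rV[R]_2),
        [/\ scri_ds s0 c 1 P x = deval c E1 (boundary_value P c) x,
            scri_ds s0 c 2 P x = deval c E2 (boundary_value P c) x &
            scri_ds s0 c 3 P x = deval c E3 (boundary_value P c) x]) /\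
  (* (ii) *)
  (exists (s0 t0 : R) (P Q : 'rV[R]_3 -> R -> R),
    [/\ spacelike_cmc1 m s0 P /\ Ck_up_to_scri 4 s0 P,
        spacelike_cmc1 m t0 Q /\ Ck_up_to_scri 4 t0 Q,
        forall y, sphere y -> P y 0 = Q y 0 &
        exists (c : bool) (x : 'rV[R]_2),
          scri_ds s0 c 4 P x <> scri_ds t0 c 4 Q x]) /\
  (* (iii) *)
  (forall (s0 : R) (P : 'rV[R]_3 -> R -> R),
    spacelike_cmc1 m s0 P -> Ck_up_to_scri 4 s0 P ->
    forall (c : bool) (x : 'rV[R]_2),
      let f := boundary_value P c in
      0 = 5 / 2 * l2 c f x * Slap c f x + 3 / 4 * l1 c f x ^+ 3
          - 4 * l1 c f x * Slap c (f1 c f) x - 2 * Slap c (f2 c f) x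
          + 6 * l1 c f x * f1 c f x
          + Sdot c (l2 c f) f x + 2 * Sdot c (l1 c f) (f1 c f) x) /\
  (* (iv) *)
  (forall (s0 t0 : R) (P Q : 'rV[R]_3 -> R -> R),
    spacelike_cmc1 m s0 P -> smooth_up_to_scri s0 P ->
    spacelike_cmc1 m t0 Q -> smooth_up_to_scri t0 Q ->
    (forall y, sphere y -> P y 0 = Q y 0) ->
    (forall (c : bool) (x : 'rV[R]_2),
      scri_ds s0 c 4 P x = scri_ds t0 c 4 Q x) ->
    forall (c : bool) (x : 'rV[R]_2) (l : seq 'I_(2 + 1)),
      scri_derivative s0 c l P x = scri_derivative t0 c l Q x).
Proof.
have C1 : 0 <= (1:R) <= 1 by rewrite ler01 lexx.
have C0 : 0 <= (0:R) <= 1 by rewrite ler01 lexx.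
split; [|split; [|split]].
- exists (df1 R), (df2 R), (df3 R) => s0 P cmcP C4 c x.
  exact (determined_by_boundary hm c x cmcP C4).
- exists (rad_s0 m), (rad_s0 m), (rad_P m 1), (rad_P m 0); split.
  + by split; [exact: rad_P_spacelike_cmc1|exact: rad_P_Ck].
  + by split; [exact: rad_P_spacelike_cmc1|exact: rad_P_Ck].
  + by move=> y _; rewrite !rad_P_boundary.
  + exists false, 0; exact (@rad_P_ds4 R m hm false 0).
- move=> s0 P cmcP C4 c x f.
  have C2 : Ck_up_to_scri 2 s0 P by move=> c'; exact: Ck_le (C4 c').
  rewrite /f (boundary_valueE s0).
  exact (compatibility (cmc_s0 cmcP) (C4 c) (cmc_W1 hm cmcP C2 c)
    (@cmc_equation _ _ _ _ hm cmcP C2 c) x).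
- move=> s0 t0 P Q cmcP CP cmcQ CQ PQ0 PQ4 c x l.
  exact (expansion_determined hm cmcP CP cmcQ CQ PQ0 PQ4 c l x).
Qed.
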